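(* Let $a\in\mathbb{Q}\setminus\mathbb{Z}$, $a>-1$. For $n\ge0$ let $$p_n=\sum_{k=0}^n\binom{n+a}{k}\binom{n-a}{n-k}(n+k)!,\qquad q_n=\sum_{k=0}^n\binom{n-a}{k}\binom{n+a}{n-k}(a+1)_{n+k}.$$ Then both sequences $f_n=p_n$ and $f_n=q_n$ satisfy, for all $n\ge1$, the third-order recurrence $$\lambda_2(n,a)f_{n+2}+\lambda_1(n,a)f_{n+1}+\lambda_0(n,a)f_n+\lambda_{-1}(n,a)f_{n-1}=0,$$ where $$\begin{aligned} \lambda_2(n,a)&=(n+2)(16n^3+20n^2a+10na^2+2a^3+17n^2+14na+3a^2+n-a),\\ \lambda_1(n,a)&=-128n^6-224n^5a-112n^4a^2+20n^3a^3+42n^2a^4+16na^5+2a^6-808n^5\\ &\quad-1228n^4a-601n^3a^2-45n^2a^3+47na^4+11a^5-1910n^4-2446n^3a\\ &\quad-1085n^2a^2-176na^3-3a^4-2035n^3-2063n^2a-715na^2-91a^3-887n^2\\ &\quad-592na-113a^2-82n+14a,\\ \lambda_0(n,a)&=(n-a+1)(n+a+1)(256n^6+576n^5a+544n^4a^2+272n^3a^3+72n^2a^4\\ &\quad+8na^5+1296n^5+2384n^4a+1724n^3a^2+596n^2a^3+92na^4+4a^5+2448n^4\\ &\quad+3518n^3a+1840n^2a^2+404na^3+30a^4+2185n^3+2333n^2a+817na^2+93a^3\\ &\quad+923n^2+668na+125a^2+146n+58a),\\ \lambda_{-1}(n,a)&=-(n-a)(n-a+1)(n+a+1)(16n^3+20n^2a+10na^2+2a^3+65n^2\\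 &\quad+54na+13a^2+83n+33a+34)(n+a)^2, \end{aligned}$$ with the initial conditions $$p_0=1,\quad p_1=3+a,\quad p_2=50+33a+7a^2,$$ $$q_0=1,\quad q_1=(a+1)(3-a^2),\quad q_2=(a+1)(a+2)(a^4+2a^3-12a^2-11a+50)/2,$$ and $$\Gamma(a+1)-\frac{p_n}{q_n}=e^{-2\sqrt{2n}}\Bigl(\frac{2\pi a}{\Gamma(1-a)}+O(n^{-1/2})\Bigr)\qquad\text{as } n\to\infty.$$
   Context: $(a)_0=1$ and $(a)_m=a(a+1)\cdots(a+m-1)$ for $m\ge1$ is the Pochhammer symbol. For real $\alpha$ and an integer $k\ge 0$, $\binom{\alpha}{k}=\alpha(\alpha-1)\cdots(\alpha-k+1)/k!$. The implied constant in $O(\cdot)$ may depend on $a$. *)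

(* Defs.v *)
From HB Require Import structures.
From mathcomp Require Import all_boot all_order all_algebra.
From mathcomp Require Import all_classical all_reals all_analysis.
Import Order.TTheory GRing.Theory Num.Theory.
Import numFieldNormedType.Exports.

Set Implicit Arguments.
Unset Strict Implicit.
Unset Printing Implicit Defensive.

Local Open Scope classical_set_scope.
Local Open Scope ring_scope.

Definition poch (R : pzRingType) (x : R) (m : nat) : R :=
  \prod_(i < m) (x + i%:R).

Definition gbinom (F : fieldType) (x : F) (k : nat) : F :=
  (\prod_(i < k) (x - i%:R)) / k`!%:R.

Definition eulerGamma_integral (R : realType) (x : R) : R :=
  \int[lebesgue_measure]_(t in `]0, +oo[) (t `^ (x - 1) * expR (- t)).

(* Euler's integral for [0 < x], extended to the other non-integer [x] by
   Gamma (x + m) = poch x m * Gamma x with [m] the least natural number such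
   that [0 < x + m].  At the poles 0, -1, -2, ... the value is the junk 0. *)
Definition Gamma (R : realType) (x : R) : R :=
  if 0 < x then eulerGamma_integral x
  else let m := (Num.truncn (- x)).+1 in
       eulerGamma_integral (x + m%:R) / poch x m.

Definition p_seq (F : fieldType) (a : F) (n : nat) : F :=
  \sum_(k < n.+1)
     gbinom (n%:R + a) k * gbinom (n%:R - a) (n - k) * ((n + k)`!)%:R.

Definition q_seq (F : fieldType) (a : F) (n : nat) : F :=
  \sum_(k < n.+1)
     gbinom (n%:R - a) k * gbinom (n%:R + a) (n - k) * poch (a + 1) (n + k).

Definition lambda2 (R : comPzRingType) (n a : R) : R :=
   (n + 2) * (16 * n ^+ 3 + 20 * n ^+ 2 * a + 10 * n * a ^+ 2 + 2 * a ^+ 3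
    + 17 * n ^+ 2 + 14 * n * a + 3 * a ^+ 2 + n - a).

Definition lambda1 (R : comPzRingType) (n a : R) : R :=
   - 128 * n ^+ 6 - 224 * n ^+ 5 * a - 112 * n ^+ 4 * a ^+ 2
    + 20 * n ^+ 3 * a ^+ 3 + 42 * n ^+ 2 * a ^+ 4 + 16 * n * a ^+ 5
    + 2 * a ^+ 6 - 808 * n ^+ 5
    - 1228 * n ^+ 4 * a - 601 * n ^+ 3 * a ^+ 2 - 45 * n ^+ 2 * a ^+ 3
    + 47 * n * a ^+ 4 + 11 * a ^+ 5 - 1910 * n ^+ 4 - 2446 * n ^+ 3 * a
    - 1085 * n ^+ 2 * a ^+ 2 - 176 * n * a ^+ 3 - 3 * a ^+ 4 - 2035 * n ^+ 3
    - 2063 * n ^+ 2 * a - 715 * n * a ^+ 2 - 91 * a ^+ 3 - 887 * n ^+ 2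
    - 592 * n * a - 113 * a ^+ 2 - 82 * n + 14 * a.

Definition lambda0 (R : comPzRingType) (n a : R) : R :=
   (n - a + 1) * (n + a + 1) * (256 * n ^+ 6 + 576 * n ^+ 5 * a
    + 544 * n ^+ 4 * a ^+ 2 + 272 * n ^+ 3 * a ^+ 3 + 72 * n ^+ 2 * a ^+ 4
    + 8 * n * a ^+ 5 + 1296 * n ^+ 5 + 2384 * n ^+ 4 * a
    + 1724 * n ^+ 3 * a ^+ 2 + 596 * n ^+ 2 * a ^+ 3 + 92 * n * a ^+ 4
    + 4 * a ^+ 5 + 2448 * n ^+ 4
    + 3518 * n ^+ 3 * a + 1840 * n ^+ 2 * a ^+ 2 + 404 * n * a ^+ 3
    + 30 * a ^+ 4 + 2185 * n ^+ 3 + 2333 * n ^+ 2 * a + 817 * n * a ^+ 2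
    + 93 * a ^+ 3
    + 923 * n ^+ 2 + 668 * n * a + 125 * a ^+ 2 + 146 * n + 58 * a).

Definition lambdam1 (R : comPzRingType) (n a : R) : R :=
   - (n - a) * (n - a + 1) * (n + a + 1) * (16 * n ^+ 3 + 20 * n ^+ 2 * a
    + 10 * n * a ^+ 2 + 2 * a ^+ 3 + 65 * n ^+ 2
    + 54 * n * a + 13 * a ^+ 2 + 83 * n + 33 * a + 34) * (n + a) ^+ 2.

Definition recurrence (R : comPzRingType) (a : R) (f : nat -> R) : Prop :=
  forall n : nat, (1 <= n)%N ->
    lambda2 n%:R a * f n.+2 + lambda1 n%:R a * f n.+1
    + lambda0 n%:R a * f n + lambdam1 n%:R a * f n.-1 = 0.

(* Main.v *)
Require Import Defs.
From HB Require Import structures.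
From mathcomp Require Import all_boot all_order all_algebra.
From mathcomp Require Import all_classical all_reals all_analysis.
From mathcomp Require Import measurable_realfun ring lra zify.
Set Implicit Arguments.
Unset Strict Implicit.
Unset Printing Implicit Defensive.

Import Order.TTheory GRing.Theory Num.Theory.
Import numFieldNormedType.Exports.
Local Open Scope classical_set_scope.
Local Open Scope ring_scope.

(* Let [x ^ a * B(x) - A(x)] be the error of the diagonal Pade approximation of
   [x ^ a] at 1.  Integrating [x ^ n * (x ^ a * B(x) - A(x))] against [expR (- x)]
   gives the linear form [q_n Gamma(a + 1) - p_n].

   With [x = y ^ 2] a second order differential equation shows that the error is
   [K y ^ (a - 1/2) (y - 1) ^ (2 n + 1) (1 + O((y - 1) / n))], uniformly for
   [y > 1].  Near the saddle [y = sqrt (2 n)], the factor [(1 - 1/y) ^ (2 n + 1)]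
   is [expR (- sqrt (2 n) - 1/2)] times a power of [y], so the linear form is
   [K expR (- sqrt (2 n) - 3/8) Gamma(2 n + a/2 + 5/4) (1 + O(n ^ (- 1/2)))].

   The denominator [q_n] is a sum of [w ^ (2 j) / (2 j)!], [w = sqrt (2 n)], against
   a slowly varying factor, and concentrates at [j = w / 2]; this contributes
   [expR w / 2].  Together they give [expR (- 2 w)]; the powers of [n] cancel.

   The recurrence is creative telescoping. *)

(** * Derivatives of real functions *)

(** The obstacle is the cancellation in [q_n Gamma(a + 1) - p_n]: separate estimates of the two
    sequences do not survive it. The form is therefore kept as one integral. As Gamma moments of
    powers are explicit, the integrand is only ever compared with finite sums of powers of [x]. With
    [s = sqrt (2 n)], the factor [(1 - 1/y) ^ (2 n + 1)] is replaced by
    [expR (- s - 1/2) (x / (2 n)) ^ m], [m] the integer part of [s / 2], and the relative error is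
    dominated by [((x / (2 n)) ^ r + (2 n / x) ^ r) / s] with [r] of order [s]. Powers of order [s]
    have bounded moments under a Gamma law of mean about [s ^ 2], so an error [O(1 / s)] remains.

    The exponent [-3/8] is [-1/2] from that factor plus [1/8] from the [m]-th moment. The central
    term of the denominator carries the same [-3/8], and the two cancel. The [pi] of the limit is
    [Gamma(1/2) ^ 2]: one factor comes from the central binomial coefficient inside [K], the other
    from trading the factorials of [q_n] for [(2 j)!]. *)

Section DeriveReal.
Variable R : realType.
Implicit Types (f g : R -> R) (x c df dg : R).

(** Derivatives below are assembled as proof terms; the value such a term carries is rarely in the
    wanted form, and this lets a [ring] or [field] identity correct it afterwards. *)
Lemma is_derive1_eq f x df dg : is_derive x 1 f df -> df = dg -> is_derive x 1 f dg.
Proof. by move=> + <-. Qed.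

Lemma is_derive1_ext f g x df : f =1 g -> is_derive x 1 f df -> is_derive x 1 g df.
Proof. by move=> /funext ->. Qed.

Lemma is_derive1C c x : is_derive x 1 (fun=> c) 0.
Proof. exact: is_derive_cst. Qed.

Lemma is_derive1id x : is_derive x 1 (fun t : R => t) 1.
Proof. exact: is_derive_id. Qed.

Lemma is_derive1D f g x df dg : is_derive x 1 f df -> is_derive x 1 g dg ->
  is_derive x 1 (fun t => f t + g t) (df + dg).
Proof. exact: is_deriveD. Qed.

Lemma is_derive1B f g x df dg : is_derive x 1 f df -> is_derive x 1 g dg ->
  is_derive x 1 (fun t => f t - g t) (df - dg).
Proof. exact: is_deriveB. Qed.

Lemma is_derive1N f x df : is_derive x 1 f df -> is_derive x 1 (fun t => - f t) (- df).
Proof. exact: is_deriveN. Qed.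

Lemma is_derive1M f g x df dg : is_derive x 1 f df -> is_derive x 1 g dg ->
  is_derive x 1 (fun t => f t * g t) (df * g x + f x * dg).
Proof.
move=> Hf Hg; apply: is_derive1_eq (is_deriveM Hf Hg) _.
by rewrite /GRing.scale /= addrC mulrC.
Qed.

Lemma is_derive1Z c f x df : is_derive x 1 f df -> is_derive x 1 (fun t => c * f t) (c * df).
Proof.
by move=> Hf; apply: is_derive1_eq (is_derive1M (is_derive1C c x) Hf) _; rewrite mul0r add0r.
Qed.

Lemma is_derive1cmp f g x df dg : is_derive (g x) 1 f df -> is_derive x 1 g dg ->
  is_derive x 1 (fun t => f (g t)) (df * dg).
Proof. exact: is_derive1_comp. Qed.

Lemma is_derive1X f n x df : is_derive x 1 f df ->
  is_derive x 1 (fun t => f t ^+ n) (n%:R * f x ^+ n.-1 * df).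
Proof.
elim: n => [|n IH] Hf.
  by apply: is_derive1_ext (is_derive1_eq (is_derive1C 1 x) _) => [t|];
     rewrite ?expr0 // !mul0r.
apply: is_derive1_ext (is_derive1_eq (is_derive1M Hf (IH Hf)) _) => [t|].
  by rewrite exprS.
case: n {IH} => [|n]; first by rewrite /= !expr0; ring.
by rewrite /= exprS -[in RHS]natr1; ring.
Qed.

Lemma is_derive1I f x df : is_derive x 1 f df -> f x != 0 ->
  is_derive x 1 (fun t => (f t)^-1) (- df / f x ^+ 2).
Proof.
move=> Hf fx; apply: is_derive1_eq (is_deriveV fx Hf) _.
by rewrite /GRing.scale /=; ring.
Qed.

Lemma is_derive1exp f x df : is_derive x 1 f df ->
  is_derive x 1 (fun t => expR (f t)) (expR (f x) * df).
Proof. by move=> Hf; exact: (is_derive1cmp (is_derive_expR (f x)) Hf). Qed.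

Lemma is_derive1pow f c x df : 0 < f x -> is_derive x 1 f df ->
  is_derive x 1 (fun t => f t `^ c) (c * f x `^ (c - 1) * df).
Proof. by move=> fx Hf; exact: (is_derive1cmp (is_derive1_powR c fx) Hf). Qed.

Lemma is_derive1ln f x df : is_derive x 1 f df -> 0 < f x ->
  is_derive x 1 (fun t => ln (f t)) (df / f x).
Proof.
move=> Hf fx; apply: is_derive1_eq (is_derive1cmp (is_derive1_ln fx) Hf) _.
by rewrite mulrC.
Qed.

Lemma is_derive1_continuous f x df : is_derive x 1 f df -> {for x, continuous f}.
Proof. by move=> [d _]; apply: differentiable_continuous; exact/derivable1_diffP. Qed.

(** The mean value theorem writes the increment as a nonnegative derivative times [b - a].
    Comparisons of a function with an explicit majorant go through this form. *)
Lemma ge0_derive1_nondecreasing f (f1 : R -> R) (a b : R) : a <= b ->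
  (forall x, a <= x <= b -> {for x, continuous f}) ->
  (forall x, a < x < b -> is_derive x 1 f (f1 x)) ->
  (forall x, a < x < b -> 0 <= f1 x) -> f a <= f b.
Proof.
move=> ab cf Hf df0.
move: ab; rewrite le_eqVlt => /predU1P[->//|ab].
have H1 x : x \in `]a, b[%R -> is_derive x 1 f (f1 x) by rewrite in_itv => /Hf.
have H2 : {within `[a, b], continuous f}.
  by apply: continuous_in_subspaceT => x /set_mem /=; rewrite in_itv => /cf.
have [c] := MVT ab H1 H2; rewrite in_itv /= => /df0 cab E.
by rewrite -subr_ge0 E mulr_ge0 // subr_ge0 ltW.
Qed.

End DeriveReal.

(** * Sequences tending to 1 at a given rate *)

Section Near1.
Variable R : realType.
Implicit Types (r u v : nat -> R).

Definition rate r := (forall n, 0 <= r n) /\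
  (forall e, 0 < e -> exists N, forall n, (N <= n)%N -> r n <= e).

Definition bigOn r v := exists C N, forall n, (N <= n)%N -> `|v n| <= C * r n.

(** Asymptotic equivalence with a rate. Being closed under products and inverses, it lets the final
    asymptotics be composed factor by factor, without explicit constants. *)
Definition near1 r u := bigOn r (fun n => u n - 1).

Lemma bigOnC0 r v : rate r -> bigOn r v ->
  exists C N, 0 <= C /\ forall n, (N <= n)%N -> `|v n| <= C * r n.
Proof.
move=> [r0 _] [C [N H]]; exists `|C|, N; split => // n /H.
by move=> /le_trans; apply; rewrite ler_wpM2r // ler_norm.
Qed.

Lemma bigOn_eq r v w N : (forall n, (N <= n)%N -> v n = w n) -> bigOn r v -> bigOn r w.
Proof.
move=> E [C [M H]]; exists C, (maxn N M) => n; rewrite geq_max => /andP[nN nM].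
by rewrite -E // H.
Qed.

Lemma bigOn_le r v w C N : rate r -> (forall n, (N <= n)%N -> `|w n| <= C * `|v n|) ->
  bigOn r v -> bigOn r w.
Proof.
move=> rr E /(bigOnC0 rr) [D [M [D0 H]]].
exists (`|C| * D), (maxn N M) => n; rewrite geq_max => /andP[nN nM].
apply: le_trans (E _ nN) _; apply: le_trans (_ : `|C| * `|v n| <= _).
  by rewrite ler_wpM2r // ler_norm.
by rewrite -mulrA ler_wpM2l // H.
Qed.

Lemma bigOn_rate r r' v : rate r -> (forall n, r n <= r' n) -> bigOn r v -> bigOn r' v.
Proof.
move=> rr E /(bigOnC0 rr) [D [M [D0 H]]]; exists D, M => n /H /le_trans; apply.
exact: ler_wpM2l.
Qed.

Lemma bigOnD r v w : rate r -> bigOn r v -> bigOn r w -> bigOn r (fun n => v n + w n).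
Proof.
move=> [r0 _] [C [M H]] [D [M' H']]; exists (C + D), (maxn M M') => n.
rewrite geq_max => /andP[/H h /H' h']; rewrite mulrDl.
by apply: le_trans (ler_normD _ _) _; exact: lerD.
Qed.

Lemma bigOn_small r v e : rate r -> bigOn r v -> 0 < e ->
  exists N, forall n, (N <= n)%N -> `|v n| <= e.
Proof.
move=> rr /(bigOnC0 rr) [C [M [C0 H]]] e0.
have [N HN] := rr.2 (e / (C + 1)) (divr_gt0 e0 (ltr_wpDl C0 ltr01)).
exists (maxn M N) => n; rewrite geq_max => /andP[/H h /HN h'].
apply: le_trans h _; apply: le_trans (ler_wpM2l C0 h') _.
rewrite mulrCA -[leRHS]mulr1 ler_pM2l // ler_pdivrMr; last by rewrite ltr_wpDl.
by rewrite mul1r lerDl.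
Qed.

Lemma near1_ev r u e : rate r -> near1 r u -> 0 < e ->
  exists N, forall n, (N <= n)%N -> 1 - e <= u n <= 1 + e.
Proof.
move=> rr nu e0; have [N H] := bigOn_small rr nu e0.
by exists N => n /H; rewrite ler_distl.
Qed.

Lemma near1_eq r u v N : (forall n, (N <= n)%N -> u n = v n) -> near1 r u -> near1 r v.
Proof. by move=> E; apply: (bigOn_eq (N := N)) => n /E ->. Qed.

Lemma near1M r u v : rate r -> near1 r u -> near1 r v -> near1 r (fun n => u n * v n).
Proof.
move=> rr nu nv; have [N H] := near1_ev rr nv ltr01.
have : bigOn r (fun n => `|u n - 1| * 2 + `|v n - 1|).
  apply: bigOnD => //.
    by apply: (bigOn_le (N := 0%N) (C := 2) rr _ nu) => n _; rewrite normrM normr_id (ger0_norm (ler0n R 2)) mulrC.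
  by apply: (bigOn_le (N := 0%N) (C := 1) rr _ nv) => n _; rewrite normr_id mul1r.
apply: (bigOn_le (N := N) (C := 1) rr) => n /H vn.
rewrite mul1r [X in _ <= X]ger0_norm; last by rewrite addr_ge0 ?mulr_ge0.
have -> : u n * v n - 1 = (u n - 1) * v n + (v n - 1) by ring.
apply: le_trans (ler_normD _ _) _; rewrite lerD2r normrM ler_wpM2l //.
by rewrite ler_norml; lra.
Qed.

Lemma near1V r u : rate r -> near1 r u -> near1 r (fun n => (u n)^-1).
Proof.
move=> rr nu; have h : 0 < 2^-1 :> R by [].
have [N H] := near1_ev rr nu h.
apply: (bigOn_le (N := N) (C := 2) rr _ nu) => n /H un.
have u0 : 0 < u n by lra.
have -> : (u n)^-1 - 1 = (1 - u n) / u n by field; rewrite gt_eqF.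
rewrite normrM distrC mulrC ler_wpM2r // normfV gtr0_norm //.
by rewrite invf_ple ?posrE //; lra.
Qed.

Lemma near1_div r u v : rate r -> near1 r u -> near1 r v -> near1 r (fun n => u n / v n).
Proof. by move=> rr nu nv; apply: near1M => //; exact: near1V. Qed.

(** A symmetric substitute for the mean value theorem: for [y <= x], [1 + t <= expR t] at
    [t = y - x] suffices. It turns an error in an exponent into a relative error. *)
Lemma expR_sub_le (x y : R) : `|expR x - expR y| <= `|x - y| * (expR x + expR y).
Proof.
wlog xy : x y / y <= x => [H|].
  have [/H//|/ltW/H h] := leP y x.
  by rewrite distrC (distrC x) (addrC (expR x)).

rewrite !ger0_norm ?subr_ge0 ?ler_expR // mulrDr.
apply: (@le_trans _ _ ((x - y) * expR x)); last first.
  by rewrite lerDl mulr_ge0 ?subr_ge0 ?expR_ge0.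
have -> : expR y = expR x * expR (y - x) by rewrite -expRD addrCA subrr addr0.
rewrite -[X in X - _]mulr1 -mulrBr mulrC ler_wpM2r ?expR_ge0 //.
by have := expR_ge1Dx (y - x); lra.
Qed.

Lemma ln_sub1_ge (x : R) : 0 < x -> 1 - x^-1 <= ln x <= x - 1.
Proof.
move=> x0; apply/andP; split; last first.
  by have := @le_ln1Dx R (x - 1); rewrite (addrC 1) subrK; apply; lra.
have := @le_ln1Dx R (x^-1 - 1); rewrite (addrC 1) subrK lnV ?posrE // => H.
have : 0 < x^-1 by rewrite invr_gt0.
by move=> ?; have := H _; rewrite lerNl opprB; apply; lra.
Qed.

Definition rinv n : R := n%:R^-1.
Definition rsqrt n : R := (Num.sqrt n%:R)^-1.

Lemma rate_rinv : rate rinv.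
Proof.
split=> [n|e e0]; first by rewrite invr_ge0.
exists (Num.truncn e^-1).+1 => n nN.
have n0 : 0 < n%:R :> R by rewrite ltr0n (leq_trans _ nN).
rewrite /rinv invf_ple ?posrE //; apply: ltW; apply: lt_le_trans (truncnS_gt _) _.
by rewrite ler_nat.
Qed.

Lemma rate_rsqrt : rate rsqrt.
Proof.
split=> [n|e e0]; first by rewrite invr_ge0 sqrtr_ge0.
have [_ /(_ (e ^+ 2) (exprn_gt0 _ e0)) [N H]] := rate_rinv.
exists N => n /H h; rewrite /rsqrt -sqrtrV ?ler0n // -[leRHS]ger0_norm ?(ltW e0) //.
by rewrite -sqrtr_sqr ler_wsqrtr.
Qed.

Lemma rinv_le_rsqrt n : rinv n <= rsqrt n.
Proof.
rewrite /rinv /rsqrt -sqrtrV ?ler0n //; case: n => [|n].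
  by rewrite invr0 sqrtr0.
set x := n.+1%:R^-1; have x0 : 0 <= x by rewrite invr_ge0.
rewrite -[leLHS]ger0_norm // -sqrtr_sqr ler_wsqrtr // expr2 ler_piMr //.
by rewrite invf_le1 ?ler1n.
Qed.

Lemma near1_rsqrt u : near1 rinv u -> near1 rsqrt u.
Proof. exact: bigOn_rate rate_rinv rinv_le_rsqrt. Qed.

Lemma near1_double r u : rate r -> (forall n, r n.*2 <= r n) -> near1 r u ->
  near1 r (fun n => u n.*2).
Proof.
move=> rr r2 /(bigOnC0 rr) [C [N [C0 H]]]; exists C, N => n nN.
apply: le_trans (H _ _) _; first by rewrite (leq_trans nN) // -addnn leq_addr.
exact: ler_wpM2l.
Qed.

Lemma rinv_double n : rinv n.*2 <= rinv n.
Proof.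
case: n => [|n]; first by rewrite double0.
by rewrite /rinv lef_pV2 ?posrE ?ltr0n ?double_gt0 // ler_nat -addnn leq_addr.
Qed.

End Near1.

(** * The recurrences and initial values *)

Section Recurrence.
Variable R : realType.
(* Zeilberger certificate for [p_seq], found by linear algebra over
   the coefficients; it serves [q_seq] too, whose summand is that of [p_seq]
   with [k] shifted by [a].  Numerals above 5000 are written [c * 1000 + d]
   because longer ones trigger the nat-literal overflow. *)
Definition cert0 (n a : R) : R :=
   (256) * n ^+ 8
    + (832 * a + 2176) * n ^+ 7
    + (1120 * a ^+ 2 + (6 * 1000 + 204) * a + (7 * 1000 + 687)) * n ^+ 6
    + (816 * a ^+ 3 + (7 * 1000 + 206) * a ^+ 2 + (18 * 1000 + 753) * a + (14 * 1000 + 682)) * n ^+ 5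
    + (344 * a ^+ 4 + 4408 * a ^+ 3 + (18 * 1000 + 123) * a ^+ 2 + (29 * 1000 + 675) * a + (16 * 1000 + 467)) * n ^+ 4
    + (80 * a ^+ 5 + 1506 * a ^+ 4 + (8 * 1000 + 831) * a ^+ 3 + (22 * 1000 + 774) * a ^+ 2 + (26 * 1000 + 476) * a + (10 * 1000 + 876)) * n ^+ 3
    + (8 * a ^+ 6 + 272 * a ^+ 5 + 2240 * a ^+ 4 + (8 * 1000 + 221) * a ^+ 3 + (15 * 1000 + 185) * a ^+ 2 + (13 * 1000 + 206) * a + 3868) * n ^+ 2
    + (20 * a ^+ 6 + 262 * a ^+ 5 + 1360 * a ^+ 4 + 3644 * a ^+ 3 + (5 * 1000 + 138) * a ^+ 2 + 3276 * a + 544) * n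
    + (8 * a ^+ 6 + 76 * a ^+ 5 + 304 * a ^+ 4 + 636 * a ^+ 3 + 672 * a ^+ 2 + 272 * a).
Definition cert1 (n a : R) : R :=
   (- 512) * n ^+ 7
    + (- 1408 * a - 3664) * n ^+ 6
    + (- 1664 * a ^+ 2 - (8 * 1000 + 540) * a - (10 * 1000 + 531)) * n ^+ 5
    + (- 1088 * a ^+ 3 - (8 * 1000 + 210) * a ^+ 2 - (20 * 1000 + 277) * a - (15 * 1000 + 543)) * n ^+ 4
    + (- 416 * a ^+ 4 - 4120 * a ^+ 3 - (15 * 1000 + 325) * a ^+ 2 - (23 * 1000 + 998) * a - (12 * 1000 + 362)) * n ^+ 3
    + (- 88 * a ^+ 5 - 1102 * a ^+ 4 - (5 * 1000 + 597) * a ^+ 3 - (13 * 1000 + 659) * a ^+ 2 - (14 * 1000 + 720) * a - 4922) * n ^+ 2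
    + (- 8 * a ^+ 6 - 136 * a ^+ 5 - 952 * a ^+ 4 - 3360 * a ^+ 3 - (5 * 1000 + 834) * a ^+ 2 - 4200 * a - 724) * n
    + (- 4 * a ^+ 6 - 54 * a ^+ 5 - 296 * a ^+ 4 - 772 * a ^+ 3 - 914 * a ^+ 2 - 364 * a).
Definition cert2 (n a : R) : R :=
   (256) * n ^+ 6
    + (576 * a + 1376) * n ^+ 5
    + (544 * a ^+ 2 + 2596 * a + 2837) * n ^+ 4
    + (272 * a ^+ 3 + 1946 * a ^+ 2 + 4387 * a + 2860) * n ^+ 3
    + (72 * a ^+ 4 + 716 * a ^+ 3 + 2533 * a ^+ 2 + 3555 * a + 1425) * n ^+ 2
    + (8 * a ^+ 5 + 126 * a ^+ 4 + 651 * a ^+ 3 + 1482 * a ^+ 2 + 1370 * a + 282) * n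
    + (8 * a ^+ 5 + 64 * a ^+ 4 + 211 * a ^+ 3 + 325 * a ^+ 2 + 194 * a).
Definition cert3 (n a : R) : R :=
   (- 16) * n ^+ 4
    + (- 36 * a - 65) * n ^+ 3
    + (- 30 * a ^+ 2 - 119 * a - 83) * n ^+ 2
    + (- 12 * a ^+ 3 - 67 * a ^+ 2 - 116 * a - 34) * n
    + (- 2 * a ^+ 4 - 13 * a ^+ 3 - 33 * a ^+ 2 - 34 * a).

Definition cert (n a k : R) : R :=
  cert0 n a + cert1 n a * k + cert2 n a * k ^+ 2 + cert3 n a * k ^+ 3.

(** The telescoping relation for the summand, divided by [cbin s (n + 2) k * W (n - 1 + k)], so that
    only rational functions remain. [k] is real because [q_seq] uses it at [k + a]. *)
Lemma cert_id (n a k : R) :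
  n + 2 + a != 0 -> n + 2 - a != 0 -> n + 1 + a != 0 -> n + 1 - a != 0 ->
  n + a != 0 -> n - a != 0 ->
  lambda2 n a * ((n + k) * (n + 1 + k) * (n + 2 + k))
  + lambda1 n a * ((n + 2 + a - k) * (n + 2 - k)) / ((n + 2 + a) * (n + 2 - a)) * ((n + k) * (n + 1 + k))
  + lambda0 n a * ((n + 2 + a - k) * (n + 2 - k)) * ((n + 1 + a - k) * (n + 1 - k))
      / ((n + 2 + a) * (n + 2 - a)) / ((n + 1 + a) * (n + 1 - a)) * (n + k)
  + lambdam1 n a * ((n + 2 + a - k) * (n + 2 - k)) * ((n + 1 + a - k) * (n + 1 - k)) * ((n + a - k) * (n - k))
      / ((n + 2 + a) * (n + 2 - a)) / ((n + 1 + a) * (n + 1 - a)) / ((n + a) * (n - a))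
  = (cert n a (k + 1) * ((n + 2 + a - k) * (n + 2 - k) * (n + k)) - cert n a k * (k * (k - a)))
     / ((n + 2 + a) * (n + 2 - a)).
Proof.
move=> h2 h2' h1 h1' h0 h0'.
rewrite /lambda2 /lambda1 /lambda0 /lambdam1 /cert /cert0 /cert1 /cert2 /cert3.
field.
by rewrite ?h2 ?h2' ?h1 ?h1' ?h0 ?h0'.
Qed.

Lemma gbinom0 (x : R) : gbinom x 0 = 1.
Proof. by rewrite /gbinom big_ord0 fact0 divr1. Qed.

Lemma gbinomS (x : R) k : k.+1%:R * gbinom x k.+1 = (x - k%:R) * gbinom x k.
Proof.
rewrite /gbinom big_ord_recr /= factS natrM invfM.
by have ? : k.+1%:R != 0 :> R by []; have ? : k`!%:R != 0 :> R;
  [rewrite pnatr_eq0 -lt0n fact_gt0|field; apply/andP].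
Qed.

Lemma gbinomD1 (x : R) k :
  (x + 1) * gbinom x k = (x + 1 - k%:R) * gbinom (x + 1) k.
Proof.
elim: k => [|k IH]; first by rewrite !gbinom0; ring.
have kN0 : k.+1%:R != 0 :> R by [].
apply: (mulfI kN0).
rewrite mulrCA gbinomS (mulrCA k.+1%:R) gbinomS.
rewrite mulrCA IH -natr1; ring.
Qed.

Lemma gbinomSS (x : R) k : k.+1%:R * gbinom (x + 1) k.+1 = (x + 1) * gbinom x k.
Proof. by rewrite gbinomS gbinomD1. Qed.

(** Common factor of the summands of [p_seq] (at [s = a]) and [q_seq] (at [s = - a]). It is 0 beyond
    [n] because truncated subtraction would turn [n - k] into 0 there and [cbinSk] would fail at the
    edge. *)
Definition cbin (s : R) (n k : nat) : R :=
  if (k <= n)%N then gbinom (n%:R + s) k * gbinom (n%:R - s) (n - k) else 0.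

Lemma cbinSn s n k :
  (n.+1%:R + s) * (n.+1%:R - s) * cbin s n k =
  (n.+1%:R + s - k%:R) * (n.+1%:R - k%:R) * cbin s n.+1 k.
Proof.
rewrite /cbin; case: (ltngtP k n.+1) => [|kn|->].
- rewrite ltnS => kn; rewrite kn subSn //.
  have := gbinomD1 (n%:R + s) k; have := gbinomSS (n%:R - s) (n - k).
  rewrite -!natr1 natrB //.
  have -> : n%:R + s + 1 = n%:R + 1 + s by ring.
  have -> : n%:R - s + 1 = n%:R + 1 - s by ring.
  move=> h1 h2.
  rewrite [LHS](_ : _ = ((n%:R + 1 + s) * gbinom (n%:R + s) k) *
     ((n%:R + 1 - s) * gbinom (n%:R - s) (n - k))); last ring.
  rewrite h2 -h1; ring.
- by rewrite leqNgt (ltn_trans _ kn) // !mulr0.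
- by rewrite ltnn mulr0 subrr mulr0 mul0r.
Qed.

Lemma cbinSk s n k :
  k.+1%:R * (k.+1%:R - s) * cbin s n k.+1 =
  (n%:R + s - k%:R) * (n%:R - k%:R) * cbin s n k.
Proof.
rewrite /cbin; case: (ltngtP k n) => [kn|kn|->]; last first.
- by rewrite subrr !mulr0 mul0r.
- by rewrite !mulr0.
have h1 := gbinomS (n%:R + s) k; have := gbinomS (n%:R - s) (n - k.+1).
rewrite -subSn // subSS !natrB ?(ltnW kn) // => h2.
rewrite [LHS](_ : _ = (k.+1%:R * gbinom (n%:R + s) k.+1) *
  ((n%:R - s - (n%:R - k.+1%:R)) * gbinom (n%:R - s) (n - k.+1))); last ring.
rewrite h1 -h2; ring.
Qed.

Definition cbin_sum (s : R) (W : nat -> R) (n : nat) : R :=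
  \sum_(k < n.+1) cbin s n k * W (n + k)%N.

(** Allows the four sums of the recurrence, of different lengths, to be added termwise. *)
Lemma cbin_sum_widen s W n N : (n <= N)%N ->
  cbin_sum s W n = \sum_(0 <= k < N.+1) cbin s n k * W (n + k)%N.
Proof.
move=> nN; rewrite (big_cat_nat (n := n.+1)) //= big_mkord [X in _ = _ + X]big_nat_cond.
rewrite [X in _ = _ + X]big1 ?addr0 // => k /andP[/andP[nk _] _].
by rewrite /cbin leqNgt nk mul0r.
Qed.

End Recurrence.

Section RecurrenceSums.
Variable R : realType.
Implicit Types (s : R).
(** In terms of [x = k + d], the factors [k (k - s)] and [(n + s - k)(n - k)] become [x (x - a)] and
    [(n + a - x)(n - x)] in both cases of [(s, d)]. *)
Lemma cbin_sum_rec (a s d : R) (W : nat -> R) :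
  (forall n : nat, n%:R + a != 0) -> (forall n : nat, n%:R - a != 0) ->
  (s = a /\ d = 0) \/ (s = - a /\ d = a) ->
  (forall j, W j.+1 = (j.+1%:R + d) * W j) ->
  recurrence a (cbin_sum s W).
Proof.
move=> aP aN sd WS [//|m] _; set n := m.+1%:R.
have [n2P n2N] : n + 2 + a != 0 /\ n + 2 - a != 0.
  have := aP m.+3; have := aN m.+3.
  by rewrite (_ : m.+3%:R = n + 2) // /n -natrD addnC.
have [n1P n1N] : n + 1 + a != 0 /\ n + 1 - a != 0.
  by have := aP m.+2; have := aN m.+2; rewrite (_ : m.+2%:R = n + 1) // /n natr1.
have nP := aP m.+1; have nN := aN m.+1.
rewrite !(@cbin_sum_widen R s W _ m.+3) /=; try lia.
pose x k := k%:R + d : R.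
(* [G] vanishes at both ends: at 0 because [x 0] is 0 or [a], at the top because [cbin s m.+3]
   does. *)
pose G k := cert n a (x k) * (x k * (x k - a)) * cbin s m.+3 k * W (m + k)%N
  / ((n + 2 + a) * (n + 2 - a)).
rewrite !mulr_sumr -!big_split /= (eq_bigr (fun k => G k.+1 - G k)) => [|k _].
  rewrite telescope_sumr // /G /cbin ltnn !mulr0 !mul0r sub0r.
  suff -> : x 0 * (x 0 - a) = 0 by rewrite !mulr0 !mul0r oppr0.
  by rewrite /x; case: sd => -[_ ->]; ring.
have stepP c l : (s = a /\ d = 0) \/ (s = - a /\ d = a) ->
  (l%:R + s) * (l%:R - s) * c = (l%:R + a) * (l%:R - a) * c.
  by case=> -[-> _]; ring.
have step0 l : (l%:R + s - k%:R) * (l%:R - k%:R) = (l%:R + a - x k) * (l%:R - x k).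
  by rewrite /x; case: sd => -[-> ->]; ring.
have cstep l : cbin s l k = (l.+1%:R + a - x k) * (l.+1%:R - x k)
    / ((l.+1%:R + a) * (l.+1%:R - a)) * cbin s l.+1 k.
  have := cbinSn s l k; rewrite step0 stepP // => h.
  apply: (@mulfI _ ((l.+1%:R + a) * (l.+1%:R - a))); first by rewrite mulf_neq0.
  rewrite h; move: (aP l.+1) (aN l.+1); move: l.+1%:R (cbin _ _ _) => v c vP vN.
  by field; rewrite vP vN.
have GS : G k.+1 = cert n a (x k + 1)
    * ((n + 2 + a - x k) * (n + 2 - x k) * (n + x k)) * cbin s m.+3 k
    * W (m + k)%N / ((n + 2 + a) * (n + 2 - a)).
  rewrite /G addnS WS.
  have -> : x k.+1 = x k + 1 by rewrite /x -natr1; ring.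
  have -> : (m + k).+1%:R + d = n + x k by rewrite /n /x -addSn natrD; ring.
  have -> : (x k + 1) * (x k + 1 - a) = k.+1%:R * (k.+1%:R - s).
    by rewrite /x -natr1; case: sd => -[-> ->]; ring.
  have := cbinSk s m.+3 k; rewrite step0.
  have -> : m.+3%:R = n + 2 by rewrite /n -natrD addnC.
  move: (cert _ _ _) (cbin s m.+3 k.+1) (cbin s m.+3 k) (W _) => c C1 C2 w E.
  rewrite [LHS](_ : _ = c * (k.+1%:R * (k.+1%:R - s) * C1) * ((n + x k) * w)
    / ((n + 2 + a) * (n + 2 - a))); last by ring.
  by rewrite E; ring.
rewrite GS /G.
have W1 : W (m.+1 + k)%N = (n + x k) * W (m + k)%N.
  by rewrite addSn WS /n /x -addSn natrD; ring.
have W2 : W (m.+2 + k)%N = (n + 1 + x k) * ((n + x k) * W (m + k)%N).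
  by rewrite -W1 addSn WS /n /x -addSn -natr1 addSn -natr1 natrD -natr1; ring.
have W3 : W (m.+3 + k)%N = (n + 2 + x k) * ((n + 1 + x k) * ((n + x k) * W (m + k)%N)).
  by rewrite -W2 addSn WS /n /x -addSn !addSn -!natr1 natrD; ring.
rewrite W1 W2 W3 (cstep m) (cstep m.+1) (cstep m.+2).
have -> : m.+3%:R = n + 2 by rewrite /n -natrD addnC.
have -> : m.+2%:R = n + 1 by rewrite /n natr1.
rewrite -/n.
have := @cert_id R n a (x k) n2P n2N n1P n1N nP nN.
move: (cert n a (x k + 1)) (cert n a (x k)) => c1 c2.
move: (lambda2 n a) (lambda1 n a) (lambda0 n a) (lambdam1 n a) => l2 l1 l0 lm.
move: (cbin s m.+3 k) (W (m + k)%N) => C w E.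
rewrite [RHS](_ : _ = (c1 * ((n + 2 + a - x k) * (n + 2 - x k) * (n + x k))
  - c2 * (x k * (x k - a))) / ((n + 2 + a) * (n + 2 - a)) * (C * w)); last by ring.
rewrite -E; move: (x k) n2P n2N n1P n1N nP nN; rewrite -/n; clear; move: n => v y.
by move=> v2P v2N v1P v1N vP vN; field; rewrite v2P v2N v1P v1N vP vN.
Qed.

Lemma cbin_sum_p (a : R) :
  cbin_sum a (fun j => j`!%:R) =1 p_seq a.
Proof.
move=> n; apply: eq_bigr => k _.
by rewrite /cbin -ltnS ltn_ord.
Qed.

Lemma cbin_sum_q (a : R) : cbin_sum (- a) (poch (a + 1)) =1 q_seq a.
Proof.
move=> n; apply: eq_bigr => k _.
by rewrite /cbin -ltnS ltn_ord opprK.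
Qed.

Lemma recurrence_ext (a : R) f g : f =1 g -> recurrence a f -> recurrence a g.
Proof. by move=> fg fP n n0; rewrite -!fg; exact: fP. Qed.

Lemma pochS (x : R) n : poch x n.+1 = poch x n * (x + n%:R).
Proof. by rewrite /poch big_ord_recr. Qed.

Lemma p_recurrence (a : R) : a \isn't a Num.int -> recurrence a (p_seq a).
Proof.
move=> aN; apply: recurrence_ext (cbin_sum_p a) _.
apply: (@cbin_sum_rec a a 0) => [n|n||j]; last by rewrite factS natrM addr0.
- by apply: contra aN; rewrite addrC addr_eq0 => /eqP ->; rewrite rpredN intr_nat.
- by apply: contra aN; rewrite subr_eq0 => /eqP <-; rewrite intr_nat.
- by left.
Qed.

Lemma q_recurrence (a : R) : a \isn't a Num.int -> recurrence a (q_seq a).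
Proof.
move=> aN; apply: recurrence_ext (cbin_sum_q a) _.
apply: (@cbin_sum_rec a (- a) a) => [n|n||j].
- by apply: contra aN; rewrite addrC addr_eq0 => /eqP ->; rewrite rpredN intr_nat.
- by apply: contra aN; rewrite subr_eq0 => /eqP <-; rewrite intr_nat.
- by right.
- by rewrite pochS -natr1; ring.
Qed.

Lemma gbinom1 (x : R) : gbinom x 1 = x.
Proof. by rewrite /gbinom big_ord1 subr0 divr1. Qed.

Lemma gbinom2 (x : R) : gbinom x 2 = x * (x - 1) / 2.
Proof. by rewrite /gbinom !big_ord_recr big_ord0 /= subr0 mul1r. Qed.

Lemma p_init (a : R) : [/\ p_seq a 0 = 1, p_seq a 1 = 3 + a &
  p_seq a 2 = 50 + 33 * a + 7 * a ^+ 2].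
Proof.
rewrite /p_seq !big_ord_recr !big_ord0 /= !subnn !subn0 !gbinom0 !gbinom1 !gbinom2.
by split; rewrite ?addn0 ?addn1 ?addn2 ?factS fact0; field.
Qed.

Lemma q_init (a : R) : [/\ q_seq a 0 = 1,
  q_seq a 1 = (a + 1) * (3 - a ^+ 2) &
  q_seq a 2 = (a + 1) * (a + 2)
    * (a ^+ 4 + 2 * a ^+ 3 - 12 * a ^+ 2 - 11 * a + 50) / 2].
Proof.
rewrite /q_seq !big_ord_recr !big_ord0 /= !subnn !subn0 !gbinom0 !gbinom1 !gbinom2.
by split; rewrite ?addn0 ?addn1 ?addn2 ?pochS /poch big_ord0; field.
Qed.
End RecurrenceSums.

(** * Euler's Gamma function *)

Section FTC.
Variable R : realType.
Notation mu := (@lebesgue_measure R).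

(** Both ends are improper. The interval is exhausted by the half-lines starting at [1 / (i + 1)],
    on each of which the one-sided theorem applies, and monotonicity in the domain passes to the
    limit. *)
Lemma ge0_integral_oy (f F : R -> R) (l0 l : R) :
  (forall x : R, 0 < x -> 0 <= f x) ->
  (forall x : R, 0 < x -> {for x, continuous f}) ->
  (forall x : R, 0 < x -> is_derive x 1 F (f x)) ->
  F x @[x --> 0^'+] --> l0 -> F x @[x --> +oo] --> l ->
  (\int[mu]_(x in `]0%R, +oo[) (f x)%:E = (l - l0)%:E)%E.
Proof.
move=> f0 cf dF F0 Fl.
pose a (i : nat) : R := i.+1%:R^-1.
have a0 i : 0 < a i by rewrite invr_gt0.
pose A i := [set` `[a i, +oo[%R].
have UA : \bigcup_i A i = [set` `]0%R, +oo[%R].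
  apply/seteqP; split => x /=.
    by move=> [i _]; rewrite /A /= !in_itv /= !andbT; exact: lt_le_trans.
  rewrite in_itv /= andbT => x0; exists (Num.truncn x^-1) => //.
  rewrite /A /= in_itv /= andbT /a invf_ple ?posrE //.
  by rewrite ltW // truncnS_gt.
have cA i : (\int[mu]_(x in A i) (f x)%:E = (l - F (a i))%:E)%E.
  rewrite (@ge0_continuous_FTC2y R f F (a i) l) //.
  - by move=> x ax; apply: f0; exact: lt_le_trans ax.
  - apply/continuous_within_itvcyP; split.
      by move=> x; rewrite in_itv /= andbT => ax; apply: cf; exact: lt_trans ax.
    by apply: cvg_at_right_filter; exact: cf.
  - move=> x ax; have : is_derive x 1 F (f x) by apply: dF; exact: lt_trans ax.
    by move=> [].
  - apply: cvg_at_right_filter.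
    have [dFa _] := dF _ (a0 i).
    by apply: differentiable_continuous; exact/derivable1_diffP.
  - move=> x; rewrite in_itv /= andbT => ax.
    have [dFx dFE] := dF _ (lt_trans (a0 i) ax).
    by rewrite derive1E dFE.
have := @ge0_nondecreasing_set_cvg_integral _ (measurableTypeR R) R A (EFin \o f) (@lebesgue_measure R).
rewrite UA => H.
have {H} : (\int[mu]_(x in A i) (f x)%:E @[i --> \oo] -->
    \int[mu]_(x in `]0%R, +oo[) (f x)%:E)%E.
  apply: H.
  - move=> i j ij; apply/subsetPset => x /=; rewrite /A /= !in_itv /= !andbT.
    by apply: le_trans; rewrite lef_pV2 ?posrE // ler_nat.
  - by move=> i; exact: measurable_itv.
  - move=> i; apply/measurable_EFinP.
    apply: (@measurable_funS _ _ (measurableTypeR R) (measurableTypeR R) [set` `]0%R, +oo[%R] (A i) f); first exact: measurable_itv.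
      by move=> x; rewrite /A /= !in_itv /= !andbT; exact: lt_le_trans.
    apply: open_continuous_measurable_fun; first exact: interval_open.
    by move=> x /set_mem /=; rewrite in_itv /= andbT; exact: cf.
  - by move=> i x; rewrite /A /= in_itv /= andbT lee_fin => ax; apply: f0; exact: lt_le_trans ax.
under eq_fun do rewrite cA.
move=> H; apply: (cvg_unique _ H); first exact: ereal_hausdorff.
apply: cvg_EFin; first by near=> x.
apply: cvgB; first exact: cvg_cst.
apply: (cvg_at_rightP F 0 l0).1 => //; split => //.
rewrite (_ : a = fun n => n.+1%:R^-1) //.
exact: cvg_harmonic.
Unshelve. all: end_near.
Qed.
End FTC.

(** * Euler's integral: functional equation and the values at 1 and 1/2 *)

Section EulerGamma.
Variable R : realType.
Notation mu := (@lebesgue_measure R).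
Notation GI := (@eulerGamma_integral R).
Implicit Types (b c p t x : R).

Lemma powR_le_expR p t : 0 < p -> 0 <= t -> t `^ p <= p `^ p * expR t.
Proof.
move=> p0 t0; have -> : expR t = expR (t / p) `^ p.
  by rewrite -expRM divfK // gt_eqF.
rewrite -powRM ?expR_ge0 ?(ltW p0) //.
apply: ge0_ler_powR; rewrite ?nnegrE ?mulr_ge0 ?expR_ge0 ?(ltW p0) //.
rewrite -ler_pdivrMl // mulrC.
by apply: le_trans (expR_ge1Dx _); rewrite lerDr.
Qed.

(* An explicit majorant whose integral over ]0, +oo[ is 1 by the fundamental
   theorem; it dominates the Gamma integrand up to the constant [domK]. *)
Definition dom c t := c * t `^ (c - 1) * (1 + t) `^ (- c - 1).

Lemma is_derive_add1pow c t : 0 <= t ->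
  is_derive t 1 (fun t : R => (1 + t) `^ c) (c * (1 + t) `^ (c - 1)).
Proof.
move=> t0; have t1 : 0 < 1 + t by rewrite ltr_pwDl.
apply: is_derive1_eq
  (is_derive1pow c t1 (is_derive1D (is_derive1C 1 t) (is_derive1id t))) _.
by rewrite add0r mulr1.
Qed.

Lemma dom_derive c t : 0 < t ->
  is_derive t 1 (fun t => t `^ c * (1 + t) `^ (- c)) (dom c t).
Proof.
move=> t0; have t1 : 0 < 1 + t by rewrite addr_gt0.
apply: is_derive1_eq
  (is_derive1M (is_derive1_powR c t0) (is_derive_add1pow (- c) (ltW t0))) _.
have tE : t `^ c = t `^ (c - 1) * t.
  by rewrite -[X in _ * X]powRr1 ?(ltW t0) // -powRD ?subrK // (gt_eqF t0) implybT.
have t1E : (1 + t) `^ (- c) = (1 + t) `^ (- c - 1) * (1 + t).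
  by rewrite -[X in _ * X]powRr1 ?(ltW t1) // -powRD ?subrK // (gt_eqF t1) implybT.
by rewrite /dom tE t1E; ring.
Qed.

Lemma dom_ge0 c t : 0 < c -> 0 <= dom c t.
Proof. by move=> c0; rewrite !mulr_ge0 ?powR_ge0 // ltW. Qed.

Lemma cvg_invy : t^-1 @[t --> +oo] --> (0 : R).
Proof. by apply/gtr0_cvgV0; [exact: nbhs_pinfty_gt|exact: cvg_id]. Qed.

Lemma powR_expN_cvgy c : t `^ c * expR (- t) @[t --> +oo] --> (0 : R).
Proof.
pose p := `|c| + 1; have p0 : 0 < p by rewrite ltr_wpDl.
apply: (@squeeze_cvgr _ _ _ _ (fun=> 0) (fun t => (p + 1) `^ (p + 1) * t^-1)).
- near=> t; have t1 : 1 <= t by near: t; exact: nbhs_pinfty_ge.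
  have t0 : 0 < t by exact: lt_le_trans t1.
  rewrite mulr_ge0 ?powR_ge0 ?expR_ge0 //= expRN ler_pdivrMr ?expR_gt0 //.
  rewrite mulrAC ler_pdivlMr //.
  rewrite -[X in _ * X <= _]powRr1 ?(ltW t0) // -powRD ?(gt_eqF t0) ?implybT //.
  apply: le_trans (powR_le_expR _ (ltW t0)); last by rewrite ltr_wpDl // ltW.
  by apply: ler_powR => //; rewrite lerD2r /p (le_trans (ler_norm c)) // lerDl.
- exact: cvg_cst.
- rewrite -[X in _ --> X](mulr0 ((p + 1) `^ (p + 1))).
  apply: cvgM; first exact: cvg_cst.
  exact: cvg_invy.
Unshelve. all: by end_near. Qed.

Lemma dom_cont c t : 0 < t -> {for t, continuous (dom c)}.
Proof.
move=> t0; exact: (is_derive1_continuous (is_derive1M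
  (is_derive1Z c (is_derive1_powR (c - 1) t0))
  (is_derive_add1pow (- c - 1) (ltW t0)))).
Qed.

Definition gam b t := t `^ b * expR (- t).

Lemma gam_derive b t : 0 < t -> is_derive t 1 (gam b) (b * gam (b - 1) t - gam b t).
Proof.
move=> t0; apply: is_derive1_eq (is_derive1M (is_derive1_powR b t0)
  (is_derive1exp (is_derive1N (is_derive1id t)))) _.
by rewrite /gam; ring.
Qed.

Lemma gam_cont b t : 0 < t -> {for t, continuous (gam b)}.
Proof. by move=> t0; exact: is_derive1_continuous (gam_derive b t0). Qed.

Lemma gam_ge0 b t : 0 <= gam b t.
Proof. by rewrite mulr_ge0 ?powR_ge0 ?expR_ge0. Qed.

Lemma add1pow_cvg c : (1 + t) `^ c @[t --> (0 : R)] --> (1 : R).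
Proof.
have := is_derive1_continuous (is_derive_add1pow c (lexx 0)).
by rewrite /prop_for /continuous_at addr0 powR1.
Qed.

Lemma cvg_dom0 c : 0 < c -> t `^ c * (1 + t) `^ (- c) @[t --> 0^'+] --> (0 : R).
Proof.
move=> c0; rewrite -[X in _ --> X](mul0r (1 : R)).
apply: cvgM; first exact: powR_cvg0.
by apply: cvg_at_right_filter; exact: add1pow_cvg.
Qed.

Lemma cvg_domy c : 0 < c -> t `^ c * (1 + t) `^ (- c) @[t --> +oo] --> (1 : R).
Proof.
move=> c0; have h := cvg_comp _ _ cvg_invy (add1pow_cvg (- c)).
apply: cvg_trans h; apply: near_eq_cvg; near=> t.
have t0 : 0 < t by near: t; exact: nbhs_pinfty_gt.
rewrite /=; have -> : 1 + t^-1 = (1 + t) * t `^ (- 1).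
  by rewrite powR_inv1 ?ltW // mulrDl mul1r divff ?gt_eqF // addrC.
rewrite powRM ?powR_ge0 ?addr_ge0 ?(ltW t0) //.
by rewrite -powRrM mulN1r opprK mulrC.
Unshelve. all: by end_near. Qed.

Lemma integral_dom c : 0 < c ->
  (\int[mu]_(t in `]0%R, +oo[) (dom c t)%:E = 1%:E)%E.
Proof.
move=> c0; apply: (etrans (@ge0_integral_oy R (dom c)
  (fun t => t `^ c * (1 + t) `^ (- c)) 0 1 _ _ _ _ _)); last by rewrite subr0.
- by move=> t t0; exact: dom_ge0.
- by move=> t t0; exact: dom_cont.
- by move=> t t0; exact: dom_derive.
- exact: cvg_dom0.
- exact: cvg_domy.
Qed.

Definition domK c : R := (c + 2) `^ (c + 2) * expR 1 / c.

(** Multiplying the first integrand by [1 + t] covers both exponents at once. After cancelling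
    [t ^ (c - 1)] the claim is [(1 + t) ^ (c + 2) <= (c + 2) ^ (c + 2) expR (1 + t)], whence
    [domK]. *)
Lemma gam_le_dom c t : 0 < c -> 0 < t ->
  gam (c - 1) t <= domK c * dom c t /\ gam c t <= domK c * dom c t.
Proof.
move=> c0 t0; have t1 : 0 < 1 + t by rewrite addr_gt0.
suff H : t `^ (c - 1) * (1 + t) * expR (- t) <= domK c * dom c t.
  split; apply: le_trans H; rewrite /gam ler_pM2r ?expR_gt0 //.
    by rewrite ler_peMr ?powR_ge0 // lerDl ltW.
  have -> : t `^ c = t `^ (c - 1) * t.
    by rewrite -[X in _ * X]powRr1 ?(ltW t0) // -powRD ?subrK // (gt_eqF t0) implybT.
  by rewrite ler_pM2l ?powR_gt0 // lerDr.
rewrite /domK /dom [leRHS](_ : _ = t `^ (c - 1) * ((c + 2) `^ (c + 2) * expR 1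
  * (1 + t) `^ (- c - 1))); last by field; rewrite gt_eqF.
rewrite -mulrA ler_pM2l ?powR_gt0 // expRN ler_pdivrMr ?expR_gt0 //.
have /(powR_le_expR (addr_gt0 c0 (ltr0n R 2))) := ltW t1.
rewrite expRD mulrA => /(ler_wpM2r (powR_ge0 (1 + t) (- c - 1))).
rewrite -powRD ?(gt_eqF t1) ?implybT //.
have -> : c + 2 + (- c - 1) = 1 by ring.
by rewrite powRr1 ?(ltW t1) // => /le_trans; apply; rewrite le_eqVlt; apply/orP/or_introl/eqP; ring.
Qed.

Lemma measurable_pos (f : R -> R) : (forall t, 0 < t -> {for t, continuous f}) ->
  measurable_fun ([set` `]0%R, +oo[%R] : set R) f.
Proof.
move=> cf; apply: open_continuous_measurable_fun; first exact: interval_open.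
by move=> x /set_mem /=; rewrite in_itv /= andbT; exact: cf.
Qed.

Lemma integrable_dom c : 0 < c ->
  mu.-integrable [set` `]0%R, +oo[%R] (EFin \o dom c).
Proof.
move=> c0; apply/integrableP; split.
  by apply/measurable_EFinP; apply: measurable_pos => t; exact: dom_cont.
under eq_integral do rewrite /= ger0_norm ?dom_ge0 //.
by rewrite integral_dom // ltry.
Qed.

Lemma integrableZl_fin (k : R) (f : R -> R) :
  mu.-integrable [set` `]0%R, +oo[%R] (EFin \o f) ->
  mu.-integrable [set` `]0%R, +oo[%R] (EFin \o (fun t => k * f t)).
Proof.
move=> If.
exact: (@integrableZl _ _ _ mu [set` `]0%R, +oo[%R] _ k (EFin \o f)).
Qed.

Lemma integrable_gam b : -1 < b ->
  mu.-integrable [set` `]0%R, +oo[%R] (EFin \o gam b).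
Proof.
move=> b1; have c0 : 0 < b + 1 by lra.
apply: (@le_integrable _ (measurableTypeR R) R mu [set` `]0%R, +oo[%R] _ _ (fun t => (domK (b + 1))%:E * (dom (b + 1) t)%:E)%E).
- exact: measurable_itv.
- by apply/measurable_EFinP; apply: measurable_pos => t; exact: gam_cont.
- move=> t; rewrite /= in_itv /= andbT => t0; rewrite lee_fin.
  have [H _] := gam_le_dom c0 t0; rewrite addrK in H.
  by rewrite (ger0_norm (gam_ge0 _ _)) (le_trans H) // ler_norm.
- by apply: integrableZl; [exact: measurable_itv|exact: integrable_dom].
Qed.

Lemma GIE b : GI b = (\int[mu]_(t in `]0, +oo[) gam (b - 1) t)%R.
Proof. by []. Qed.

Lemma GI_rec c : 0 < c -> GI (c + 1) = c * GI c.
Proof.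
move=> c0; rewrite !GIE addrK.
have ic : mu.-integrable [set` `]0%R, +oo[%R] (EFin \o gam c).
  by apply: integrable_gam; lra.
have ic1 : mu.-integrable [set` `]0%R, +oo[%R] (EFin \o gam (c - 1)).
  by apply: integrable_gam; lra.
have id := integrable_dom c0.
(* Integration by parts. The derivative of [gam c] changes sign whereas [ge0_integral_oy] takes a
   nonnegative integrand; adding a majorant of known integral restores the sign. *)
pose f t := domK c * dom c t + (c * gam (c - 1) t - gam c t).
have If : (\int[mu]_(t in `]0%R, +oo[) (f t)%:E = (domK c)%:E)%E.
  apply: (etrans (@ge0_integral_oy R f
    (fun t => domK c * (t `^ c * (1 + t) `^ (- c)) + gam c t) 0 (domK c) _ _ _ _ _)).
  - move=> t t0; rewrite /f; have [_ H] := gam_le_dom c0 t0.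
    have : 0 <= c * gam (c - 1) t by rewrite mulr_ge0 ?gam_ge0 ?ltW.
    by lra.
  - move=> t t0; apply: continuousD.
      by apply: continuousM; [exact: cst_continuous|exact: dom_cont].
    apply: continuousB; last exact: gam_cont.
    by apply: continuousM; [exact: cst_continuous|exact: gam_cont].
  - move=> t t0; apply: is_derive1D; last exact: gam_derive.
    by apply: is_derive1Z; exact: dom_derive.
  - rewrite -[X in _ --> X](addr0 (0 : R)); apply: cvgD.
      rewrite -[X in _ --> X](mulr0 (domK c)).
      by apply: cvgM; [exact: cvg_cst|exact: cvg_dom0].
    rewrite -[X in _ --> X](mul0r (expR (- (0 : R)))).
    apply: cvgM; first exact: powR_cvg0.
    apply: cvg_at_right_filter.
    exact: (is_derive1_continuous (is_derive1exp (is_derive1N (is_derive1id 0)))).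
  - rewrite -[X in _ --> X](addr0 (domK c)); apply: cvgD.
      rewrite -[X in _ --> X](mulr1 (domK c)).
      by apply: cvgM; [exact: cvg_cst|exact: cvg_domy].
    exact: powR_expN_cvgy.
  - by rewrite subr0.
have mI : measurable ([set` `]0%R, +oo[%R] : set (measurableTypeR R)).
  exact: measurable_itv.
have : (\int[mu]_(t in `]0%R, +oo[) f t)%R = domK c by rewrite /Rintegral If.
have ic1Z := integrableZl_fin c ic1; have idZ := integrableZl_fin (domK c) id.
rewrite (RintegralD mI idZ (integrableB mI ic1Z ic)) (RintegralB mI ic1Z ic).
rewrite (RintegralZl _ mI ic1) (RintegralZl _ mI id).
rewrite {1}/Rintegral integral_dom //= mulr1 -[RHS]addr0 => /addrI /eqP.
by rewrite subr_eq0 => /eqP <-.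
Qed.

Lemma GI_ge0 b : 0 <= GI b.
Proof. by rewrite GIE Rintegral_ge0 // => t _; exact: gam_ge0. Qed.

Lemma GI1 : GI 1 = 1.
Proof.
rewrite GIE subrr /Rintegral.
rewrite (_ : integral _ _ _ = 1%:E) //.
apply: (etrans (@ge0_integral_oy R (gam 0) (fun t => - expR (- t)) (- 1) 0 _ _ _ _ _)).
- by move=> t _; exact: gam_ge0.
- by move=> t; exact: gam_cont.
- move=> t _; apply: is_derive1_eq
    (is_derive1N (is_derive1exp (is_derive1N (is_derive1id t)))) _.
  by rewrite /gam powRr0; ring.
- apply: cvgN; rewrite -expR0 -[X in expR X]oppr0.
  apply: cvg_at_right_filter.
  exact: (is_derive1_continuous (is_derive1exp (is_derive1N (is_derive1id 0)))).
- by rewrite -[X in _ --> X]oppr0; apply: cvgN; exact: cvgr_expR.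
- by rewrite sub0r opprK.
Qed.

Import gauss_integral_proof.

Lemma is_derive_integral0_gauss x : 0 < x ->
  is_derive x 1 (@integral0_gauss R) (gauss_fun x).
Proof.
move=> x0; have [] := @continuous_FTC1 R gauss_fun (BLeft 0) x (x + 1) _ _ _ _.
- by rewrite ltrDl.
- apply: continuous_compact_integrable => //; first exact: segment_compact.
  by apply: continuous_subspaceT; exact: continuous_gauss_fun.
- by rewrite /= lte_fin.
- exact: continuous_gauss_fun.
by move=> d dE; split; [exact: d|rewrite -derive1E; exact: dE].
Qed.

Lemma integral0_gauss_le x : 0 <= x -> @integral0_gauss R x <= x.
Proof.
move=> x0; rewrite /integral0_gauss.
have mI : measurable ([set` `[0, x]] : set (measurableTypeR R)).
  exact: measurable_itv.
apply: (@le_trans _ _ (\int[mu]_(t in `[0, x]) cst 1 t)).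
  apply: le_Rintegral => //.
  - apply: continuous_compact_integrable; first exact: segment_compact.
    by apply: continuous_subspaceT; exact: continuous_gauss_fun.
  - apply: continuous_compact_integrable; first exact: segment_compact.
    by apply: continuous_subspaceT => ?; exact: cst_continuous.
  - by move=> t _; exact: gauss_fun_le1.
rewrite Rintegral_cst // mul1r.
have := @lebesgue_measure_itv R (`[0, x]%R); rewrite /= lte_fin => ->.
by case: ltgtP x0 => //= x0 _; rewrite ?oppr0 ?addr0 // -x0.
Qed.

Lemma integral0_gauss_cvgy : @integral0_gauss R x @[x --> +oo] --> Num.sqrt pi / 2.
Proof.
have : Num.sqrt (@integral0_gauss R x ^+ 2) @[x --> +oo] --> Num.sqrt (pi / 4 : R).
  apply: continuous_cvg; first exact: sqrt_continuous.
  exact: cvg_integral0_gauss_sqr.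
have -> : Num.sqrt (pi / 4) = Num.sqrt pi / 2 :> R.
  rewrite sqrtrM ?pi_ge0 // sqrtrV // (_ : 4 = 2 ^+ 2); last by rewrite -natrX.
  by rewrite sqrtr_sqr ger0_norm.
apply: cvg_trans; apply: near_eq_cvg; near=> t.
by rewrite sqrtr_sqr ger0_norm // integral0_gauss_ge0.
Unshelve. all: by end_near. Qed.

Lemma sqrt_cvgy : Num.sqrt t @[t --> +oo] --> (+oo : set_system R).
Proof.
apply/cvgryPgt => A; near=> t.
have [A0|A0] := ltP A 0; first by apply: lt_le_trans A0 _; exact: sqrtr_ge0.
have : A ^+ 2 < t by near: t; apply: nbhs_pinfty_gt; exact: num_real.
by move=> At; rewrite -(ger0_norm A0) -sqrtr_sqr ltr_sqrt // (le_lt_trans (sqr_ge0 A)).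
Unshelve. all: by end_near. Qed.

(** The substitution [t = x ^ 2] is made in the antiderivative: that of [t ^ (- 1/2) expR (- t)] is
    twice the Gauss integral up to [sqrt t]. *)
Lemma GI_half : GI 2^-1 = Num.sqrt pi.
Proof.
rewrite GIE /Rintegral.
have -> : 2^-1 - 1 = - 2^-1 :> R by field.
rewrite (_ : integral _ _ _ = (Num.sqrt pi)%:E) //.
apply: (etrans (@ge0_integral_oy R (gam (- 2^-1))
  (fun t => 2 * integral0_gauss (Num.sqrt t)) 0 (Num.sqrt pi) _ _ _ _ _)).
- by move=> t _; exact: gam_ge0.
- by move=> t; exact: gam_cont.
- move=> t t0; have st : 0 < Num.sqrt t by rewrite sqrtr_gt0.
  apply: is_derive1_eq (is_derive1Z 2 (is_derive1cmp
    (is_derive_integral0_gauss st) (is_derive1_sqrt t0))) _.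
  rewrite /gam /gauss_fun sqr_sqrtr ?(ltW t0) // powRN powR12_sqrt ?(ltW t0) //.
  by field; rewrite gt_eqF.
- apply: (@squeeze_cvgr _ _ _ _ (fun=> 0) (fun t => 2 * Num.sqrt t)).
  + near=> t; rewrite mulr_ge0 ?integral0_gauss_ge0 //=.
    by rewrite ler_pM2l // integral0_gauss_le // sqrtr_ge0.
  + exact: cvg_cst.
  + have h : 2 * Num.sqrt t @[t --> 0^'+] --> (2 * Num.sqrt 0 : R).
      apply: cvgM; first exact: cvg_cst.
      by apply: cvg_at_right_filter; exact: sqrt_continuous.
    by rewrite sqrtr0 mulr0 in h.
- have -> : Num.sqrt pi = 2 * (Num.sqrt pi / 2) :> R by field.
  apply: cvgM; first exact: cvg_cst.
  exact: (cvg_comp _ _ sqrt_cvgy integral0_gauss_cvgy).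
- by rewrite subr0.
Unshelve. all: by end_near. Qed.

(** Positivity of the functional sending [t ^ e] to [GI (e + 1)]. Later comparisons of integrals
    thereby become pointwise inequalities between finite sums of powers. *)
Lemma sum_GI_ge0 (I : Type) (r : seq I) (c e : I -> R) :
  (forall i, - 1 < e i) ->
  (forall t, 0 < t -> 0 <= \sum_(i <- r) c i * t `^ e i) ->
  0 <= \sum_(i <- r) c i * GI (e i + 1).
Proof.
move=> e1 H.
have mI : measurable ([set` `]0%R, +oo[%R] : set (measurableTypeR R)).
  exact: measurable_itv.
have E s : mu.-integrable [set` `]0%R, +oo[%R]
    (EFin \o (fun t => \sum_(i <- s) c i * gam (e i) t)) /\
  (\int[mu]_(t in `]0%R, +oo[) (\sum_(i <- s) c i * gam (e i) t))%R
    = \sum_(i <- s) c i * GI (e i + 1).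
  elim: s => [|i s [IH1 IH2]].
    have F0 : (fun t => \sum_(j <- [::]) c j * gam (e j) t) = fun=> 0.
      by apply/funext => t; rewrite big_nil.
    rewrite F0 big_nil; split; first exact: integrable0.
    by rewrite Rintegral_cst // mul0r.
  have Hi := integrableZl_fin (c i) (integrable_gam (e1 i)).
  have F : (fun t => \sum_(j <- i :: s) c j * gam (e j) t) =
      (fun t => c i * gam (e i) t + \sum_(j <- s) c j * gam (e j) t).
    by apply/funext => t; rewrite big_cons.
  rewrite F; split; first exact: (integrableD mI Hi IH1).
  rewrite (RintegralD mI Hi IH1) IH2 big_cons.
  by rewrite (RintegralZl _ mI (integrable_gam (e1 i))) GIE addrK.
have [_ <-] := E r; apply: Rintegral_ge0 => t /=.
rewrite in_itv /= andbT => /H t0.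
rewrite (eq_bigr (fun i => c i * t `^ e i * expR (- t))) => [|i _].
  by rewrite -mulr_suml mulr_ge0 ?expR_ge0.
by rewrite /gam mulrA.
Qed.

End EulerGamma.

(** * Gauss's limit with a rate, from tangent lines *)

Section GammaAsymptotics.
Variable R : realType.
Notation GI := (@eulerGamma_integral R).
Implicit Types (a b s t u x : R).

Lemma powR_le_tangent s u : 0 <= s <= 1 -> 0 < u -> u `^ s <= 1 + s * (u - 1).
Proof.
move=> /andP[s0 s1] u0; set L := 1 + s * (u - 1).
have L0 : 0 < L.
  rewrite /L; have -> : 1 + s * (u - 1) = (1 - s) + s * u by ring.
  have [->|sp] := eqVneq s 0; first by rewrite subr0 mul0r addr0.
  by rewrite ltr_wpDl ?subr_ge0 // mulr_gt0 // lt0r sp s0.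
have /andP[_ h1] := ln_sub1_ge (divr_gt0 u0 L0).
have Li : 0 < L^-1 by rewrite invr_gt0.
have /andP[_ h2] := ln_sub1_ge Li.
rewrite ln_div ?posrE // in h1; rewrite lnV ?posrE // in h2.
have s1' : 0 <= 1 - s by rewrite subr_ge0.
(* Weighted arithmetic-geometric mean: [L] is the mean of [u] and 1 with weights [s] and [1 - s], so
   the bounds [ln x <= x - 1] at [u / L] and [1 / L] add up to 0 on the right. *)
have e : s * (u / L - 1) + (1 - s) * (L^-1 - 1) = 0.
  by rewrite /L; field; rewrite -/L gt_eqF.
have H := lerD (ler_wpM2l s0 h1) (ler_wpM2l s1' h2).
rewrite e in H.
rewrite /powR gt_eqF // -[leRHS]lnK ?posrE // ler_expR; lra.
Qed.

Lemma powR_ge_tangent s u : s <= 0 -> 0 < u -> 1 + s * (u - 1) <= u `^ s.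
Proof.
move=> s0 u0; rewrite /powR gt_eqF //.
apply: le_trans (expR_ge1Dx _); rewrite lerD2l ler_wnM2l //.
by have /andP[_] := ln_sub1_ge u0.
Qed.

Lemma GI_nat n : GI n.+1%:R = n`!%:R.
Proof.
elim: n => [|n IH]; first by rewrite GI1.
by rewrite -natr1 GI_rec // IH factS natrM.
Qed.

(* Gauss: this ratio tends to 1, at rate 1/n. *)
Definition gratio b n : R := GI (n%:R + b) / (n`!%:R * n%:R `^ (b - 1)).

Lemma factR_gt0 n : 0 < n`!%:R :> R.
Proof. by rewrite ltr0n fact_gt0. Qed.

(** [t ^ s] is concave, hence below its tangent at [t = n]; integrating this against
    [t ^ n expR (- t)] leaves two factorials. *)
Lemma GI_upper n s : (0 < n)%N -> 0 <= s <= 1 ->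
  GI (n%:R + (1 + s)) <= n`!%:R * n%:R `^ s * (1 + s / n%:R).
Proof.
move=> n0 s01; have n0' : 0 < n%:R :> R by rewrite ltr0n.
pose c (i : nat) := nth 0 [:: n%:R `^ s * (1 - s); s * n%:R `^ s / n%:R; -1] i : R.
(* Beyond the three entries [nth] returns 0, an admissible exponent. *)
pose e (i : nat) := nth 0 [:: n%:R; n.+1%:R; n%:R + s] i : R.
have /andP[s0 s1] := s01.
have := @sum_GI_ge0 R _ [:: 0; 1; 2]%N c e.
rewrite !big_cons big_nil /c /e /= addr0 => H.
have : 0 <= n%:R `^ s * (1 - s) * GI (n%:R + 1) +
   (s * n%:R `^ s / n%:R * GI (n.+1%:R + 1) + -1 * GI (n%:R + s + 1)).
  apply: H => [i|t t0].
    have N0 : -1 < 0 :> R by [].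
    case: i => [|[|[|i]]] /=; rewrite ?nth_nil ?(lt_le_trans N0) ?ler0n //.
    by rewrite addr_ge0.
  rewrite !big_cons big_nil /= addr0.
  rewrite !powR_mulrn ?(ltW t0) // powRD ?(gt_eqF t0) ?implybT // powR_mulrn ?(ltW t0) //.
  have := powR_le_tangent s01 (divr_gt0 t0 n0').
  have -> : t `^ s = (t / n%:R) `^ s * n%:R `^ s.
    by rewrite -powRM ?divfK ?gt_eqF ?divr_ge0 ?ltW.
  have := powR_gt0 s n0'; have := exprn_gt0 n t0.
  move: ((t / n%:R) `^ s) (n%:R `^ s) => A B; rewrite exprS.
  move: (t ^+ n) => T T0 B0 HA.
  have -> : B * (1 - s) * T + (s * B / n%:R * (t * T) + -1 * (T * (A * B))) =
     (B * T) * (1 + s * (t / n%:R - 1) - A) by ring.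
  by apply: mulr_ge0; [rewrite ltW // mulr_gt0|rewrite subr_ge0].
rewrite !natr1 !GI_nat factS natrM (_ : n%:R + s + 1 = n%:R + (1 + s)); last by ring.
rewrite -natr1; move: (GI _) => G h.
rewrite -subr_ge0; apply: le_trans h _; rewrite le_eqVlt; apply/orP/or_introl/eqP.
by field; rewrite gt_eqF.
Qed.

(** [t ^ (n + s)] is split as [t ^ (n + 1) * t ^ (s - 1)]: as [s - 1 <= 0] the second factor is
    convex, and its tangent at [n + 1] bounds it from below. *)
Lemma GI_lower n s : (0 < n)%N -> 0 <= s <= 1 ->
  n`!%:R * n%:R `^ s * (1 - n%:R^-1) <= GI (n%:R + (1 + s)).
Proof.
move=> n0 s01; have n0' : 0 < n.+1%:R :> R by [].
pose B := n.+1%:R `^ (s - 1).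
pose c (i : nat) := nth 0 [:: - (B * (2 - s)); - ((s - 1) * B / n.+1%:R); 1] i : R.
pose e (i : nat) := nth 0 [:: n.+1%:R; n.+2%:R; n%:R + s] i : R.
have /andP[s0 s1] := s01.
have := @sum_GI_ge0 R _ [:: 0; 1; 2]%N c e.
rewrite !big_cons big_nil /c /e /= addr0 => H.
have : 0 <= - (B * (2 - s)) * GI (n.+1%:R + 1) +
   (- ((s - 1) * B / n.+1%:R) * GI (n.+2%:R + 1) + 1 * GI (n%:R + s + 1)).
  apply: H => [i|t t0].
    have N0 : -1 < 0 :> R by [].
    case: i => [|[|[|i]]] /=; rewrite ?nth_nil ?(lt_le_trans N0) ?ler0n //.
    by rewrite addr_ge0.
  rewrite !big_cons big_nil /= addr0.
  rewrite !powR_mulrn ?(ltW t0) //.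
  have -> : n%:R + s = n.+1%:R + (s - 1) by rewrite -natr1; ring.
  rewrite powRD ?(gt_eqF t0) ?implybT // powR_mulrn ?(ltW t0) //.
  have s1' : s - 1 <= 0 by lra.
  have := powR_ge_tangent s1' (divr_gt0 t0 n0').
  have -> : t `^ (s - 1) = (t / n.+1%:R) `^ (s - 1) * B.
    by rewrite -powRM ?divfK ?gt_eqF ?divr_ge0 ?ltW.
  have : 0 < B by exact: powR_gt0.
  have := exprn_gt0 n.+1 t0.
  move: ((t / n.+1%:R) `^ (s - 1)) => A; rewrite (exprS t n.+1).
  move: (t ^+ n.+1) => T T0 B0 HA.
  have -> : - (B * (2 - s)) * T + (- ((s - 1) * B / n.+1%:R) * (t * T) + 1 * (T * (A * B))) =
     (B * T) * (A - (1 + (s - 1) * (t / n.+1%:R - 1))) by ring.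
  by apply: mulr_ge0; [rewrite ltW // mulr_gt0|rewrite subr_ge0].
rewrite !natr1 !GI_nat (factS n.+1) (factS n) !natrM (_ : n%:R + s + 1 = n%:R + (1 + s)); last by ring.
move: (GI _) => G h.
have BE : B = n.+1%:R `^ s / n.+1%:R.
  apply: (mulIf (lt0r_neq0 n0')); rewrite divfK ?gt_eqF //.
  rewrite -[X in B * X = _]powRr1 ?(ltW n0') // -powRD ?subrK //.
  by rewrite pnatr_eq0 implybT.
have hh : n`!%:R * n.+1%:R `^ s * (1 - (1 - s) / n.+1%:R) <= G.
  rewrite -subr_ge0; apply: le_trans h _; rewrite le_eqVlt; apply/orP/or_introl/eqP.
  by rewrite BE -[n.+2%:R]natr1; field; rewrite gt_eqF.
apply: le_trans hh; rewrite -!mulrA ler_pM2l ?factR_gt0 //.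
have i1 : n.+1%:R^-1 <= n%:R^-1 :> R.
  by rewrite lef_pV2 ?posrE ?ltr0n // ler_nat.
have i0 : n%:R^-1 <= 1 :> R by rewrite invf_le1 ?ler1n ?ltr0n.
have i2 : 0 < n.+1%:R^-1 :> R by rewrite invr_gt0.
apply: ler_pM; rewrite ?powR_ge0 ?subr_ge0 //.
  by apply: ge0_ler_powR => //; rewrite ?nnegrE ?ler0n // ler_nat.
move: i1 i2; move: (n%:R^-1) (n.+1%:R^-1) => x y i1 i2; nra.
Qed.

End GammaAsymptotics.

(** * Gauss's limit for all shifts, and Pochhammer symbols *)

Section GammaRatio.
Variable R : realType.
Notation GI := (@eulerGamma_integral R).
Notation rinv := (@rinv R).
Implicit Types (a b s t u x : R).

Lemma near1_gratio12 s : 0 <= s <= 1 -> near1 rinv (gratio (1 + s)).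
Proof.
move=> s01; exists 1, 1%N => n n0; have n0' : 0 < n%:R :> R by rewrite ltr0n.
rewrite /gratio (addrC 1 s) addrK (addrC s 1).
have D : 0 < n`!%:R * n%:R `^ s by rewrite mulr_gt0 ?factR_gt0 ?powR_gt0.
have U := GI_upper n0 s01; have L := GI_lower n0 s01.
rewrite mul1r ler_distl lerBlDr -lerBlDr.
rewrite ler_pdivlMr // ler_pdivrMr // mulrC L /=.
apply: le_trans U _; rewrite mulrC ler_pM2r // lerD2l /rinv.
by rewrite ler_piMl ?invr_ge0 ?ler0n //; case/andP: s01.
Qed.

Lemma near1_lin b : near1 rinv (fun n => (n%:R + b) / n%:R).
Proof.
exists `|b|, 1%N => n n0; have n0' : 0 < n%:R :> R by rewrite ltr0n.
have -> : (n%:R + b) / n%:R - 1 = b / n%:R by field; rewrite gt_eqF.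
by rewrite normrM normfV (gtr0_norm n0').
Qed.

Lemma ev_ltn x : exists N, forall n, (N <= n)%N -> x < n%:R.
Proof.
exists (Num.truncn x).+1 => n nN; apply: lt_le_trans (truncnS_gt x) _.
by rewrite ler_nat.
Qed.

Lemma gratio_shift b : exists N, forall n, (N <= n)%N ->
  gratio (b + 1) n = (n%:R + b) / n%:R * gratio b n.
Proof.
have [N H] := ev_ltn `|b|; exists (maxn N 1) => n; rewrite geq_max => /andP[/H nb n0].
have n0' : 0 < n%:R :> R by rewrite ltr0n.
have nb0 : 0 < n%:R + b by have := ler_norm (- b); rewrite normrN; lra.
rewrite /gratio addrK addrA GI_rec //.
have -> : n%:R `^ b = n%:R `^ (b - 1) * n%:R.
  by rewrite -[X in _ * X]powRr1 ?(ltW n0') // -powRD ?subrK // (gt_eqF n0') implybT.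
by field; rewrite !gt_eqF ?factR_gt0 ?powR_gt0.
Qed.

Lemma near1_gratioS b : near1 rinv (gratio b) -> near1 rinv (gratio (b + 1)).
Proof.
move=> H; have [N E] := gratio_shift b.
apply: (near1_eq (N := N)) (near1M (rate_rinv R) (near1_lin b) H) => n /E.
by move=> ->.
Qed.

Lemma near1_gratioP b : near1 rinv (gratio (b + 1)) -> near1 rinv (gratio b).
Proof.
move=> H; have [N E] := gratio_shift b; have [M HM] := ev_ltn `|b|.
apply: (near1_eq (N := maxn N (maxn M 1))) (near1_div (rate_rinv R) H (near1_lin b)) => n.
rewrite !geq_max => /and3P[/E -> /HM nb n0].
have n0' : 0 < n%:R :> R by rewrite ltr0n.
have nb0 : 0 < n%:R + b by have := ler_norm (- b); rewrite normrN; lra.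
by rewrite mulrAC divff ?mul1r // mulf_neq0 ?invr_eq0 ?gt_eqF.
Qed.

(** The tangent bounds cover [1 <= b <= 2]. Any [b] differs from a point of this strip by an
    integer, and the functional equation moves the limit up or down by one. *)
Lemma near1_gratio b : near1 rinv (gratio b).
Proof.
have K (k : nat) c : near1 rinv (gratio c) -> near1 rinv (gratio (c + k%:R)).
  elim: k c => [|k IH] c H; first by rewrite addr0.
  by rewrite -natr1 addrA; apply/near1_gratioS/IH.
have K' (k : nat) c : near1 rinv (gratio (c + k%:R)) -> near1 rinv (gratio c).
  elim: k c => [|k IH] c; first by rewrite addr0.
  by rewrite -natr1 addrA => /near1_gratioP/IH.
have base : near1 rinv (gratio (1 + (b - (Num.floor b)%:~R))).
  apply: near1_gratio12; have := floor_itv b; rewrite intrD1 => /andP[h1 h2].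
  by apply/andP; split; lra.
have eb : b = 1 + (b - (Num.floor b)%:~R) + (Num.floor b - 1)%:~R.
  by rewrite intrB; ring.
move: base eb; move: (1 + _) (Num.floor b - 1) => c [k|k] H ->; first exact: K.
apply: (K' k.+1); rewrite NegzE intrN -addrA addNr addr0 //.
Qed.

Lemma poch_add (x : R) m k : poch x (m + k) = poch x m * poch (x + m%:R) k.
Proof.
elim: k => [|k IH]; first by rewrite addn0 {3}/poch big_ord0 mulr1.
by rewrite addnS !pochS IH -mulrA natrD addrA.
Qed.

Lemma poch_GI x m : 0 < x -> GI (x + m%:R) = poch x m * GI x.
Proof.
move=> x0; elim: m => [|m IH]; first by rewrite addr0 /poch big_ord0 mul1r.
rewrite -natr1 addrA GI_rec; last by rewrite ltr_pwDl.
by rewrite IH pochS; ring.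
Qed.

Lemma poch_neq0 x m : (forall k, x + k%:R != 0) -> poch x m != 0.
Proof.
move=> H; elim: m => [|m IH]; first by rewrite /poch big_ord0 oner_neq0.
by rewrite pochS mulf_neq0.
Qed.

Lemma nonint_add x : x \isn't a Num.int -> forall k : nat, x + k%:R != 0.
Proof.
move=> xN k; apply: contra xN; rewrite addr_eq0 => /eqP ->.
by rewrite rpredN intr_nat.
Qed.

Lemma Gamma_pos x : 0 < x -> Gamma x = GI x.
Proof. by rewrite /Gamma => ->. Qed.

(** For negative [x] the definition of [Gamma] goes through some [x + m > 0], and the integral on
    the left is referred to that point once [n >= m]; hence the threshold. *)
Lemma poch_Gamma x : (forall k, x + k%:R != 0) ->
  exists N, forall n, (N <= n)%N -> GI (n%:R + x) = poch x n * Gamma x.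
Proof.
move=> H; rewrite /Gamma; have [x0|x0] := ltP 0 x.
  by exists 0%N => n _; rewrite addrC poch_GI.
set m := (Num.truncn (- x)).+1; exists m => n mn.
have xm : 0 < x + m%:R.
  have := truncnS_gt (- x); rewrite -/m; lra.
rewrite -(subnKC mn) poch_add natrD addrC addrA (poch_GI _ xm).
by field; exact: poch_neq0.
Qed.

Lemma near1_neq0 (r u : nat -> R) : rate r -> near1 r u ->
  exists N, forall n, (N <= n)%N -> 0 < u n.
Proof.
move=> rr nu; have h : 0 < 2^-1 :> R by [].
have [N H] := near1_ev rr nu h; exists N => n /H; lra.
Qed.

Lemma near1_poch x : (forall k, x + k%:R != 0) ->
  near1 rinv (fun n => poch x n * Gamma x / (n`!%:R * n%:R `^ (x - 1))).
Proof.
move=> H; have [N E] := poch_Gamma H.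
by apply: (near1_eq (N := N)) (near1_gratio x) => n /E <-.
Qed.

(** Some sequence of multiples of [Gamma x] tends to 1. *)
Lemma Gamma_neq0 x : (forall k, x + k%:R != 0) -> Gamma x != 0.
Proof.
move=> H; have [N h] := near1_neq0 (rate_rinv R) (near1_poch H).
have := h N (leqnn N); apply: contraTneq => ->.
by rewrite mulr0 mul0r ltxx.
Qed.

Lemma GI_gt0 x : 0 < x -> 0 < GI x.
Proof.
move=> x0; rewrite lt0r GI_ge0 andbT -Gamma_pos //; apply: Gamma_neq0 => k.
by rewrite gt_eqF // ltr_pwDl.
Qed.

End GammaRatio.

(** * Pade approximation of a power *)

Section PadePoly.
Variable R : realType.
Implicit Types (a b x : R) (n k : nat).

(* [padeB a n] and [padeB (- a) n] are the denominator and the numerator of the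
   diagonal Pade approximant of [x ^ a] at [x = 1]. *)
Definition padeB b n : {poly R} := \poly_(k < n.+1) cbin (- b) n k.

Lemma coef_padeB b n k : (padeB b n)`_k = cbin (- b) n k.
Proof.
rewrite coef_poly ltnS /cbin.
by case: ifP => // ->.
Qed.

(** The hypergeometric equation; on coefficients it is the two-term relation [cbinSk]. *)
Lemma padeB_ode b n :
  'X * (1 - 'X) * (padeB b n)^`()^`()
  + ((1 + b)%:P + (2 * n%:R - b - 1)%:P * 'X) * (padeB b n)^`()
  - (n%:R * (n%:R - b))%:P * padeB b n = 0.
Proof.
set B := padeB b n.
have -> : 'X * (1 - 'X) * B^`()^`() + ((1 + b)%:P + (2 * n%:R - b - 1)%:P * 'X) * B^`()
  - (n%:R * (n%:R - b))%:P * B = 'X * B^`()^`() - 'X * ('X * B^`()^`())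
   + (1 + b)%:P * B^`() + (2 * n%:R - b - 1)%:P * ('X * B^`())
   - (n%:R * (n%:R - b))%:P * B by ring.
apply/polyP => k; rewrite coef0 !(coefB, coefD, coefCM, coefXM).
have E : k.+1%:R * (k.+1%:R - - b) * B`_k.+1
    - (n%:R + - b - k%:R) * (n%:R - k%:R) * B`_k = 0.
  by rewrite !coef_padeB cbinSk subrr.
rewrite -[RHS]E !coef_deriv; clearbody B.
by case: k {E} => [|[|k]] /=; rewrite ?coef_deriv /=; ring.
Qed.

(** The equation determines every coefficient from the constant one; it is applied to the difference
    of the two sides, whose constant coefficient is 0. *)
Lemma poly_ode1 (w : {poly R}) (m : nat) :
  (1 - 'X) * w^`() = - m%:R%:P * w -> w = (w`_0)%:P * (1 - 'X) ^+ m.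
Proof.
move=> wE; apply/eqP; rewrite -subr_eq0; set v := w - _.
have v0 : v`_0 = 0.
  rewrite /v coefB coefCM -[X in _ - _ * X]horner_coef0 horner_exp !hornerE.
  by rewrite subr0 expr1n mulr1 subrr.
have vE : (1 - 'X) * v^`() = - m%:R%:P * v.
  have d1 : (1 - 'X : {poly R})^`() = -1.
    by rewrite derivB derivX -polyC1 derivC sub0r.
  rewrite /v derivB derivM derivC mul0r add0r deriv_exp d1 mulrBr wE polyCMn.
  move: (w`_0)%:P => c; case: m {wE v v0} => [|m]; first by rewrite !mulr0n; ring.
  by rewrite /= exprS; ring.
apply/eqP/polyP => k; rewrite coef0; elim: k => [//|k IH].
have /(congr1 (fun p : {poly R} => p`_k)) := vE.
rewrite mulrBl mul1r coefB coefXM mulNr coefN coefCM IH mulr0 oppr0.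
case: k IH => [|k] IH; rewrite !coef_deriv ?subr0.
  by rewrite mulr1n.
rewrite IH mul0rn subr0 => /eqP; rewrite mulrn_eq0 /=.
by move/eqP.
Qed.

(* The Wronskian of [x ^ a * padeB a n] and [padeB (- a) n], up to a power of [x].
   The differential equation makes it a multiple of [(1 - x) ^ (2 n)]. *)
Definition wronsk a n : {poly R} :=
  'X * ((padeB (- a) n)^`() * padeB a n - padeB (- a) n * (padeB a n)^`())
  - a%:P * padeB (- a) n * padeB a n.

Lemma wronskE a n : wronsk a n =
  (- a * gbinom (n%:R - a) n * gbinom (n%:R + a) n)%:P * (1 - 'X) ^+ (2 * n).
Proof.
have -> : - a * gbinom (n%:R - a) n * gbinom (n%:R + a) n = (wronsk a n)`_0.
  rewrite -horner_coef0 /wronsk !(hornerD, hornerN, hornerM, hornerX, hornerC).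
  rewrite mul0r sub0r !horner_coef0 !coef_padeB /cbin leq0n opprK !gbinom0 subn0.
  by ring.
apply: poly_ode1; rewrite /wronsk.
have hB := padeB_ode a n; have hA := padeB_ode (- a) n.
move: (padeB a n) (padeB (- a) n) hB hA => B A hB hA.
rewrite derivB !derivM derivX derivB !derivM derivC.
apply/eqP; rewrite -subr_eq0; apply/eqP.
rewrite -[RHS](subr0 0) -[X in _ = X - _](mulr0 B) -[X in _ = _ - X](mulr0 A).
rewrite -[X in _ = B * X - _]hA -[X in _ = _ - A * X]hB.
rewrite !(polyCD, polyCB, polyCN, polyCM, polyC1) natrM polyCM.
ring.
Qed.

Lemma gbinom_vandermonde x y n :
  \sum_(k < n.+1) gbinom x k * gbinom y (n - k) = gbinom (x + y) n.
Proof.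
elim: n => [|n IH]; first by rewrite big_ord1 !gbinom0 mulr1.
have nN : n.+1%:R != 0 :> R by [].
apply: (mulfI nN); rewrite gbinomS -IH !mulr_sumr.
transitivity (\sum_(k < n.+2) (k%:R * gbinom x k * gbinom y (n.+1 - k)) +
   \sum_(k < n.+2) gbinom x k * ((n.+1 - k)%N%:R * gbinom y (n.+1 - k))).
  rewrite -big_split /=; apply: eq_bigr => k _.
  have kn : (k <= n.+1)%N by rewrite -ltnS.
  by rewrite natrB //; ring.
rewrite big_ord_recl mul0r mul0r add0r [X in _ + X]big_ord_recr /= subnn mul0r mulr0 addr0.
rewrite -big_split /=; apply: eq_bigr => k _.
have kn : (k <= n)%N by rewrite -ltnS.
by rewrite /bump /= add1n subSS gbinomS subSn // gbinomS natrB //; ring.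
Qed.

(** Vandermonde's identity makes the value at 1 independent of [a], so the numerator and the
    denominator agree there and the Pade error vanishes. *)
Lemma padeB1 a n : (padeB a n).[1] = gbinom (2 * n%:R) n.
Proof.
rewrite horner_poly -[X in gbinom X](_ : (n%:R - a) + (n%:R + a) = _); last by ring.
rewrite -gbinom_vandermonde; apply: eq_bigr => k _.
by rewrite expr1n mulr1 /cbin -ltnS ltn_ord opprK.
Qed.

Lemma gbinom_poch x n : gbinom (n%:R + x) n = poch (x + 1) n / n`!%:R.
Proof.
rewrite /gbinom /poch (reindex_inj rev_ord_inj) /=; congr (_ / _).
by apply: eq_bigr => k _; rewrite natrB // -natr1; ring.
Qed.

(** In this form Gauss's limit at [1/2] gives the asymptotics of the central binomial
    coefficient. *)
Lemma gbinom_central n : gbinom (2 * n%:R) n * n`!%:R = 4 ^+ n * poch (2^-1 : R) n.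
Proof.
have -> : 2 * n%:R = n%:R + n%:R :> R by ring.
rewrite gbinom_poch divfK; last by rewrite gt_eqF // factR_gt0.
elim: n => [|n IH]; first by rewrite /poch !big_ord0 mulr1.
have E : (n%:R + 1) * poch (n.+1%:R + 1 : R) n.+1
    = (n%:R + 1) * ((2 * n%:R + 1) * 2 * poch (n%:R + 1) n).
  rewrite pochS (_ : n.+1%:R + 1 = (n%:R + 1) + 1%:R); last by rewrite -natr1.
  have := @poch_add R (n%:R + 1) 1 n; rewrite add1n pochS.
  rewrite {2}/poch big_ord1 addr0 => E.
  rewrite [LHS](_ : _ = ((n%:R + 1) * poch (n%:R + 1 + 1%:R) n) * (n%:R + 1 + 1 + n%:R));
    last by ring.
  by rewrite -E; ring.
move/mulfI: E => ->; last by rewrite natr1.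
by rewrite IH pochS exprS; field.
Qed.

End PadePoly.

(** * The differential equation in the variable [y = sqrt x] *)

Section PadeODE.
Variable R : realType.
Implicit Types (a b x y : R) (n k : nat).

Lemma powRB1 y b : 0 < y -> y `^ (b - 1) = y `^ b / y.
Proof.
move=> y0; apply: (mulIf (lt0r_neq0 y0)); rewrite divfK ?gt_eqF //.
by rewrite -[X in _ * X = _]powRr1 ?(ltW y0) // -powRD ?subrK // (gt_eqF y0) implybT.
Qed.

(** The normalisation is that of [a = 1/2], where the Pade polynomials are, up to a constant, the
    even and odd parts of [(1 + y) ^ (2 n + 1)]. After division by this power the solutions are 1
    and [((y - 1) / (y + 1)) ^ (2 n + 1)]; for other [a] the equation is a perturbation of that
    one. *)
Definition hpre b n y : R := y `^ (b + 2^-1) * ((y + 1) ^+ (2 * n).+1)^-1.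

(* In the variable [y = sqrt x] the exponents at 0 become [1/2 +- a]; then
   [Uf] has derivative [(a ^ 2 - 1/4) * (y ^ 2 - 1) / y ^ 2 * Hf], which is small. *)
Definition Hf b n y : R := hpre b n y * (padeB b n).[y ^+ 2].

Definition dHf b n y : R := hpre b n y *
  (((b + 2^-1) / y - (2 * n%:R + 1) / (y + 1)) * (padeB b n).[y ^+ 2]
    + 2 * y * (padeB b n)^`().[y ^+ 2]).

Definition Uf b n y : R := (y ^+ 2 - 1) * dHf b n y - 2 * (2 * n%:R + 1) * Hf b n y.

Lemma hpre_derive b n y : 0 < y -> is_derive y 1 (hpre b n)
  (hpre b n y * ((b + 2^-1) / y - (2 * n%:R + 1) / (y + 1))).
Proof.
move=> y0; have y1 : 0 < y + 1 by rewrite addr_gt0.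
have yn : (y + 1) ^+ (2 * n).+1 != 0 by rewrite expf_neq0 // gt_eqF.
apply: is_derive1_eq (is_derive1M (is_derive1_powR (b + 2^-1) y0)
  (is_derive1I (is_derive1X _ (is_derive1D (is_derive1id y) (is_derive1C 1 y))) yn)) _.
rewrite powRB1 // /hpre addr0 mulr1 /= exprS -(natr1 (2 * n)) natrM.
have : (y + 1) ^+ (2 * n) != 0 by rewrite expf_neq0 // gt_eqF.
move: ((y + 1) ^+ (2 * n)) (y `^ _) => E P E0.
by field; rewrite E0 !gt_eqF.
Qed.

Lemma horner_sq_derive (p : {poly R}) y :
  is_derive y 1 (fun t => p.[t ^+ 2]) (p^`().[y ^+ 2] * (2 * y)).
Proof.
have h := @is_derive1cmp R (horner p) (fun t => t ^+ 2) y _ _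
  (is_derive_poly p (y ^+ 2)) (is_derive1X 2 (is_derive1id y)).
by apply: is_derive1_eq h _; rewrite /= expr1 mulr1.
Qed.

Lemma Hf_derive b n y : 0 < y -> is_derive y 1 (Hf b n) (dHf b n y).
Proof.
move=> y0; apply: is_derive1_eq
  (is_derive1M (hpre_derive b n y0) (horner_sq_derive (padeB b n) y)) _.
by rewrite /dHf; ring.
Qed.

Lemma Uf_derive b n y : 0 < y ->
  is_derive y 1 (Uf b n) ((b ^+ 2 - 4^-1) * ((y ^+ 2 - 1) / y ^+ 2) * Hf b n y).
Proof.
move=> y0; have y1 : 0 < y + 1 by rewrite addr_gt0.
have y1N : y + 1 != 0 by rewrite gt_eqF.
have yN : y != 0 by rewrite gt_eqF.
have dq : is_derive y 1 (fun t => (b + 2^-1) / t - (2 * n%:R + 1) / (t + 1))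
    (- (b + 2^-1) / y ^+ 2 + (2 * n%:R + 1) / (y + 1) ^+ 2).
  apply: is_derive1_eq (is_derive1B (is_derive1Z (b + 2^-1) (is_derive1I (is_derive1id y) yN))
    (is_derive1Z (2 * n%:R + 1) (is_derive1I (is_derive1D (is_derive1id y) (is_derive1C 1 y)) y1N))) _.
  by field; rewrite y1N yN.
have dy : is_derive y 1 (fun t : R => t ^+ 2 - 1) (2 * y).
  apply: is_derive1_eq (is_derive1B (is_derive1X 2 (is_derive1id y)) (is_derive1C 1 y)) _.
  by rewrite /= expr1; ring.
have d2 : is_derive y 1 (fun t : R => 2 * t) 2.
  by apply: is_derive1_eq (is_derive1Z 2 (is_derive1id y)) _; rewrite mulr1.
have dd : is_derive y 1 (dHf b n) _ := is_derive1M (hpre_derive b n y0)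
  (is_derive1D (is_derive1M dq (horner_sq_derive (padeB b n) y))
     (is_derive1M d2 (horner_sq_derive (padeB b n)^`() y))).
apply: is_derive1_eq (is_derive1B (is_derive1M dy dd)
  (is_derive1Z (2 * (2 * n%:R + 1)) (Hf_derive b n y0))) _.
have := congr1 (fun p : {poly R} => p.[y ^+ 2]) (padeB_ode b n).
rewrite !(hornerD, hornerN, hornerM, hornerX, hornerC).
rewrite /dHf /Hf; move: (padeB b n).[_] (padeB b n)^`().[_] (padeB b n)^`()^`().[_] => p p1 p2.
move: (hpre b n y) => h E.
apply/eqP; rewrite -subr_eq0; apply/eqP.
transitivity (- 4 * h * 0 : R); last by rewrite mulr0.
by rewrite -E; field; rewrite y1N yN.
Qed.

Lemma Hf1 a n : Hf a n 1 = gbinom (2 * n%:R) n / 2 ^+ (2 * n).+1.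
Proof. by rewrite /Hf /hpre powR1 mul1r expr1n padeB1 mulrC. Qed.

(** Up to sign and a square in the denominator, this is the derivative of the quotient of
    [Hf (- a) n] by [Hf a n], with its zero of order [2 n] at 1 made explicit. *)
Lemma Hf_wronsk a n y : 0 < y ->
  dHf a n y * Hf (- a) n y - Hf a n y * dHf (- a) n y =
  2 * (a * gbinom (n%:R - a) n * gbinom (n%:R + a) n)
   * (((y + 1) ^+ (2 * n).+1)^-1) ^+ 2 * (y ^+ 2 - 1) ^+ (2 * n).
Proof.
move=> y0; have y1 : 0 < y + 1 by rewrite addr_gt0.
have y1N : y + 1 != 0 by rewrite gt_eqF.
have yN : y != 0 by rewrite gt_eqF.
have := congr1 (fun p : {poly R} => p.[y ^+ 2]) (wronskE a n).
rewrite /wronsk !(hornerD, hornerN, hornerM, hornerX, hornerC, horner_exp).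
rewrite /dHf /Hf /hpre; move: (padeB a n).[_] (padeB a n)^`().[_] => B B1.
move: (padeB (- a) n).[_] (padeB (- a) n)^`().[_] => A A1.
have -> : (1 - y ^+ 2) ^+ (2 * n) = (y ^+ 2 - 1) ^+ (2 * n).
  by rewrite -opprB exprNn mulnC -signr_odd oddM andbF expr0 mul1r.
move=> E.
have P : y `^ (a + 2^-1) * y `^ (- a + 2^-1) = y.
  rewrite -powRD ?yN ?implybT // (_ : _ + _ = 1) ?powRr1 ?ltW //.
  by field.
move: (y `^ _) (y `^ _) P E => Pa Pm P E.
have I0 : (y + 1) ^+ (2 * n).+1 != 0 by rewrite expf_neq0.
move: ((y + 1) ^+ (2 * n).+1) I0 => I I0.
have h : 2 * (a * gbinom (n%:R - a) n * gbinom (n%:R + a) n) * I^-1 ^+ 2 *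
  (y ^+ 2 - 1) ^+ (2 * n) = - 2 * I^-1 ^+ 2 *
  (- a * gbinom (n%:R - a) n * gbinom (n%:R + a) n * (y ^+ 2 - 1) ^+ (2 * n)) by ring.
rewrite h -E; apply/eqP; rewrite -subr_eq0; apply/eqP.
transitivity ((Pa * Pm - y) * I^-1 ^+ 2 * (2 * a / y * A * B + 2 * y * (B1 * A - B * A1))).
  by field; rewrite yN y1N I0.
by rewrite (mulrC Pa) P subrr !mul0r.
Qed.

End PadeODE.

(** * A barrier argument for the perturbed equation *)

Section Barrier.
Variable R : realType.
Implicit Types (x y : R) (n p : nat).

Lemma limr_at_right_ge (f : R -> R) (l c y : R) : 1 < y ->
  f x @[x --> 1^'+] --> l -> (forall x, 1 < x -> x < y -> f x <= c) -> l <= c.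
Proof.
move=> y1 fl fc; apply: (cvgr_to_le fl); near=> x.
by apply: fc; near: x; [exact: nbhs_right_gt|exact: nbhs_right_lt].
Unshelve. all: by end_near. Qed.

(** The solution of the unperturbed equation that vanishes at 1. *)
Definition Ef n y : R := ((y - 1) / (y + 1)) ^+ (2 * n).+1.
Definition dEf n y : R :=
  (2 * n%:R + 1) * ((y - 1) / (y + 1)) ^+ (2 * n) * (2 / (y + 1) ^+ 2).

Lemma Ef_derive n y : 0 < y -> is_derive y 1 (Ef n) (dEf n y).
Proof.
move=> y0; have y1 : y + 1 != 0 by rewrite gt_eqF // addr_gt0.
have d1 := is_derive1I (is_derive1D (is_derive1id y) (is_derive1C 1 y)) y1.
have d2 := is_derive1M (is_derive1B (is_derive1id y) (is_derive1C 1 y)) d1.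
apply: is_derive1_eq (is_derive1X (2 * n).+1 d2) _.
rewrite /dEf /= -(natr1 (2 * n)) natrM; move: (((y - 1) / (y + 1)) ^+ (2 * n)) => P.
by field; rewrite y1.
Qed.

Lemma Ef_gt0 n y : 1 < y -> 0 < Ef n y.
Proof. by move=> y1; rewrite exprn_gt0 // divr_gt0; lra. Qed.

Lemma Ef1 n : Ef n 1 = 0.
Proof. by rewrite /Ef subrr mul0r expr0n. Qed.

Lemma dEfE n y : 1 < y -> (y ^+ 2 - 1) * dEf n y = 2 * (2 * n%:R + 1) * Ef n y.
Proof.
move=> y1; rewrite /dEf /Ef (exprS _ (2 * n)); move: (((y - 1) / (y + 1)) ^+ (2 * n)) => P.
by field; lra.
Qed.

Variables (H dH U : R -> R) (kap K : R) (n p : nat).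
Hypothesis n0 : (0 < n)%N.
Hypothesis p0 : (0 < p)%N.
Hypothesis kap_le : `|kap| <= 2 * p%:R.
Hypothesis H1 : H 1 = 0.
Hypothesis dHP : forall y, 0 < y -> is_derive y 1 H (dH y).
Hypothesis UE : forall y, U y = (y ^+ 2 - 1) * dH y - 2 * (2 * n%:R + 1) * H y.
Hypothesis dUP : forall y, 0 < y ->
  is_derive y 1 U (kap * ((y ^+ 2 - 1) / y ^+ 2) * H y).
Hypothesis HK : H y / Ef n y @[y --> 1^'+] --> K.

Definition Mf y : R := (1 + (y - 1) / n%:R) ^+ p.
Definition dMf y : R := p%:R * (1 + (y - 1) / n%:R) ^+ p.-1 / n%:R.
Definition d2Mf y : R :=
  p%:R * (p.-1%:R * (1 + (y - 1) / n%:R) ^+ p.-2 / n%:R) / n%:R.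

Let nR0 : 0 < n%:R :> R. Proof. by rewrite ltr0n. Qed.

Let base_derive y : is_derive y 1 (fun t : R => 1 + (t - 1) / n%:R) (n%:R^-1).
Proof.
apply: is_derive1_eq (is_derive1D (is_derive1C 1 y)
 (is_derive1M (is_derive1B (is_derive1id y) (is_derive1C 1 y)) (is_derive1C n%:R^-1 y))) _.
by rewrite mulr0 add0r addr0 subr0 mul1r.
Qed.

Lemma Mf_derive y : is_derive y 1 Mf (dMf y).
Proof. exact: (is_derive1X p (base_derive y)). Qed.

Lemma dMf_derive y : is_derive y 1 dMf (d2Mf y).
Proof.
apply: is_derive1_eq (is_derive1M (is_derive1Z p%:R (is_derive1X p.-1 (base_derive y)))
  (is_derive1C n%:R^-1 y)) _.
by rewrite mulr0 addr0.
Qed.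

Lemma base_ge1 y : 1 <= y -> 1 <= 1 + (y - 1) / n%:R.
Proof. by move=> y1; rewrite lerDl divr_ge0 // subr_ge0. Qed.

Lemma Mf_ge1 y : 1 <= y -> 1 <= Mf y.
Proof. by move=> /base_ge1 h; exact: exprn_ege1. Qed.

Lemma d2Mf_ge0 y : 1 <= y -> 0 <= d2Mf y.
Proof.
move=> /base_ge1 h; rewrite divr_ge0 ?ler0n // mulr_ge0 // divr_ge0 ?ler0n //.
by rewrite mulr_ge0 // exprn_ge0 //; exact: le_trans h.
Qed.

Definition Tf y : R := (y ^+ 2 - 1) * (dMf y * Ef n y).
Definition dTf y : R :=
  2 * y * (dMf y * Ef n y) + (y ^+ 2 - 1) * (d2Mf y * Ef n y + dMf y * dEf n y).

Lemma sq1_derive y : is_derive y 1 (fun t : R => t ^+ 2 - 1) (2 * y).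
Proof.
apply: is_derive1_eq (is_derive1B (is_derive1X 2 (is_derive1id y)) (is_derive1C 1 y)) _.
by rewrite /= expr1; ring.
Qed.

Lemma Tf_derive y : 0 < y -> is_derive y 1 Tf (dTf y).
Proof.
move=> y0; exact: (is_derive1M (sq1_derive y) (is_derive1M (dMf_derive y) (Ef_derive n y0))).
Qed.

(** As [(y ^ 2 - 1) dEf = 2 (2 n + 1) Ef], the coefficient of [dMf * Ef] is [2 y + 4 n + 2], at
    least twice [n + y - 1]; since [dMf / Mf = p / (n + y - 1)] their product is at least
    [2 p >= |kap|]. The second derivative only helps. *)
Lemma dTf_ge y : 1 < y -> `|kap| * ((y ^+ 2 - 1) / y ^+ 2) * (Mf y * Ef n y) <= dTf y.
Proof.
move=> y1; have y0 : 0 < y by lra.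
have E0 := Ef_gt0 n y1; have h := base_ge1 (ltW y1).
have -> : dTf y = ((2 * y + 2 * (2 * n%:R + 1)) * dMf y + (y ^+ 2 - 1) * d2Mf y) * Ef n y.
  rewrite /dTf; have := dEfE n y1; move: (dEf n y) (Ef n y) => d E e.
  rewrite [LHS](_ : _ = 2 * y * (dMf y * E) + (y ^+ 2 - 1) * d2Mf y * E
    + dMf y * ((y ^+ 2 - 1) * d)); last by ring.
  by rewrite e; ring.
rewrite mulrA ler_pM2r //.
have q1 : (y ^+ 2 - 1) / y ^+ 2 <= 1.
  by rewrite ler_pdivrMr ?exprn_gt0 // mul1r gerBl.
have q0 : 0 <= (y ^+ 2 - 1) / y ^+ 2 by rewrite divr_ge0 ?sqr_ge0 //; nra.
apply: (@le_trans _ _ (`|kap| * Mf y)).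
  rewrite ler_wpM2r ?(le_trans ler01 (Mf_ge1 (ltW y1))) //.
  by rewrite ler_piMr.
apply: (@le_trans _ _ ((2 * y + 2 * (2 * n%:R + 1)) * dMf y)); last first.
  by rewrite lerDl mulr_ge0 ?d2Mf_ge0 ?(ltW y1) //; nra.
rewrite /Mf /dMf -[in leLHS](prednK p0) exprS.
have : 0 <= (1 + (y - 1) / n%:R) ^+ p.-1 by rewrite exprn_ge0 // (le_trans ler01 h).
move: (_ ^+ p.-1) => S S0.
have -> : (2 * y + 2 * (2 * n%:R + 1)) * (p%:R * S / n%:R) =
   S * ((2 * y + 2 * (2 * n%:R + 1)) * p%:R / n%:R) by ring.
rewrite [leLHS](_ : _ = S * (`|kap| * (1 + (y - 1) / n%:R))); last by ring.
apply: ler_wpM2l => //.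
apply: (@le_trans _ _ (2 * p%:R * (1 + (y - 1) / n%:R))).
  by rewrite ler_wpM2r // (le_trans ler01 h).
rewrite -subr_ge0.
have -> : (2 * y + 2 * (2 * n%:R + 1)) * p%:R / n%:R - 2 * p%:R * (1 + (y - 1) / n%:R)
  = p%:R * (2 * n%:R + 4) / n%:R by field; rewrite gt_eqF.
by rewrite divr_ge0 ?ler0n // mulr_ge0 // addr_ge0 // mulr_ge0.
Qed.

(** The quotient extended by its limit: at 1 itself division by zero would give 0, and continuity on
    the closed interval is needed for a maximum to exist. *)
Definition hh y : R := if y <= 1 then K else H y / Ef n y.

Lemma hh_near y : 1 < y -> {near y, (fun t => H t / Ef n t) =1 hh}.
Proof.
move=> y1; near=> t; rewrite /hh leNgt; case: ifP => // /negP[].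
by near: t; exact: lt_nbhsr.
Unshelve. all: by end_near. Qed.

(** By [dEfE] the terms in [dH] and [H] combine into [U], so a bound on [U] can be integrated to one
    on the quotient. *)
Lemma quot_derive y : 1 < y ->
  is_derive y 1 (fun t => H t / Ef n t) (U y / ((y ^+ 2 - 1) * Ef n y)).
Proof.
move=> y1; have y0 : 0 < y by lra.
have E0 : Ef n y != 0 by rewrite gt_eqF // Ef_gt0.
have yy : y ^+ 2 - 1 != 0 by rewrite gt_eqF //; nra.
apply: is_derive1_eq (is_derive1M (dHP y0) (is_derive1I (Ef_derive n y0) E0)) _.
rewrite UE; have := dEfE n y1; move: (dEf n y) (Ef n y) E0 => d E E0 e.
have -> : d = 2 * (2 * n%:R + 1) * E / (y ^+ 2 - 1).
  by rewrite -e mulrAC divff // mul1r.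
by field; rewrite E0 yy.
Qed.

Lemma hh_cont Y : 1 < Y -> {within `[1, Y], continuous (fun y => `|hh y| / Mf y)}.
Proof.
move=> Y1.
have MC y : 1 <= y -> {for y, continuous (fun t => (Mf t)^-1)}.
  move=> y1; apply: (is_derive1_continuous (is_derive1I (Mf_derive y) _)).
  by rewrite gt_eqF // (lt_le_trans ltr01) // Mf_ge1.
have C y : 1 < y -> {for y, continuous (fun t => `|hh t| / Mf t)}.
  move=> y1; apply: continuousM; last by apply: MC; exact: ltW.
  apply: continuous_comp; last exact: norm_continuous.
  have e := hh_near y1.
  rewrite /prop_for /continuous_at -(nbhs_singleton e).
  apply: cvg_trans (is_derive1_continuous (quot_derive y1)).
  by apply: near_eq_cvg; exact: e.
apply/(continuous_within_itvP _ Y1); split.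
- by move=> y; rewrite in_itv /= => /andP[y1 _]; exact: C.
- apply: cvgM; last by apply: cvg_at_right_filter; exact: MC.
  rewrite {2}/hh lexx; apply: cvg_norm; apply: cvg_trans HK.
  apply: near_eq_cvg; near=> t; rewrite /hh leNgt.
  have -> // : 1 < t by near: t; exact: nbhs_right_gt.
- by apply: cvg_at_left_filter; exact: C.
Unshelve. all: by end_near. Qed.

(* If [k] is the maximum of [|H / Ef| / Mf] on [1, y], comparing [U] with the
   barrier [k * Tf] yields [|H / Ef - K| <= k * (Mf - 1)], whence [k <= |K|]. *)
Lemma barrier y : 1 < y -> `|H y / Ef n y - K| <= `|K| * (Mf y - 1).
Proof.
move=> y1; have [c] := EVT_max (ltW y1) (hh_cont y1).
rewrite in_itv /= => /andP[c1 cy] cmax; set k := `|hh c| / Mf c in cmax.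
have k0 : 0 <= k by rewrite divr_ge0 // (le_trans ler01) // Mf_ge1.
have hle t : 1 < t -> t <= y -> `|H t| <= k * (Mf t * Ef n t).
  move=> t1 ty; have := cmax t; rewrite in_itv /= (ltW t1) ty => /(_ isT).
  rewrite /hh (leNgt t 1) t1 /= ler_pdivrMr ?(lt_le_trans ltr01) ?Mf_ge1 ?(ltW t1) //.
  by rewrite normrM normfV (gtr0_norm (Ef_gt0 n t1)) ler_pdivrMr ?Ef_gt0 // mulrA.
have T1 : Tf 1 = 0 by rewrite /Tf expr1n subrr mul0r.
have U1 : U 1 = 0 by rewrite UE H1 expr1n subrr mul0r mulr0 subr0.
(* First integration, starting from [U 1 = Tf 1 = 0]. The sign [s] treats both sides of the absolute
   value at once. *)
have key (s t : R) : `|s| = 1 -> 1 < t -> t <= y -> s * U t <= k * Tf t.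
  move=> s1 t1 ty.
  suff : k * Tf 1 - s * U 1 <= k * Tf t - s * U t.
    by rewrite T1 U1 !mulr0 subr0 subr_ge0.
  apply: (@ge0_derive1_nondecreasing R (fun t => k * Tf t - s * U t)
    (fun t => k * dTf t - s * (kap * ((t ^+ 2 - 1) / t ^+ 2) * H t)) 1 t (ltW t1)).
  - move=> x /andP[x1 _]; have x0 : 0 < x by lra.
    exact: (is_derive1_continuous (is_derive1B (is_derive1Z k (Tf_derive x0))
      (is_derive1Z s (dUP x0)))).
  - move=> x /andP[x1 _]; have x0 : 0 < x by lra.
    exact: (is_derive1B (is_derive1Z k (Tf_derive x0)) (is_derive1Z s (dUP x0))).
  - move=> x /andP[x1 xt]; rewrite subr_ge0.
    have q0 : 0 <= (x ^+ 2 - 1) / x ^+ 2 by rewrite divr_ge0 ?sqr_ge0 //; nra.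
    apply: le_trans (ler_norm _) _; rewrite normrM s1 mul1r normrM (normrM kap) (ger0_norm q0).
    apply: le_trans (ler_wpM2l k0 (dTf_ge x1)).
    rewrite (mulrCA k); apply: ler_wpM2l; first by rewrite mulr_ge0.
    by apply: hle => //; apply: le_trans ty; exact: ltW.
(* Second integration; the lower endpoint [x > 1] is sent to 1, where the quotient has the limit
   [K]. *)
have key2 (s t : R) : `|s| = 1 -> 1 < t -> t <= y ->
    s * (H t / Ef n t) - s * K <= k * (Mf t - 1).
  move=> s1 t1 ty.
  suff : k * 1 - s * K <= k * Mf t - s * (H t / Ef n t) by lra.
  apply: (@limr_at_right_ge (fun x => k * Mf x - s * (H x / Ef n x)) _ _ t t1).
    apply: cvgB; apply: cvgM; [exact: cvg_cst| |exact: cvg_cst|exact: HK].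
    have M1 : Mf 1 = 1 by rewrite /Mf subrr mul0r addr0 expr1n.
    rewrite -[X in _ --> X]M1; apply: cvg_at_right_filter.
    exact: (is_derive1_continuous (Mf_derive 1)).
  move=> x x1 xt.
  have D (z : R) : 1 < z -> is_derive z 1 (fun x => k * Mf x - s * (H x / Ef n x))
      (k * dMf z - s * (U z / ((z ^+ 2 - 1) * Ef n z))).
    move=> z1; exact: (is_derive1B (is_derive1Z k (Mf_derive z))
      (is_derive1Z s (quot_derive z1))).
  apply: (@ge0_derive1_nondecreasing R (fun x => k * Mf x - s * (H x / Ef n x))
    (fun z => k * dMf z - s * (U z / ((z ^+ 2 - 1) * Ef n z))) x t (ltW xt)).
  - by move=> z /andP[xz _]; apply: is_derive1_continuous (D z _); exact: lt_le_trans xz.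
  - by move=> z /andP[xz _]; apply: D; exact: lt_trans xz.
  - move=> z /andP[xz zt]; have z1 : 1 < z by exact: lt_trans xz.
    have q0 : 0 < (z ^+ 2 - 1) * Ef n z by rewrite mulr_gt0 ?Ef_gt0 //; nra.
    have := key s z s1 z1 (le_trans (ltW zt) ty).
    rewrite subr_ge0 mulrA ler_pdivrMr // /Tf; lra.
have diff t : 1 < t -> t <= y -> `|H t / Ef n t - K| <= k * (Mf t - 1).
  move=> t1 ty; have := key2 1 t; have := key2 (- 1) t.
  rewrite normrN normr1 => /(_ erefl t1 ty) h1 /(_ erefl t1 ty) h2.
  by rewrite ler_norml; apply/andP; split; lra.
(* If the maximum is attained at [c > 1], then [k Mf(c) <= |K| + k (Mf(c) - 1)] and the terms in
   [Mf(c)] cancel; at [c = 1] the value of [k] is [|K|] itself. *)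
suff kK : k <= `|K|.
  by apply: le_trans (diff y y1 (lexx _)) _; rewrite ler_wpM2r // subr_ge0 Mf_ge1 // ltW.
move: c1; rewrite le_eqVlt => /predU1P[c1|c1].
  by rewrite /k /hh -c1 lexx /Mf subrr mul0r addr0 expr1n divr1.
have Mc : 0 < Mf c by rewrite (lt_le_trans ltr01) // Mf_ge1 // ltW.
have hk : `|H c / Ef n c| = k * Mf c.
  by rewrite /k /hh leNgt c1 /= divfK // gt_eqF.
have := diff c c1 cy.
have := ler_normD K (H c / Ef n c - K); rewrite addrC subrK hk.
by move: (`|_ - _|) => z h1 h2; lra.
Qed.

End Barrier.

(** * Uniform estimate of the Pade error for [y > 1] *)

Section PadeError.
Variable R : realType.
Implicit Types (a x y : R) (n p : nat).

Lemma gbinom_central_gt0 n : 0 < gbinom (2 * n%:R : R) n.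
Proof.
have : 0 < gbinom (2 * n%:R : R) n * n`!%:R.
  rewrite gbinom_central mulr_gt0 ?exprn_gt0 //.
  by apply: prodr_gt0 => i _; rewrite ltr_pwDl.
by rewrite pmulr_lgt0 // factR_gt0.
Qed.

Lemma Hf1_gt0 a n : 0 < Hf a n 1.
Proof. by rewrite Hf1 divr_gt0 ?gbinom_central_gt0 // exprn_gt0. Qed.

Definition Kc a n : R :=
  a * gbinom (n%:R - a) n * gbinom (n%:R + a) n / ((2 * n%:R + 1) * Hf a n 1).

Definition Hd a n y : R := Hf a n y - Hf (- a) n y.

(** L'Hopital is applied to [1 - Hf (- a) n / Hf a n] and not to [Hd] itself: the derivative is a
    Wronskian over a square, its zero of order [2 n] cancels against that of [dEf], and one step is
    enough. *)
Lemma Hd_Ef_cvg a n : Hd a n y / Ef n y @[y --> 1^'+] --> Kc a n.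
Proof.
have CH (b : R) : {for 1, continuous (Hf b n)}.
  exact: (is_derive1_continuous (Hf_derive b n ltr01)).
have [d d1 dP] : exists2 d, 1 < d & forall y, 1 < y -> y < d -> 0 < Hf a n y.
  have : \forall y \near (1 : R), 0 < Hf a n y.
    exact: (cvgr_gt (Hf a n 1) (CH a) 0 (Hf1_gt0 a n)).
  move=> [e /= e0 eP]; exists (1 + e); first by rewrite ltrDl.
  by move=> y y1 ye; apply: eP => /=; rewrite ler0_norm; lra.
pose k0 := a * gbinom (n%:R - a) n * gbinom (n%:R + a) n.
pose f y := 1 - Hf (- a) n y / Hf a n y.
pose df y := (dHf a n y * Hf (- a) n y - Hf a n y * dHf (- a) n y) / Hf a n y ^+ 2.
have dfE y : 1 < y -> y < d ->
    df y / dEf n y = k0 / (2 * n%:R + 1) / Hf a n y ^+ 2.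
  move=> y1 yd; have y0 : 0 < y by lra.
  have n1 : 2 * n%:R + 1 != 0 :> R by rewrite gt_eqF // ltr_wpDl ?mulr_ge0.
  have y1' : y + 1 != 0 by rewrite gt_eqF //; lra.
  rewrite /df Hf_wronsk // /dEf -/k0 expr_div_n (exprS _ (2 * n)).
  rewrite (_ : y ^+ 2 - 1 = (y - 1) * (y + 1)); last by ring.
  rewrite exprMn.
  have : (y + 1) ^+ (2 * n) != 0 by rewrite expf_neq0.
  have : (y - 1) ^+ (2 * n) != 0 by rewrite expf_neq0 // gt_eqF //; lra.
  have := dP y y1 yd => /lt0r_neq0.
  move: ((y + 1) ^+ (2 * n)) ((y - 1) ^+ (2 * n)) (Hf a n y) => P Q h h0 Q0 P0.
  by field; rewrite h0 Q0 P0 n1 y1'.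
have lf : f y / Ef n y @[y --> 1^'+] --> k0 / (2 * n%:R + 1) / Hf a n 1 ^+ 2.
  apply: (@lhopital_at_right R f df (Ef n) (dEf n) 1 d) => //.
  - move=> y; rewrite in_itv /= => /andP[y1 yd]; have y0 : 0 < y by lra.
    have h0 : Hf a n y != 0 by rewrite gt_eqF // dP.
    apply: is_derive1_eq (is_derive1B (is_derive1C 1 y) (is_derive1M (Hf_derive (- a) n y0)
      (is_derive1I (Hf_derive a n y0) h0))) _.
    by rewrite /df; field.
  - by move=> y; rewrite in_itv /= => /andP[y1 yd]; apply: Ef_derive; lra.
  - have f1 : f 1 = 0.
      by rewrite /f !Hf1 divff ?subrr // -(Hf1 a) gt_eqF // Hf1_gt0.
    rewrite -[X in _ --> X]f1; apply: cvg_at_right_filter.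
    apply: cvgB; first exact: cvg_cst.
    apply: cvgM; first exact: CH.
    by apply: cvgV; [rewrite gt_eqF // Hf1_gt0|exact: CH].
  - rewrite -[X in _ --> X](Ef1 R n); apply: cvg_at_right_filter.
    exact: (is_derive1_continuous (Ef_derive n ltr01)).
  - move=> y; rewrite in_itv /= => /andP[y1 yd]; rewrite /dEf gt_eqF //.
    have p1 : 0 < y + 1 by lra.
    have p2 : 0 < y - 1 by lra.
    apply: mulr_gt0; last by rewrite divr_gt0 // exprn_gt0.
    apply: mulr_gt0; last by rewrite exprn_gt0 // divr_gt0.
    by rewrite ltr_wpDl ?mulr_ge0.
  - have : k0 / (2 * n%:R + 1) / Hf a n y ^+ 2 @[y --> 1^'+] -->
      k0 / (2 * n%:R + 1) / Hf a n 1 ^+ 2.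
      apply: cvgM; first exact: cvg_cst.
      apply: cvgV; first by rewrite expf_neq0 // gt_eqF // Hf1_gt0.
      rewrite expr2; apply: cvg_at_right_filter.
      by under eq_fun do rewrite expr2; apply: cvgM; exact: CH.
    apply: cvg_trans; apply: near_eq_cvg; near=> y.
    by rewrite dfE.
have -> : Kc a n = Hf a n 1 * (k0 / (2 * n%:R + 1) / Hf a n 1 ^+ 2).
  rewrite /Kc -/k0; have h0 := Hf1_gt0 a n.
  by field; rewrite !gt_eqF // ltr_wpDl ?mulr_ge0.
have : Hf a n y * (f y / Ef n y) @[y --> 1^'+] -->
    Hf a n 1 * (k0 / (2 * n%:R + 1) / Hf a n 1 ^+ 2).
  by apply: cvgM; [apply: cvg_at_right_filter; exact: CH|exact: lf].
apply: cvg_trans; apply: near_eq_cvg; near=> y.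
by rewrite mulrA /f mulrBr mulr1 mulrCA divff ?mulr1 // gt_eqF // dP.
Unshelve. all: by end_near. Qed.

Lemma Hd_bound a n p y : (0 < n)%N -> (0 < p)%N -> `|a ^+ 2 - 4^-1| <= 2 * p%:R ->
  1 < y -> `|Hd a n y / Ef n y - Kc a n| <= `|Kc a n| * ((1 + (y - 1) / n%:R) ^+ p - 1).
Proof.
move=> n0 p0 ap y1.
apply: (@barrier R (Hd a n) (fun y => dHf a n y - dHf (- a) n y)
  (fun y => Uf a n y - Uf (- a) n y) (a ^+ 2 - 4^-1) (Kc a n) n p) => //.
- by rewrite /Hd !Hf1 subrr.
- by move=> t t0; exact: (is_derive1B (Hf_derive a n t0) (Hf_derive (- a) n t0)).
- by move=> t; rewrite /Uf /Hd; ring.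
- move=> t t0.
  apply: is_derive1_eq (is_derive1B (Uf_derive a n t0) (Uf_derive (- a) n t0)) _.
  by rewrite sqrrN /Hd mulrBr.
- exact: Hd_Ef_cvg.
Qed.

Lemma pade_Hd a n y : 0 < y ->
  y `^ (2 * a) * (padeB a n).[y ^+ 2] - (padeB (- a) n).[y ^+ 2] =
  y `^ (a - 2^-1) * (y + 1) ^+ (2 * n).+1 * Hd a n y.
Proof.
move=> y0; have yN : y != 0 by rewrite gt_eqF.
have E0 : (y + 1) ^+ (2 * n).+1 != 0 by rewrite expf_neq0 // gt_eqF // addr_gt0.
rewrite /Hd /Hf /hpre; move: (padeB a n).[_] (padeB (- a) n).[_] => B A.
have P1 : y `^ (2 * a) = y `^ (a - 2^-1) * y `^ (a + 2^-1).
  by rewrite -powRD ?yN ?implybT //; congr (_ `^ _); ring.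
have P2 : 1 = y `^ (a - 2^-1) * y `^ (- a + 2^-1).
  by rewrite -powRD ?yN ?implybT // (_ : _ + _ = 0) ?powRr0 //; ring.
rewrite P1 -[X in _ - X]mul1r [in X in _ - X * _]P2.
by move: ((y + 1) ^+ _) E0 => E E0; field.
Qed.

End PadeError.

(** * The linear form *)

Section KeyInequality.
Variable R : realType.
Implicit Types (s l v x y : R).

Lemma ln1B_bound v : 0 <= v <= 2^-1 -> `|ln (1 - v) + v + v ^+ 2 / 2| <= v ^+ 3.
Proof.
move=> /andP[v0 vh].
have D x : x < 1 -> is_derive x 1 (fun t : R => ln (1 - t) + t + t ^+ 2 / 2)
    (- x ^+ 2 / (1 - x)).
  move=> x1; have h : 0 < 1 - x by lra.
  apply: is_derive1_eq (is_derive1D (is_derive1D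
    (is_derive1ln (is_derive1B (is_derive1C 1 x) (is_derive1id x)) h) (is_derive1id x))
    (is_derive1M (is_derive1X 2 (is_derive1id x)) (is_derive1C 2^-1 x))) _.
  by rewrite /= expr1; field; rewrite gt_eqF.
have D3 x : is_derive x 1 (fun t : R => t ^+ 3) (3 * x ^+ 2).
  by apply: is_derive1_eq (is_derive1X 3 (is_derive1id x)) _; rewrite /= mulr1.
have q x : 0 < x -> x < v -> 0 <= x ^+ 2 / (1 - x) <= 3 * x ^+ 2.
  move=> x0 xv; have h : 0 < 1 - x by lra.
  by rewrite divr_ge0 ?sqr_ge0 ?(ltW h) //= ler_pdivrMr //; nra.
pose f (t : R) := ln (1 - t) + t + t ^+ 2 / 2.
have f0 : f 0 = 0 by rewrite /f subr0 ln1 expr0n /= mul0r !addr0.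
have x1 (x : R) : x <= v -> x < 1 by move=> ?; lra.
rewrite ler_norml; apply/andP; split.
  rewrite lerNl -subr_ge0 opprK addrC -/(f v).
  have -> : 0 = f 0 + 0 ^+ 3 by rewrite f0 expr0n addr0.
  apply: (@ge0_derive1_nondecreasing R (fun t => f t + t ^+ 3)
    (fun x => - x ^+ 2 / (1 - x) + 3 * x ^+ 2) 0 v v0).
  - by move=> x /andP[_ /x1 xl]; exact: (is_derive1_continuous (is_derive1D (D x xl) (D3 x))).
  - by move=> x /andP[_ /ltW/x1 xl]; exact: (is_derive1D (D x xl) (D3 x)).
  - by move=> x /andP[x0 xv]; have /andP[_] := q x x0 xv; lra.
apply: (@le_trans _ _ 0); last by rewrite exprn_ge0.
rewrite -/(f v) -oppr_ge0 -oppr0 -f0.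
apply: (@ge0_derive1_nondecreasing R (fun t => - f t) (fun x => - (- x ^+ 2 / (1 - x))) 0 v v0).
- by move=> x /andP[_ /x1 xl]; exact: (is_derive1_continuous (is_derive1N (D x xl))).
- by move=> x /andP[_ /ltW/x1 xl]; exact: (is_derive1N (D x xl)).
- by move=> x /andP[x0 xv]; have /andP[] := q x x0 xv; rewrite mulNr opprK.
Qed.

Lemma ln1D_sub (x : R) : `|x| <= 2^-1 -> `|ln (1 + x) - x| <= 2 * x ^+ 2.
Proof.
rewrite ler_norml => /andP[h1 h2]; have p0 : 0 < 1 + x by lra.
have /andP[l1 l2] := ln_sub1_ge p0.
have e : 1 - (1 + x)^-1 = x - x ^+ 2 / (1 + x) by field; rewrite gt_eqF.
have : x ^+ 2 / (1 + x) <= 2 * x ^+ 2.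
  by rewrite ler_pdivrMr //; have := sqr_ge0 x; nra.
have := sqr_ge0 x; rewrite e in l1.
by rewrite ler_norml => ? ?; apply/andP; split; lra.
Qed.

(** Replaces the logarithm of a product by a plain sum with a quadratic remainder; it serves for the
    [m]-th moment and for the terms of [q_seq]. *)
Lemma prod_expR (x : nat -> R) (m : nat) :
  (forall i, (i < m)%N -> `|x i| <= 2^-1) ->
  exists2 d, `|d| <= 2 * \sum_(i < m) x i ^+ 2 &
    \prod_(i < m) (1 + x i) = expR (\sum_(i < m) x i + d).
Proof.
elim: m => [|m IH] H.
  by exists 0; rewrite !big_ord0 ?mulr0 ?normr0 // addr0 expR0.
have [i im|d dle dE] := IH; first by apply: H; exact: leqW.
have hm := H m (leqnn _); have := hm; rewrite ler_norml => /andP[h1 h2].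
have p0 : 0 < 1 + x m by lra.
exists (d + (ln (1 + x m) - x m)).
  rewrite big_ord_recr /= mulrDr; apply: le_trans (ler_normD _ _) _.
  by apply: lerD => //; exact: ln1D_sub.
rewrite !big_ord_recr /= dE -[X in _ * X]lnK ?posrE // -expRD.
by congr expR; ring.
Qed.

(* Writing [y = s * expR l] with [s = sqrt N], the factor [(1 - 1 / y) ^ (N + 1)]
   is compared with the power of [expR l] whose Gamma moments are explicit. *)
Definition psi s l : R := (s ^+ 2 + 1) * ln (1 - expR (- l) / s) + s.

Let vE s l : expR (- l) / s = (s * expR l)^-1.
Proof. by rewrite expRN invfM mulrC. Qed.

(** From [ln (1 - v) <= - v] and [1 - l <= expR (- l)]. Unlike the two-sided estimate it holds
    arbitrarily close to [y = 1]. *)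
Lemma psi_le s l : 1 <= s -> 1 < s * expR l -> psi s l <= s * l.
Proof.
move=> s1 y1; have s0 : 0 < s by lra.
have v0 : 0 < expR (- l) / s by rewrite divr_gt0 ?expR_gt0.
have v1 : 0 < 1 - expR (- l) / s.
  by rewrite subr_gt0 vE invf_lt1 //; lra.
have /andP[_ h] := ln_sub1_ge v1.
have e := expR_ge1Dx (- l).
have e2 : s ^+ 2 * (expR (- l) / s) = s * expR (- l) by field; rewrite gt_eqF.
rewrite /psi; have s2 : 0 <= s ^+ 2 + 1 by rewrite addr_ge0 ?sqr_ge0.
have := ler_wpM2l s2 h; nra.
Qed.

Lemma psi_approx s l mu : 1 <= s -> 2 <= s * expR l -> s - 2 <= mu <= s ->
  `|psi s l - (- 2^-1 + mu * l)| <= 12 / s * expR ((s + 3) * `|l|).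
Proof.
move=> s1 y2 /andP[mu1 mu2]; have s0 : 0 < s by lra.
set c := `|l|; have c0 : 0 <= c by exact: normr_ge0.
have F : expR ((s + 3) * c) = expR (s * c) * expR c ^+ 3.
  by rewrite -expRM_natl -expRD; congr expR; ring.
have Y1 : 1 <= expR c by have := expR_ge1Dx c; lra.
have sc0 : 0 <= s * c by rewrite mulr_ge0 // ltW.
have X1 : s * c <= expR (s * c) by have := expR_ge1Dx (s * c); lra.
have X2 : (s * c) ^+ 2 <= 2 * expR (s * c).
  by have := expR_ge1Dxn 1 sc0; rewrite (_ : 2`!%:R = 2 :> R) //; lra.
have X0 : 1 <= expR (s * c) by have := expR_ge1Dx (s * c); lra.
have e1 : expR (- l) <= expR c by rewrite ler_expR /c -normrN ler_norm.
have e2 : expR (- (2 * l)) <= expR c ^+ 2.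
  by rewrite -expRM_natl ler_expR -mulrN ler_wpM2l // /c -normrN ler_norm.
have e0 := expR_gt0 (- l).
set v := expR (- l) / s.
have v0 : 0 < v by rewrite divr_gt0 ?expR_gt0.
have vh : v <= 2^-1 by rewrite /v vE lef_pV2 ?posrE //; lra.
have vc : v <= expR c / s by rewrite ler_pM2r ?invr_gt0.
have := @ln1B_bound v; rewrite (ltW v0) vh => /(_ isT).
set d := ln (1 - v) + v + v ^+ 2 / 2 => dv.
(* Each of the six pieces is [O(1 / s)] times an exponential in [|l|], powers of [s * |l|] being
   absorbed by [expR (s * |l|)]. The constant [-1/2] is the value of [- s ^ 2 v ^ 2 / 2] at
   [l = 0]. *)
have -> : psi s l - (- 2^-1 + mu * l) = s * (1 - expR (- l) - l) + (s - mu) * l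
   + (1 - expR (- (2 * l))) / 2 - v - v ^+ 2 / 2 + (s ^+ 2 + 1) * d.
  have -> : expR (- (2 * l)) = (s * v) ^+ 2.
    by rewrite /v mulrCA divff ?gt_eqF // mulr1 -expRM_natl mulrN.
  have -> : expR (- l) = s * v by rewrite /v mulrCA divff ?gt_eqF // mulr1.
  by rewrite /psi -/v /d; field.
have T1 : `|s * (1 - expR (- l) - l)| <= 4 / s * (expR (s * c) * expR c).
  have h1 : 0 <= expR (- l) - 1 + l by have := expR_ge1Dx (- l); lra.
  have h2 : expR (- l) - 1 <= - l * expR (- l).
    have := expR_ge1Dx l; have : expR l * expR (- l) = 1 by rewrite -expRD subrr expR0.
    by move: (expR l) => E E1 E2; nra.
  have h3 : `|expR (- l) - 1| <= 2 * c * expR c.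
    have := expR_sub_le (- l) 0; rewrite expR0 subr0 normrN -/c => /le_trans; apply.
    by rewrite -mulrA (mulrCA 2) ler_wpM2l //; lra.
  have h4 : expR (- l) - 1 + l <= 2 * c ^+ 2 * expR c.
    apply: (@le_trans _ _ (- l * (expR (- l) - 1))); first by lra.
    apply: le_trans (ler_norm _) _; rewrite normrM normrN -/c.
    by have := ler_wpM2l c0 h3; lra.
  rewrite normrM (gtr0_norm s0) distrC.
  have -> : `|l - (1 - expR (- l))| = expR (- l) - 1 + l.
    by rewrite (_ : l - _ = expR (- l) - 1 + l) ?ger0_norm //; ring.
  apply: le_trans (ler_wpM2l (ltW s0) h4) _.
  rewrite [leLHS](_ : _ = 2 / s * expR c * (s * c) ^+ 2); last first.
    by field; rewrite gt_eqF.
  rewrite [leRHS](_ : _ = 2 / s * expR c * (2 * expR (s * c))); last by ring.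
  by rewrite ler_wpM2l // mulr_ge0 ?divr_ge0 // ltW.
have T2 : `|(s - mu) * l| <= 2 / s * expR (s * c).
  rewrite normrM -/c ger0_norm; last by lra.
  apply: (@le_trans _ _ (2 * c)); first by rewrite ler_wpM2r //; lra.
  rewrite [leLHS](_ : _ = 2 / s * (s * c)); last by field; rewrite gt_eqF.
  by rewrite ler_wpM2l // divr_ge0 // ltW.
have T3 : `|(1 - expR (- (2 * l))) / 2| <= 2 / s * (expR (s * c) * expR c ^+ 2).
  rewrite normrM (ger0_norm (_ : 0 <= 2^-1)) // distrC.
  have := expR_sub_le (- (2 * l)) 0; rewrite expR0 subr0 normrN normrM -/c (ger0_norm (ler0n R 2)).
  have g : 1 <= expR c ^+ 2 by rewrite exprn_ege1.
  have : 2 * c * (expR (- (2 * l)) + 1) <= 2 * c * (2 * expR c ^+ 2).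
    by rewrite ler_wpM2l ?mulr_ge0 //; lra.
  have : 2 / s * (s * c * expR c ^+ 2) <= 2 / s * (expR (s * c) * expR c ^+ 2).
    rewrite ler_wpM2l ?divr_ge0 ?(ltW s0) // ler_wpM2r //; lra.
  rewrite (_ : 2 / s * (s * c * expR c ^+ 2) = 2 * c * expR c ^+ 2); last first.
    by field; rewrite gt_eqF.
  by move: (expR c ^+ 2) (`|_|) (expR _) => E N G; lra.
have T4 : `|v| <= expR c / s by rewrite gtr0_norm.
have T5 : `|v ^+ 2 / 2| <= expR c / s.
  rewrite ger0_norm ?divr_ge0 ?sqr_ge0 //; apply: le_trans vc.
  by rewrite expr2; nra.
have T6 : `|(s ^+ 2 + 1) * d| <= 2 / s * expR c ^+ 3.
  have s2 : 1 <= s ^+ 2 by rewrite exprn_ege1.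
  rewrite normrM (ger0_norm (_ : 0 <= s ^+ 2 + 1)); last by lra.
  have s2' : 0 <= s ^+ 2 + 1 by lra.
  apply: le_trans (ler_wpM2l s2' dv) _.
  have v3 : v ^+ 3 <= (expR c / s) ^+ 3.
    by rewrite lerXn2r // nnegrE ?(ltW v0) // divr_ge0 ?expR_ge0 // ltW.
  apply: le_trans (ler_wpM2l s2' v3) _.
  apply: (@le_trans _ _ (2 * s ^+ 2 * (expR c / s) ^+ 3)).
    rewrite ler_wpM2r ?exprn_ge0 ?divr_ge0 ?expR_ge0 ?(ltW s0) //; lra.
  by rewrite le_eqVlt; apply/orP/or_introl/eqP; field; rewrite gt_eqF.
rewrite F.
have B : forall A, 0 <= A -> A <= expR (s * c) * expR c ^+ 3 -> A / s <= expR (s * c) * expR c ^+ 3 / s.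
  by move=> A _ h; rewrite ler_pM2r ?invr_gt0.
set Z := expR (s * c) * expR c ^+ 3 / s.
have Y2 : expR c <= expR c ^+ 2 by rewrite expr2 ler_peMr.
have Y3 : expR c ^+ 2 <= expR c ^+ 3 by rewrite (exprS _ 2) ler_peMl.
have Xp : 0 <= expR (s * c) := expR_ge0 _.
have B1 : expR (s * c) * expR c / s <= Z by rewrite ler_pM2r ?invr_gt0 // ler_wpM2l //; lra.
have B2 : expR (s * c) / s <= Z.
  by rewrite ler_pM2r ?invr_gt0 // ler_peMr //; lra.
have B3 : expR (s * c) * expR c ^+ 2 / s <= Z by rewrite ler_pM2r ?invr_gt0 // ler_wpM2l.
have B4 : expR c / s <= Z.
  rewrite ler_pM2r ?invr_gt0 //; apply: (@le_trans _ _ (expR c ^+ 3)); first lra.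
  by rewrite ler_peMl //; lra.
have B6 : expR c ^+ 3 / s <= Z by rewrite ler_pM2r ?invr_gt0 // ler_peMl //; lra.
have -> : 12 / s * (expR (s * c) * expR c ^+ 3) = 4 * Z + 2 * Z + 2 * Z + Z + Z + 2 * Z.
  by rewrite /Z; field; rewrite gt_eqF.
apply: le_trans (ler_normD _ _) _; apply: lerD; last by lra.
apply: le_trans (ler_normB _ _) _; apply: lerD; last by lra.
apply: le_trans (ler_normB _ _) _; apply: lerD; last by lra.
apply: le_trans (ler_normD _ _) _; apply: lerD; last by lra.
apply: le_trans (ler_normD _ _) _; apply: lerD; lra.
Qed.

Lemma psi_key s l mu : 1 <= s -> 1 < s * expR l -> s - 2 <= mu <= s -> 0 <= mu ->
  `|expR (psi s l) - expR (- 2^-1 + mu * l)| <= 24 / s * expR ((2 * s + 3) * `|l|).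
Proof.
move=> s1 y1 mus mu0; have s0 : 0 < s by lra.
have /andP[_ mu2] := mus.
set c := `|l|; have c0 : 0 <= c by exact: normr_ge0.
have lc : l <= c by exact: ler_norm.
have P1 : expR (psi s l) <= expR (s * c).
  rewrite ler_expR; apply: le_trans (psi_le s1 y1) _.
  by rewrite ler_wpM2l // ltW.
have P2 : expR (- 2^-1 + mu * l) <= expR (s * c).
  rewrite ler_expR; have := ler_wpM2l mu0 lc; have := ler_wpM2r c0 mu2; lra.
have F : expR ((2 * s + 3) * c) = expR (s * c) * expR ((s + 3) * c).
  by rewrite -expRD; congr expR; ring.
have [y2|y2] := leP 2 (s * expR l).
  apply: le_trans (expR_sub_le _ _) _.
  have := psi_approx s1 y2 mus; rewrite -/c => A.
  apply: le_trans (ler_pM _ _ A (lerD P1 P2)) _; rewrite ?addr_ge0 ?expR_ge0 //.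
  by rewrite F le_eqVlt; apply/orP/or_introl/eqP; ring.
apply: (@le_trans _ _ (expR (s * c))).
  have := expR_ge0 (psi s l); have := expR_ge0 (- 2^-1 + mu * l).
  by rewrite ler_norml; move: (expR _) (expR _) P1 P2 => a b; lra.
rewrite F mulrCA ler_peMr ?expR_ge0 //.
have e1 : expR (- l) <= expR ((s + 3) * c).
  rewrite ler_expR; have : - l <= c by rewrite /c -normrN ler_norm.
  by nra.
apply: (@le_trans _ _ (2 / s * expR (- l))); last first.
  apply: ler_pM => //; rewrite ?divr_ge0 ?expR_ge0 ?(ltW s0) //.
  by rewrite ler_pM2r ?invr_gt0 //; lra.
rewrite expRN -mulrA -invfM ler_pdivlMr ?mul1r; first exact: ltW.
by rewrite mulr_gt0 ?expR_gt0.
Qed.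

Lemma exprD1_sub1 (u : R) p : 0 <= u -> (1 + u) ^+ p - 1 <= p%:R * u * (1 + u) ^+ p.
Proof.
move=> u0; have h : 1 <= 1 + u by lra.
elim: p => [|p IH]; first by rewrite expr0 subrr !mul0r.
rewrite exprS -natr1; have Q1 : 1 <= (1 + u) ^+ p by rewrite exprn_ege1.
have q0 : 0 <= p%:R * u by rewrite mulr_ge0.
apply: (@le_trans _ _ ((p%:R * u + u) * (1 + u) ^+ p)); first by lra.
rewrite (mulrDl p%:R) mul1r ler_wpM2l ?addr_ge0 // ler_peMl //; lra.
Qed.

(** Meant for [h = Hd / Ef] and [u = (y - 1) / n]. As [u = O(expR l / s)], the deviation of [h] from
    [K] costs the same factor [1 / s] and a few more units in the exponent. *)
Lemma psi_key_h s l mu (u h K : R) (p : nat) : 1 <= s -> 1 < s * expR l ->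
  s - 2 <= mu <= s -> 0 <= mu -> 0 <= u <= 2 * expR l / s ->
  `|h - K| <= `|K| * ((1 + u) ^+ p - 1) ->
  `|expR (psi s l) * h - K * expR (- 2^-1 + mu * l)| <=
    `|K| * ((24 + p%:R * 2 * 3 ^+ p) / s * expR ((2 * s + (p%:R + 4)) * `|l|)).
Proof.
move=> s1 y1 mus mu0 /andP[u0 u1] hK; have s0 : 0 < s by lra.
set c := `|l|; have c0 : 0 <= c by exact: normr_ge0.
have lc : l <= c by exact: ler_norm.
have Y1 : 1 <= expR c by have := expR_ge1Dx c; lra.
have uY : u <= 2 / s * expR c.
  apply: le_trans u1 _; rewrite mulrAC ler_wpM2l ?divr_ge0 ?(ltW s0) //.
  by rewrite ler_expR.
have uY2 : 1 + u <= 3 * expR c.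
  have : 2 / s <= 2 by rewrite ler_pdivrMr // ler_peMr.
  by move=> h2; have := ler_wpM2r (expR_ge0 c) h2; lra.
have b1 : (1 + u) ^+ p - 1 <= p%:R * (2 / s * expR c) * (3 * expR c) ^+ p.
  apply: le_trans (exprD1_sub1 p u0) _; apply: ler_pM.
  - by rewrite mulr_ge0.
  - by rewrite exprn_ge0 //; lra.
  - by rewrite ler_wpM2l.
  - by rewrite lerXn2r // nnegrE; lra.
have P1 : expR (psi s l) <= expR (s * c).
  rewrite ler_expR; apply: le_trans (psi_le s1 y1) _.
  by rewrite ler_wpM2l // ltW.
have -> : expR (psi s l) * h - K * expR (- 2^-1 + mu * l) =
   K * (expR (psi s l) - expR (- 2^-1 + mu * l)) + expR (psi s l) * (h - K) by ring.
apply: le_trans (ler_normD _ _) _; rewrite !normrM (ger0_norm (expR_ge0 _)).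
have A1 := psi_key s1 y1 mus mu0.
rewrite mulrDl mulrDl mulrDr; apply: lerD.
  apply: ler_wpM2l => //; apply: le_trans A1 _.
  rewrite ler_wpM2l ?divr_ge0 ?(ltW s0) // ler_expR ler_wpM2r //.
  by rewrite lerD2l; have := ler0n R p; lra.
apply: le_trans (ler_wpM2l (expR_ge0 _) hK) _.
rewrite mulrCA ler_wpM2l //.
have D0 : 0 <= (1 + u) ^+ p - 1 by rewrite subr_ge0 exprn_ege1 //; lra.
apply: le_trans (ler_pM (expR_ge0 _) D0 P1 b1) _.
rewrite exprMn -(expRM_natl p c).
rewrite [leLHS](_ : _ = p%:R * 2 * 3 ^+ p / s * (expR (s * c) * expR c * expR (p%:R * c))); last by ring.
rewrite -!expRD ler_wpM2l ?divr_ge0 ?mulr_ge0 ?exprn_ge0 ?(ltW s0) //.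
by rewrite ler_expR; have := mulr_ge0 (ltW s0) c0; lra.
Qed.

End KeyInequality.

(** * The linear form as the integral of a generalized polynomial *)

Section LinearForm.
Variable R : realType.
Notation GI := (@eulerGamma_integral R).
Implicit Types (a b x y t : R) (n p : nat) (r : seq (R * R)).

(* A generalized polynomial is a list of (coefficient, exponent) pairs; [gint] is
   its integral against [expR (- t)], so inequalities between integrals reduce
   to pointwise ones without any integrability side condition. *)
Definition gpoly r t : R := \sum_(ce <- r) ce.1 * t `^ ce.2.
Definition gint r : R := \sum_(ce <- r) ce.1 * GI (ce.2 + 1).
Definition gdom r := all (fun ce => -1 < ce.2) r.

Lemma gint_ge0 r : gdom r -> (forall t, 0 < t -> 0 <= gpoly r t) -> 0 <= gint r.
Proof.
move=> dr H; rewrite /gint.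
(* [sum_GI_ge0] asks for an exponent above -1 at every index, inside the list or not. *)
pose e i := if -1 < (nth (0, 0) r i).2 then (nth (0, 0) r i).2 else 0.
have eE i : (i < size r)%N -> e i = (nth (0, 0) r i).2.
  by move=> ir; rewrite /e; move/all_nthP : dr => /(_ (0, 0) i ir) ->.
have S (f : R * R -> R) (g : nat -> R) :
    (forall i, (i < size r)%N -> f (nth (0, 0) r i) = g i) ->
    \sum_(ce <- r) f ce = \sum_(i <- iota 0 (size r)) g i.
  move=> fg; rewrite (big_nth (0, 0)) /index_iota subn0.
  by apply: eq_big_seq => i; rewrite mem_iota => /andP[_ /fg].
rewrite (S _ (fun i => (nth (0, 0) r i).1 * GI (e i + 1))); last first.
  by move=> i /eE ->.
apply: sum_GI_ge0 => [i|t /H]; first by rewrite /e; case: ifP.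
rewrite /gpoly (S _ (fun i => (nth (0, 0) r i).1 * t `^ e i)) //.
by move=> i /eE ->.
Qed.

Lemma gpoly_cat r r' t : gpoly (r ++ r') t = gpoly r t + gpoly r' t.
Proof. exact: big_cat. Qed.

Lemma gint_cat r r' : gint (r ++ r') = gint r + gint r'.
Proof. exact: big_cat. Qed.

Lemma gdom_cat r r' : gdom (r ++ r') = gdom r && gdom r'.
Proof. exact: all_cat. Qed.

Definition gscale c r := [seq (c * ce.1, ce.2) | ce <- r].

Lemma gpoly_scale c r t : gpoly (gscale c r) t = c * gpoly r t.
Proof. by rewrite /gpoly big_map mulr_sumr; apply: eq_bigr => i _; rewrite mulrA. Qed.

Lemma gint_scale c r : gint (gscale c r) = c * gint r.
Proof. by rewrite /gint big_map mulr_sumr; apply: eq_bigr => i _; rewrite mulrA. Qed.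

Lemma gdom_scale c r : gdom (gscale c r) = gdom r.
Proof. by rewrite /gdom all_map. Qed.

Lemma gint_le r r' : gdom r -> gdom r' ->
  (forall t, 0 < t -> gpoly r t <= gpoly r' t) -> gint r <= gint r'.
Proof.
move=> dr dr' H; rewrite -subr_ge0 -mulN1r -gint_scale -gint_cat.
apply: gint_ge0; first by rewrite gdom_cat dr' gdom_scale.
by move=> t /H; rewrite gpoly_cat gpoly_scale mulN1r subr_ge0.
Qed.

Lemma gint_dist r r0 r' : gdom r -> gdom r0 -> gdom r' ->
  (forall t, 0 < t -> `|gpoly r t - gpoly r0 t| <= gpoly r' t) ->
  `|gint r - gint r0| <= gint r'.
Proof.
move=> dr d0 d' H; rewrite ler_distl lerBlDr -!gint_cat.
have dc : gdom (r ++ r') by rewrite gdom_cat dr.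
have dc0 : gdom (r0 ++ r') by rewrite gdom_cat d0.
apply/andP; split; apply: gint_le => // t /H; rewrite gpoly_cat ler_distl.
  by rewrite lerBlDr => /andP[].
by move=> /andP[].
Qed.

Definition linform a n : R := q_seq a n * GI (a + 1) - p_seq a n.

Definition lin_terms a n : seq (R * R) :=
  [seq (cbin (- a) n k, n%:R + a + k%:R) | k <- iota 0 n.+1] ++
  [seq (- cbin a n k, n%:R + k%:R) | k <- iota 0 n.+1].

Lemma gint_lin_terms a n : -1 < a -> gint (lin_terms a n) = linform a n.
Proof.
move=> a1; rewrite gint_cat /gint !big_map /linform; congr (_ + _).
  rewrite -cbin_sum_q /cbin_sum mulr_suml -(big_mkord xpredT (fun k =>
    cbin (- a) n k * poch (a + 1) (n + k) * GI (a + 1))) /index_iota subn0.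
  apply: eq_bigr => k _ /=; rewrite -mulrA -poch_GI; last by lra.
  by congr (_ * GI _); rewrite natrD; ring.
rewrite -cbin_sum_p /cbin_sum -sumrN -(big_mkord xpredT (fun k =>
    - (cbin a n k * (n + k)`!%:R))) /index_iota subn0.
apply: eq_bigr => k _ /=; rewrite mulNr -natrD natr1 GI_nat //.
Qed.

Lemma gpoly_lin_terms a n t : 0 < t ->
  gpoly (lin_terms a n) t = t ^+ n * (t `^ a * (padeB a n).[t] - (padeB (- a) n).[t]).
Proof.
move=> t0; rewrite gpoly_cat /gpoly !big_map mulrBr; congr (_ + _).
  rewrite /padeB horner_poly !mulr_sumr -(big_mkord xpredT (fun k =>
    t ^+ n * (t `^ a * (cbin (- a) n k * t ^+ k)))) /index_iota subn0.
  apply: eq_bigr => k _ /=.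
  rewrite !powRD ?(gt_eqF t0) ?implybT // !powR_mulrn ?(ltW t0) //.
  by ring.
rewrite /padeB horner_poly mulr_sumr -sumrN -(big_mkord xpredT (fun k =>
    - (t ^+ n * (cbin (- - a) n k * t ^+ k)))) /index_iota subn0.
apply: eq_bigr => k _ /=; rewrite opprK.
rewrite !powRD ?(gt_eqF t0) ?implybT // !powR_mulrn ?(ltW t0) //.
by ring.
Qed.

Definition cbin_abs a n : R := \sum_(k < n.+1) (`|cbin (- a) n k| + `|cbin a n k|).

(** For [t <= 1] no cancellation is sought: powers are at most 1 and the coefficients are added in
    absolute value. *)
Lemma gpoly_lin_small a n t : 0 < t -> t <= 1 ->
  `|gpoly (lin_terms a n) t| <= cbin_abs a n * (t `^ n%:R + t `^ (n%:R + a)).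
Proof.
move=> t0 t1; rewrite gpoly_lin_terms //.
rewrite powRD ?(gt_eqF t0) ?implybT // powR_mulrn ?(ltW t0) //.
have -> : t ^+ n + t ^+ n * t `^ a = t ^+ n * (1 + t `^ a) by ring.
rewrite normrM (ger0_norm (exprn_ge0 _ (ltW t0))) mulrCA.
rewrite ler_wpM2l ?exprn_ge0 ?(ltW t0) //.
have P b : `|(padeB b n).[t]| <= \sum_(k < n.+1) `|cbin (- b) n k|.
  rewrite /padeB horner_poly; apply: le_trans (ler_norm_sum _ _ _) _.
  apply: ler_sum => k _; rewrite normrM ler_piMr //.
  by rewrite ger0_norm ?exprn_ge0 ?exprn_ile1 ?(ltW t0).
apply: le_trans (ler_normB _ _) _; rewrite normrM (ger0_norm (powR_ge0 _ _)).
have hB := P a; have := P (- a); rewrite opprK => hA.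
rewrite /cbin_abs big_split /=.
set SB := \sum_(_ < _) `|cbin (- a) n _| in hB *.
set SA := \sum_(_ < _) `|cbin a n _| in hA *.
have w0 := powR_ge0 t a; have := ler_wpM2l w0 hB.
have SB0 : 0 <= SB by apply: le_trans hB.
have SA0 : 0 <= SA by apply: le_trans hA.
have := mulr_ge0 w0 SA0; lra.
Qed.

End LinearForm.

(** * Main term of the linear form and its integrated error *)

Section LinearFormBound.
Variable R : realType.
Notation GI := (@eulerGamma_integral R).
Implicit Types (a b x y t : R) (n p : nat).

(* The exponent of [x] in the main part of [x ^ n * (Pade error)]. *)
Definition beta0 a n : R := 2 * n%:R + a / 2 + 4^-1.

Lemma powR_sqr y b : 0 <= y -> (y ^+ 2) `^ b = y `^ (2 * b).
Proof. by move=> y0; rewrite -powR_mulrn // -powRrM. Qed.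

(** With [l = ln (y / s)] one has [t / (2 n) = expR (2 l)], so an exponent [mu = 2 m] gives an
    integral power of [t], and [expR (2 r |l|)] is at most the sum of the [r]-th power of
    [t / (2 n)] and its inverse. *)
Lemma lin_pointwise_gt1 a n p m r t : (0 < n)%N -> (0 < p)%N ->
  `|a ^+ 2 - 4^-1| <= 2 * p%:R -> 1 < t ->
  let s := Num.sqrt (2 * n%:R) in
  s - 2 <= 2 * m%:R <= s -> s + p%:R + 2 <= r%:R ->
  `|gpoly (lin_terms a n) t -
     Kc a n * expR (- s) * expR (- 2^-1) / (2 * n%:R) ^+ m * (t `^ beta0 a n * t ^+ m)|
  <= `|Kc a n| * expR (- s) * ((24 + p%:R * 2 * 3 ^+ p) / s) *
     (t `^ beta0 a n * ((t / (2 * n%:R)) ^+ r + (2 * n%:R / t) ^+ r)).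
Proof.
move=> n0 p0 ap t1 s ms rs.
have t0 : 0 < t by lra.
have nR : 1 <= n%:R :> R by rewrite ler1n.
have N0 : 0 < 2 * n%:R :> R by lra.
have s0 : 0 < s by rewrite sqrtr_gt0.
have sN : s ^+ 2 = 2 * n%:R by rewrite sqr_sqrtr // ltW.
have s1 : 1 <= s by rewrite -(@ler_pXn2r _ 2) ?nnegrE ?(ltW s0) // expr1n sN; lra.
set y := Num.sqrt t; have y0 : 0 < y by rewrite sqrtr_gt0.
have yt : y ^+ 2 = t by rewrite sqr_sqrtr // ltW.
have y1 : 1 < y by rewrite -(@ltr_pXn2r _ 2) ?nnegrE ?(ltW y0) // expr1n yt.
set l := ln (y / s).
have el : expR l = y / s by rewrite lnK // posrE divr_gt0.
have sy : s * expR l = y by rewrite el mulrCA divff ?gt_eqF // mulr1.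
have y1' : 1 < s * expR l by rewrite sy.
have mu0 : 0 <= 2 * m%:R :> R by rewrite mulr_ge0.
have u01 : 0 <= (y - 1) / n%:R <= 2 * expR l / s.
  rewrite divr_ge0 ?ler0n //=; last lra.
  rewrite el (_ : 2 * (y / s) / s = y / n%:R); last first.
    have -> : 2 * (y / s) / s = 2 * y / s ^+ 2 by field; rewrite gt_eqF.
    by rewrite sN; field; rewrite gt_eqF //; lra.
  by rewrite ler_pM2r ?invr_gt0 //; lra.
have key := psi_key_h s1 y1' ms mu0 u01 (Hd_bound n0 p0 ap y1).
set h := Hd a n y / Ef n y in key.
set A := t `^ beta0 a n; have A0 : 0 <= A by exact: powR_ge0.
have Epsi : expR (psi s l) * expR (- s) = (1 - y^-1) ^+ (2 * n).+1.
  rewrite -expRD /psi addrK expRN -invfM (mulrC (expR l)) sy sN -natrM natr1 expRM_natl lnK //.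
  by rewrite posrE subr_gt0 invf_lt1.
(* The powers of [y] are [2 n] from [t ^ n], [a - 1/2] from the Pade error and [2 n + 1] from
   [(y - 1) ^ (2 n + 1)]; together they make [2 * beta0 a n]. *)
have c1 : gpoly (lin_terms a n) t = A * expR (- s) * (expR (psi s l) * h).
  rewrite [RHS](_ : _ = A * (expR (psi s l) * expR (- s)) * h); last by ring.
  rewrite Epsi gpoly_lin_terms // -yt powR_sqr ?(ltW y0) // pade_Hd // -exprM.
  have -> : A = y `^ (a - 2^-1) * (y ^+ (2 * n) * y ^+ (2 * n).+1).
    rewrite /A -yt powR_sqr ?(ltW y0) // -exprD -powR_mulrn ?(ltW y0) //.
    rewrite -powRD ?(gt_eqF y0) ?implybT //; congr (_ `^ _).
    by rewrite /beta0 addnS -(natr1 (2 * n + 2 * n)) natrD natrM; field.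
  have -> : Hd a n y = Ef n y * h.
    by rewrite /h mulrCA divff ?mulr1 // gt_eqF // Ef_gt0.
  rewrite /Ef.
  have -> : 1 - y^-1 = (y - 1) / y by rewrite mulrBl divff ?gt_eqF // mul1r.
  rewrite !expr_div_n.
  have : (y + 1) ^+ (2 * n).+1 != 0 by rewrite expf_neq0 // gt_eqF //; lra.
  have : y ^+ (2 * n).+1 != 0 by rewrite expf_neq0 // gt_eqF.
  move: (y ^+ (2 * n).+1) ((y + 1) ^+ _) ((y - 1) ^+ _) => P Q S P0 Q0.
  by field; rewrite P0 Q0.
have Epow k : expR (2 * k%:R * l) = (t / (2 * n%:R)) ^+ k.
  by rewrite -mulrA mulrCA expRM_natl expRM_natl el expr_div_n yt sN.
have EpowN k : expR (- (2 * k%:R * l)) = (2 * n%:R / t) ^+ k.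
  by rewrite expRN Epow -exprVn invf_div.
have c2 : Kc a n * expR (- s) * expR (- 2^-1) / (2 * n%:R) ^+ m * (A * t ^+ m) =
   A * expR (- s) * (Kc a n * expR (- 2^-1 + 2 * m%:R * l)).
  rewrite expRD Epow expr_div_n; ring.
rewrite c1 c2 -mulrBr normrM ger0_norm ?mulr_ge0 ?expR_ge0 //.
rewrite [leRHS](_ : _ = A * expR (- s) * (`|Kc a n| * ((24 + p%:R * 2 * 3 ^+ p) / s *
   ((t / (2 * n%:R)) ^+ r + (2 * n%:R / t) ^+ r)))); last by ring.
apply: ler_wpM2l; first by rewrite mulr_ge0 ?expR_ge0.
apply: le_trans key _; apply: ler_wpM2l => //.
apply: ler_wpM2l.
  by rewrite divr_ge0 ?(ltW s0) // addr_ge0 // !mulr_ge0 // exprn_ge0.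
rewrite -Epow -EpowN.
apply: (@le_trans _ _ (expR (2 * r%:R * `|l|))).
  by rewrite ler_expR ler_wpM2r //; have := ler0n R p; lra.
have [l0|l0] := leP 0 l.
  by rewrite (ger0_norm l0) lerDl expR_ge0.
by rewrite (ltr0_norm l0) mulrN lerDr expR_ge0.
Qed.

Lemma gint_cons c e r : gint ((c, e) :: r) = c * GI (e + 1) + gint r :> R.
Proof. exact: big_cons. Qed.

Lemma gint_nil : gint [::] = 0 :> R.
Proof. exact: big_nil. Qed.

Lemma gpoly_cons c e r t : gpoly ((c, e) :: r) t = c * t `^ e + gpoly r t :> R.
Proof. exact: big_cons. Qed.

Lemma gpoly_nil t : gpoly [::] t = 0 :> R.
Proof. exact: big_nil. Qed.

Lemma powRDn t b m : 0 < t -> t `^ (b + m%:R) = t `^ b * t ^+ m.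
Proof. by move=> t0; rewrite powRD ?(gt_eqF t0) ?implybT // powR_mulrn // ltW. Qed.

Lemma powRBn t b m : 0 < t -> t `^ (b - m%:R) = t `^ b / t ^+ m.
Proof. by move=> t0; rewrite powRB ?(gt_eqF t0) ?implybT // powR_mulrn // ltW. Qed.

Lemma linform_bound a n p m r : -1 < a -> (0 < n)%N -> (0 < p)%N ->
  `|a ^+ 2 - 4^-1| <= 2 * p%:R ->
  let s := Num.sqrt (2 * n%:R) in
  s - 2 <= 2 * m%:R <= s -> s + p%:R + 2 <= r%:R -> r%:R < beta0 a n + 1 ->
  `|linform a n - Kc a n * expR (- s) * expR (- 2^-1) / (2 * n%:R) ^+ m *
      GI (beta0 a n + m%:R + 1)| <=
  `|Kc a n| * expR (- s) * ((25 + p%:R * 2 * 3 ^+ p) / s) *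
    (GI (beta0 a n + r%:R + 1) / (2 * n%:R) ^+ r
      + (2 * n%:R) ^+ r * GI (beta0 a n - r%:R + 1))
  + cbin_abs a n * (GI (n%:R + 1) + GI (n%:R + a + 1)).
Proof.
move=> a1 n0 p0 ap s ms rs rb.
have nR : 1 <= n%:R :> R by rewrite ler1n.
have N0 : 0 < 2 * n%:R :> R by lra.
have N1 : 1 <= 2 * n%:R :> R by lra.
have s0 : 0 < s by rewrite sqrtr_gt0.
have sN : s ^+ 2 = 2 * n%:R by rewrite sqr_sqrtr // ltW.
have s1 : 1 <= s by rewrite -(@ler_pXn2r _ 2) ?nnegrE ?(ltW s0) // expr1n sN; lra.
have pR := ler0n R p; have mR := ler0n R m; have rR := ler0n R r.
have d1 k : -1 < n%:R + a + k%:R by have := ler0n R k; lra.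
have d2 k : -1 < n%:R + k%:R :> R by have := ler0n R k; lra.
have d3 : -1 < n%:R :> R by lra.
have d4 : -1 < n%:R + a by lra.
have d5 : -1 < beta0 a n + m%:R by rewrite /beta0; lra.
have d6 : -1 < beta0 a n + r%:R by rewrite /beta0; lra.
have d7 : -1 < beta0 a n - r%:R by lra.
set b := beta0 a n in rb d5 d6 d7 *.
have C1 : 1 <= 25 + p%:R * 2 * 3 ^+ p :> R.
  have : 0 <= p%:R * 2 * 3 ^+ p :> R by rewrite !mulr_ge0 // exprn_ge0.
  lra.
have C2 : 24 + p%:R * 2 * 3 ^+ p <= 25 + p%:R * 2 * 3 ^+ p :> R by rewrite lerD2r ler_nat.
have r1 : (0 < r)%N by rewrite -(ltr0n R); lra.
set C := 25 + p%:R * 2 * 3 ^+ p in C1 C2 *.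
have C0 : 0 <= C by exact: le_trans C1.
set c0 := `|Kc a n| * expR (- s).
set M := Kc a n * expR (- s) * expR (- 2^-1) / (2 * n%:R) ^+ m.
set c := c0 * (C / s).
have c00 : 0 <= c0 by rewrite mulr_ge0 ?expR_ge0.
have c_ge0 : 0 <= c.
  by rewrite mulr_ge0 // divr_ge0 // ltW.
pose r0 := [:: (M, b + m%:R)].
pose r' := [:: (c / (2 * n%:R) ^+ r, b + r%:R); (c * (2 * n%:R) ^+ r, b - r%:R);
  (cbin_abs a n, n%:R); (cbin_abs a n, n%:R + a)].
have E0 : gint r0 = M * GI (b + m%:R + 1) by rewrite gint_cons gint_nil addr0.
have E' : gint r' = c * (GI (b + r%:R + 1) / (2 * n%:R) ^+ r
    + (2 * n%:R) ^+ r * GI (b - r%:R + 1))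
    + cbin_abs a n * (GI (n%:R + 1) + GI (n%:R + a + 1)).
  rewrite !gint_cons gint_nil; move: (GI _) (GI _) (GI _) (GI _) => g1 g2 g3 g4.
  by ring.
rewrite -gint_lin_terms // -E0 -E'; apply: gint_dist.
- rewrite gdom_cat; apply/andP; split; apply/allP => ce /mapP[k _ ->].
    exact: d1.
  exact: d2.
- by rewrite /gdom /= d5.
- by rewrite /gdom /= d6 d7 d3 d4.
move=> t t0.
have P0 : gpoly r0 t = M * (t `^ b * t ^+ m).
  by rewrite gpoly_cons gpoly_nil addr0 powRDn.
have P' : gpoly r' t = c * (t `^ b * ((t / (2 * n%:R)) ^+ r + (2 * n%:R / t) ^+ r))
    + cbin_abs a n * (t `^ n%:R + t `^ (n%:R + a)).
  rewrite !gpoly_cons gpoly_nil powRDn // powRBn // !expr_div_n.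
  have : t ^+ r != 0 by rewrite expf_neq0 // gt_eqF.
  have : (2 * n%:R) ^+ r != 0 :> R by rewrite expf_neq0 // gt_eqF.
  clearbody c; clear.
  move: (t ^+ r) ((2 * n%:R) ^+ r) (t `^ b) (t `^ _) (t `^ _) => x y u v w y0 x0.
  by field; rewrite x0 y0.
rewrite P0 P'.
have cb0 : 0 <= cbin_abs a n by rewrite sumr_ge0 // => k _; rewrite addr_ge0.
have tb0 := powR_ge0 t b.
have X0 : 0 <= (t / (2 * n%:R)) ^+ r by rewrite exprn_ge0 // divr_ge0 // ltW.
have Y0 : 0 <= (2 * n%:R / t) ^+ r by rewrite exprn_ge0 // divr_ge0 // ltW.
(* For [t <= 1] the form falls under the crude bound, and the main term is absorbed by the negative
   power, as [(2 n / t) ^ r >= 2 n >= s] there. *)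
have [t1|t1] := leP t 1; last first.
  apply: le_trans (lin_pointwise_gt1 n0 p0 ap t1 ms rs) _.
  rewrite -[leLHS]addr0; apply: lerD; last by rewrite mulr_ge0 // addr_ge0 ?powR_ge0.
  apply: ler_wpM2r; first by rewrite mulr_ge0 ?powR_ge0 // addr_ge0.
  rewrite -/s /c; apply: ler_wpM2l => //.
  by rewrite ler_pM2r ?invr_gt0.
apply: le_trans (ler_normB _ _) _; rewrite addrC; apply: lerD; last exact: gpoly_lin_small.
rewrite /M -/b.
have -> : Kc a n * expR (- s) * expR (- 2^-1) / (2 * n%:R) ^+ m * (t `^ b * t ^+ m) =
   Kc a n * (expR (- s) * expR (- 2^-1) * t `^ b * (t / (2 * n%:R)) ^+ m).
  by rewrite expr_div_n; ring.
have q0 : 0 <= t / (2 * n%:R) by rewrite divr_ge0 // ltW.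
rewrite normrM (ger0_norm (_ : 0 <= expR (- s) * _ * _ * _)); last first.
  by rewrite !mulr_ge0 ?expR_ge0 // exprn_ge0.
have -> : c * (t `^ b * ((t / (2 * n%:R)) ^+ r + (2 * n%:R / t) ^+ r)) =
   `|Kc a n| * (expR (- s) * t `^ b * (C / s * ((t / (2 * n%:R)) ^+ r + (2 * n%:R / t) ^+ r))).
  by rewrite /c /c0; ring.
apply: ler_wpM2l => //.
rewrite (mulrAC (expR (- s))) -!(mulrA (expR (- s) * _)).
apply: ler_wpM2l; first by rewrite mulr_ge0 ?expR_ge0.
have e1 : expR (- 2^-1) <= 1 :> R by rewrite expR_le1 oppr_le0 invr_ge0.
have qm : (t / (2 * n%:R)) ^+ m <= 1.
  by rewrite exprn_ile1 // ler_pdivrMr // mul1r (le_trans t1).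
apply: (@le_trans _ _ 1).
  by rewrite -[leRHS]mulr1; apply: ler_pM; rewrite ?expR_ge0 ?exprn_ge0.
have Yr : s <= (2 * n%:R / t) ^+ r.
  have h : 2 * n%:R <= 2 * n%:R / t by rewrite ler_pdivlMr // ler_piMr // ltW.
  have h1 : 1 <= 2 * n%:R / t by exact: le_trans h.
  apply: (@le_trans _ _ (2 * n%:R / t)); first by apply: le_trans h; rewrite -sN expr2 ler_peMr // ltW.
  by rewrite -[leLHS]expr1; apply: ler_weXn2l.
rewrite mulrAC ler_pdivlMr // mul1r.
apply: (@le_trans _ _ ((t / (2 * n%:R)) ^+ r + (2 * n%:R / t) ^+ r)).
  by apply: le_trans Yr _; rewrite lerDr.
by rewrite ler_peMl // addr_ge0.
Qed.

End LinearFormBound.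

(** * Moments of order [s] of a Gamma law with mean near [s ^ 2] *)

Section Moments.
Variable R : realType.
Implicit Types (a b x y t s : R) (n p : nat).

Lemma sum_iota_R m : \sum_(i < m) (i%:R : R) = m%:R * (m%:R - 1) / 2.
Proof.
elim: m => [|m IH]; first by rewrite big_ord0 mul0r mul0r.
by rewrite big_ord_recr /= IH -natr1; field.
Qed.

Lemma poch_scale (N d : R) m : N != 0 ->
  poch (N + d) m / N ^+ m = \prod_(i < m) (1 + (d + i%:R) / N).
Proof.
move=> N0; elim: m => [|m IH]; first by rewrite /poch !big_ord0 expr0 divr1.
rewrite big_ord_recr /= -IH pochS exprS.
have : N ^+ m != 0 by rewrite expf_neq0.
by move: (N ^+ m) => P P0; field; rewrite N0 P0.
Qed.

Lemma prod_le_exp (x : nat -> R) c m : (forall i, (i < m)%N -> 0 <= 1 + x i) ->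
  (forall i, (i < m)%N -> x i <= c) -> \prod_(i < m) (1 + x i) <= expR (m%:R * c).
Proof.
elim: m => [|m IH] H0 H1; first by rewrite big_ord0 mul0r expR0.
rewrite big_ord_recr /= -natr1 mulrDl mul1r expRD.
apply: ler_pM; [|exact: H0|apply: IH => i im|].
- by apply: prodr_ge0 => i _; apply: H0; rewrite (ltn_trans (ltn_ord i)).
- by apply: H0; exact: leqW.
- by apply: H1; exact: leqW.
- by apply: le_trans (expR_ge1Dx _) _; rewrite ler_expR H1.
Qed.

Lemma prod_inv_le_exp (x : nat -> R) c m :
  (forall i, (i < m)%N -> `|x i| <= c) -> c <= 2^-1 ->
  (\prod_(i < m) (1 + x i))^-1 <= expR (m%:R * (2 * c)).
Proof.
elim: m => [|m IH] H0 ch; first by rewrite big_ord0 invr1 mul0r expR0.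
have P0 : 0 <= \prod_(i < m) (1 + x i).
  apply: prodr_ge0 => i _; have := H0 i (ltn_trans (ltn_ord i) (ltnSn m)).
  by rewrite ler_norml => /andP[]; lra.
have := H0 m (ltnSn m); rewrite ler_norml => /andP[h1 h2].
rewrite big_ord_recr /= -natr1 mulrDl mul1r expRD invfM.
apply: ler_pM; rewrite ?invr_ge0 //; first lra.
  by apply: IH => // i im; apply: H0; exact: leqW.
have p0 : 0 < 1 + x m by lra.
apply: (@le_trans _ _ (1 + 2 * c)); last exact: expR_ge1Dx.
rewrite -div1r ler_pdivrMr //; nra.
Qed.

(** As [m] is within 1 of [s / 2], the sum of [i / s ^ 2] over [i < m] is [m ^ 2 / (2 s ^ 2) = 1/8]
    up to [O(1 / s)]; the shift [d] and the squares contribute [O(1 / s)]. *)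
Lemma moment_near s d m : 0 <= d -> 2 * (d + 1) <= s -> s - 2 < 2 * m%:R <= s ->
  exists2 e, `|e| <= (d + 3 + (d + 1) ^+ 2) / s &
    poch (s ^+ 2 + d) m / (s ^+ 2) ^+ m = expR (8^-1 + e).
Proof.
move=> d0 ds /andP[m1 m2]; have s0 : 0 < s by lra.
have s20 : s ^+ 2 != 0 by rewrite expf_neq0 // gt_eqF.
have xb i : (i < m)%N -> `|(d + i%:R) / s ^+ 2| <= (d + 1) / s.
  move=> im; have iR : i%:R <= s.
    apply: (@le_trans _ _ (2 * m%:R)) => //.
    by have : i%:R <= m%:R :> R; [rewrite ler_nat ltnW|have := ler0n R m; lra].
  rewrite ger0_norm ?divr_ge0 ?addr_ge0 ?sqr_ge0 // ler_pdivrMr ?exprn_gt0 //.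
  rewrite (_ : (d + 1) / s * s ^+ 2 = (d + 1) * s); last by field; rewrite gt_eqF.
  by nra.
have [i im|D Db DE] := @prod_expR R (fun i => (d + i%:R) / s ^+ 2) m.
  by apply: le_trans (xb i im) _; rewrite ler_pdivrMr //; lra.
rewrite poch_scale // DE.
exists (\sum_(i < m) (d + i%:R) / s ^+ 2 + D - 8^-1); last by congr expR; ring.
have -> : \sum_(i < m) (d + i%:R) / s ^+ 2 = (d * m%:R + m%:R * (m%:R - 1) / 2) / s ^+ 2.
  by rewrite -mulr_suml big_split /= sum_iota_R sumr_const card_ord mulr_natr.
have Db' : `|D| <= (d + 1) ^+ 2 / s.
  apply: le_trans Db _.
  have h : \sum_(i < m) ((d + i%:R) / s ^+ 2) ^+ 2 <= \sum_(i < m) ((d + 1) / s) ^+ 2.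
    apply: ler_sum => i _; rewrite -[X in X <= _]ger0_norm ?sqr_ge0 // normrX.
    by rewrite lerXn2r // ?nnegrE // ?xb // divr_ge0 ?addr_ge0 // ltW.
  apply: (@le_trans _ _ (2 * (m%:R * ((d + 1) / s) ^+ 2))).
    by rewrite ler_wpM2l // (le_trans h) // sumr_const card_ord mulr_natl.
  rewrite mulrA; apply: (@le_trans _ _ (s * ((d + 1) / s) ^+ 2)).
    by rewrite ler_wpM2r ?sqr_ge0.
  by rewrite le_eqVlt; apply/orP/or_introl/eqP; field; rewrite gt_eqF.
have Sb : `|(d * m%:R + m%:R * (m%:R - 1) / 2) / s ^+ 2 - 8^-1| <= (d + 3) / s.
  pose th := s / 2 - m%:R.
  have th0 : 0 <= th by rewrite /th; lra.
  have th1 : th <= 1 by rewrite /th; lra.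
  have mE : m%:R = s / 2 - th by rewrite /th; ring.
  rewrite mE.
  have -> : (d * (s / 2 - th) + (s / 2 - th) * (s / 2 - th - 1) / 2) / s ^+ 2 - 8^-1
    = (d * (s / 2 - th) - s * (2 * th + 1) / 4 + th * (th + 1) / 2) / s ^+ 2.
    by field; rewrite gt_eqF.
  rewrite normrM normfV (ger0_norm (sqr_ge0 s)) ler_pdivrMr ?exprn_gt0 //.
  rewrite (_ : (d + 3) / s * s ^+ 2 = (d + 3) * s); last by field; rewrite gt_eqF.
  have q1 : 0 <= th * (th + 1) <= 2 by apply/andP; split; nra.
  have q2 : 0 <= d * (s / 2 - th) <= d * s by apply/andP; split; nra.
  have q3 : 0 <= s * (2 * th + 1) <= 3 * s by apply/andP; split; nra.
  move: q1 q2 q3 => /andP[q1 q1'] /andP[q2 q2'] /andP[q3 q3'].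
  by rewrite ler_norml; apply/andP; split; lra.
rewrite (_ : _ + D - 8^-1 = (d * m%:R + m%:R * (m%:R - 1) / 2) / s ^+ 2 - 8^-1 + D); last by ring.
by apply: le_trans (ler_normD _ _) _; rewrite (mulrDl (d + 3)); exact: lerD.
Qed.

(** There are [O(s)] factors, each [1 + O(1 / s)]. *)
Lemma moment_up s d q m : 0 <= d -> 0 <= q -> 1 <= s -> m%:R <= q * s ->
  poch (s ^+ 2 + d) m / (s ^+ 2) ^+ m <= expR (q * (d + q)).
Proof.
move=> d0 q0 s1 ms; have s0 : 0 < s by lra.
have s20 : 0 < s ^+ 2 by rewrite exprn_gt0.
rewrite poch_scale ?gt_eqF //.
have c0 : 0 <= (d + q) / s by rewrite divr_ge0 ?addr_ge0 // ltW.
apply: le_trans (@prod_le_exp (fun i => (d + i%:R) / s ^+ 2) ((d + q) / s) m _ _) _.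
- by move=> i _; rewrite addr_ge0 // divr_ge0 ?addr_ge0 // ltW.
- move=> i im; rewrite ler_pdivrMr //.
  rewrite (_ : (d + q) / s * s ^+ 2 = (d + q) * s); last by field; rewrite gt_eqF.
  have : i%:R <= m%:R :> R by rewrite ler_nat ltnW.
  by nra.
rewrite ler_expR; apply: (@le_trans _ _ (q * s * ((d + q) / s))); first by rewrite ler_wpM2r.
by rewrite le_eqVlt; apply/orP/or_introl/eqP; field; rewrite gt_eqF.
Qed.

(** The same count for a negative moment; [2 (d + q) <= s] keeps the factors away from 0. *)
Lemma moment_down s d q m : 0 <= d -> 0 <= q -> 1 <= s -> m%:R <= q * s ->
  2 * (d + q) <= s ->
  (s ^+ 2) ^+ m / poch (s ^+ 2 + (d - m%:R)) m <= expR (2 * q * (d + q)).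
Proof.
move=> d0 q0 s1 ms ds; have s0 : 0 < s by lra.
have s20 : 0 < s ^+ 2 by rewrite exprn_gt0.
rewrite -invf_div poch_scale ?gt_eqF //.
have c0 : 0 <= (d + q) / s by rewrite divr_ge0 ?addr_ge0 // ltW.
apply: le_trans (@prod_inv_le_exp (fun i => (d - m%:R + i%:R) / s ^+ 2) ((d + q) / s) m _ _) _.
- move=> i im; rewrite normrM normfV (gtr0_norm s20) ler_pdivrMr //.
  rewrite (_ : (d + q) / s * s ^+ 2 = (d + q) * s); last by field; rewrite gt_eqF.
  have : i%:R <= m%:R :> R by rewrite ler_nat ltnW.
  have := ler0n R i; rewrite ler_norml => h1 h2; apply/andP; split; nra.
- by rewrite ler_pdivrMr //; lra.
rewrite ler_expR; apply: (@le_trans _ _ (q * s * (2 * ((d + q) / s)))).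
  by rewrite ler_wpM2r // mulr_ge0.
by rewrite le_eqVlt; apply/orP/or_introl/eqP; field; rewrite gt_eqF.
Qed.

End Moments.

(** * The contribution of [x <= 1] is negligible *)

Section ExpBound.
Variable R : realType.
Notation GI := (@eulerGamma_integral R).
Implicit Types (a b x y t s : R) (n p : nat) (u v : nat -> R).

(* Geometric growth, which is beaten by a factorial: this is all that is needed
   to discard the part [x <= 1] of the integral. *)
Definition expb u := exists C c N, [/\ 0 <= C, 0 <= c &
  forall n, (N <= n)%N -> `|u n| <= C * c ^+ n].

Lemma expbM u v : expb u -> expb v -> expb (fun n => u n * v n).
Proof.
move=> [C [c [N [C0 c0 H]]]] [D [d [M [D0 d0 H']]]].
exists (C * D), (c * d), (maxn N M); split; rewrite ?mulr_ge0 // => n.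
rewrite geq_max => /andP[/H h /H' h']; rewrite normrM exprMn mulrACA.
by apply: ler_pM.
Qed.

Lemma expb_le u v N : (forall n, (N <= n)%N -> `|u n| <= `|v n|) -> expb v -> expb u.
Proof.
move=> E [C [c [M [C0 c0 H]]]]; exists C, c, (maxn N M); split => // n.
by rewrite geq_max => /andP[/E h /H h']; exact: le_trans h'.
Qed.

Lemma expb_cst x : expb (fun=> x).
Proof. by exists `|x|, 1, 0%N; split => // n _; rewrite expr1n mulr1. Qed.

Lemma expb_exp x : expb (fun n => expR (x * n%:R)).
Proof.
exists 1, (expR x), 0%N; split; rewrite ?expR_ge0 // => n _.
by rewrite mul1r expRM_natr ger0_norm // exprn_ge0 // expR_ge0.
Qed.

Lemma expb_bounded u C N : (forall n, (N <= n)%N -> `|u n| <= C) -> expb u.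
Proof.
move=> H; apply: (expb_le (N := N) _ (expb_cst C)) => n /H h.
by apply: le_trans h _; exact: ler_norm.
Qed.

Lemma expb_near1 u : near1 (@rinv R) u -> expb u.
Proof.
move=> H; have [N h] := near1_ev (rate_rinv R) H ltr01.
by apply: (expb_bounded (C := 2) (N := N)) => n /h /andP[h1 h2]; rewrite ler_norml; lra.
Qed.

Lemma expb_near1V u : near1 (@rinv R) u -> expb (fun n => (u n)^-1).
Proof. by move=> H; apply: expb_near1; exact: near1V (rate_rinv R) H. Qed.

Lemma expb_pow b : expb (fun n => n%:R `^ b).
Proof.
apply: (expb_le (N := 1%N) (v := fun n => (`|b| + 1) `^ (`|b| + 1) * expR (1 * n%:R))).
  move=> n n1; have nR : 1 <= n%:R :> R by rewrite ler1n.
  rewrite [leLHS]ger0_norm ?powR_ge0 // [leRHS]ger0_norm ?mulr_ge0 ?powR_ge0 ?expR_ge0 // mul1r.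
  apply: (@le_trans _ _ (n%:R `^ (`|b| + 1))).
    by apply: ler_powR => //; rewrite (le_trans (ler_norm b)) // lerDl.
  by apply: powR_le_expR => //; rewrite ltr_wpDl.
by apply: expbM; [exact: expb_cst|exact: expb_exp].
Qed.

Lemma expb_lin x y : expb (fun n => x * n%:R + y).
Proof.
apply: (expb_le (N := 0%N) (v := fun n => (`|x| + `|y|) * expR (1 * n%:R))).
  move=> n _; rewrite [leRHS]ger0_norm ?mulr_ge0 ?addr_ge0 ?expR_ge0 // mul1r.
  apply: le_trans (ler_normD _ _) _; rewrite normrM mulrDl (ger0_norm (ler0n _ _)).
  have h := expR_ge1Dx (n%:R : R); have n0 := ler0n R n.
  apply: lerD; first by apply: ler_wpM2l => //; lra.
  by apply: ler_peMr => //; lra.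
by apply: expbM; [exact: expb_cst|exact: expb_exp].
Qed.

Lemma expb_fact u : expb u -> exists C N, forall n, (N <= n)%N -> `|u n| / n`!%:R <= C.
Proof.
move=> [C [c [N [C0 c0 H]]]]; exists (C * expR c), (maxn N 1) => n.
rewrite geq_max => /andP[/H h n1]; rewrite ler_pdivrMr ?factR_gt0 //.
apply: le_trans h _; rewrite -mulrA ler_wpM2l // -ler_pdivrMr ?factR_gt0 //.
case: n n1 => // n _; have := expR_ge1Dxn n c0; lra.
Qed.

(** [k <= n] keeps every factor at most [n + |x|], and [z ^ k / k!] is one term of the series of
    [expR z]. *)
Lemma gbinom_shift_le x n k : (k <= n)%N -> `|gbinom (n%:R + x) k| <= expR (n%:R + `|x|).
Proof.
move=> kn; rewrite /gbinom normrM normfV (ger0_norm (ler0n _ _)) normr_prod.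
have A0 : 0 <= n%:R + `|x| by rewrite addr_ge0.
apply: (@le_trans _ _ ((n%:R + `|x|) ^+ k / k`!%:R)).
  rewrite ler_pM2r ?invr_gt0 ?factR_gt0 //.
  apply: (@le_trans _ _ (\prod_(i < k) (n%:R + `|x|))); last first.
    by rewrite prodr_const card_ord.
  apply: ler_prod => i _; rewrite normr_ge0 /= addrAC.
  apply: le_trans (ler_normD _ _) _; rewrite lerD2r -natrB; last first.
    by apply: ltnW; apply: leq_trans kn; exact: ltn_ord.
  by rewrite ger0_norm // ler_nat leq_subr.
case: k {kn} => [|k].
  by rewrite expr0 fact0 divr1; have := expR_ge1Dx (n%:R + `|x|); lra.
by have := expR_ge1Dxn k A0; lra.
Qed.

Lemma expb_cbin_abs a : expb (cbin_abs a).
Proof.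
apply: (expb_le (N := 0%N) (v := fun n => (2 * n%:R + 2) * (expR (2 * `|a|) * expR (2 * n%:R)))).
  move=> n _; rewrite [leRHS]ger0_norm ?mulr_ge0 ?addr_ge0 ?mulr_ge0 ?expR_ge0 //.
  rewrite ger0_norm; last by rewrite sumr_ge0 // => k _; rewrite addr_ge0.
  have P b (k : 'I_n.+1) : `|b| = `|a| ->
      `|cbin b n k| <= expR (2 * `|a|) * expR (2 * n%:R).
    move=> ba; rewrite /cbin -ltnS ltn_ord normrM -expRD.
    rewrite (_ : 2 * `|a| + 2 * n%:R = (n%:R + `|b|) + (n%:R + `|- b|)).
      rewrite expRD; apply: ler_pM => //; apply: gbinom_shift_le.
        by rewrite -ltnS.
      exact: leq_subr.
    by rewrite normrN ba; ring.
  apply: (@le_trans _ _ (\sum_(k < n.+1) 2 * (expR (2 * `|a|) * expR (2 * n%:R)))).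
    apply: ler_sum => k _; rewrite mulr2n mulrDl mul1r.
    by apply: lerD; apply: P => //; rewrite normrN.
  rewrite sumr_const card_ord -mulr_natl -natr1 le_eqVlt; apply/orP/or_introl/eqP; ring.
apply: expbM; first exact: expb_lin.
by apply: expbM; [exact: expb_cst|exact: expb_exp].
Qed.

Lemma expb_gratio b : expb (fun n => GI (n%:R + b) / n`!%:R).
Proof.
apply: (expb_le (N := 1%N) (v := fun n => gratio b n * n%:R `^ (b - 1))).
  move=> n n1; rewrite /gratio le_eqVlt; apply/orP/or_introl/eqP; congr (`|_|).
  have : n%:R `^ (b - 1) != 0 by rewrite gt_eqF // powR_gt0 // ltr0n.
  by move: (_ `^ _) => w w0; field; rewrite w0 gt_eqF // factR_gt0.
by apply: expbM; [apply: expb_near1; exact: near1_gratio|exact: expb_pow].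
Qed.

Lemma gbinom_pochP x n : (forall k, x + 1 + k%:R != 0) -> (0 < n)%N ->
  gbinom (n%:R + x) n = poch (x + 1) n * Gamma (x + 1) / (n`!%:R * n%:R `^ (x + 1 - 1))
    * n%:R `^ x / Gamma (x + 1).
Proof.
move=> H n0; rewrite gbinom_poch addrK.
have : n%:R `^ x != 0 by rewrite gt_eqF // powR_gt0 // ltr0n.
by move: (n%:R `^ x) => w w0; field; rewrite w0 Gamma_neq0 //= gt_eqF // factR_gt0.
Qed.

Lemma expb_gbinomV x : (forall k, x + 1 + k%:R != 0) ->
  expb (fun n => (gbinom (n%:R + x) n)^-1).
Proof.
move=> H; pose nu n := poch (x + 1) n * Gamma (x + 1) / (n`!%:R * n%:R `^ (x + 1 - 1)).
have nuP : near1 (@rinv R) nu by exact: near1_poch.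
apply: (expb_le (N := 1%N) (v := fun n => (nu n)^-1 * (n%:R `^ (- x) * Gamma (x + 1)))).
  move=> n n0; rewrite gbinom_pochP // -/(nu n) powRN.
  rewrite le_eqVlt; apply/orP/or_introl/eqP; congr (`|_|).
  by move: (nu n) (_ `^ _) (Gamma _) => u v w; rewrite !invfM invrK; ring.
apply: expbM; first exact: expb_near1V.
by apply: expbM; [exact: expb_pow|exact: expb_cst].
Qed.

Lemma Hf1_le a n : Hf a n 1 <= 1.
Proof.
rewrite Hf1 ler_pdivrMr ?exprn_gt0 // mul1r.
have : gbinom (2 * n%:R : R) n * n`!%:R <= 2 ^+ (2 * n).+1 * n`!%:R.
  rewrite gbinom_central exprS exprM (_ : 2 ^+ 2 = 4); last by ring.
  rewrite -mulrA mulrCA ler_wpM2l ?exprn_ge0 //.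
  apply: (@le_trans _ _ n`!%:R); last by rewrite ler_peMl // ler1n.
  elim: n => [|n IH]; first by rewrite /poch big_ord0.
  rewrite pochS factS natrM mulrC; apply: ler_pM => //; first by rewrite prodr_ge0 // => i _; rewrite addr_ge0.
  by rewrite -(natr1 n); lra.
by rewrite ler_pM2r // factR_gt0.
Qed.

Lemma expb_KcV a : a != 0 -> (forall k, a + 1 + k%:R != 0) ->
  (forall k, - a + 1 + k%:R != 0) -> expb (fun n => (Kc a n)^-1).
Proof.
move=> a0 H1 H2.
apply: (expb_le (N := 0%N) (v := fun n => a^-1 * ((gbinom (n%:R - a) n)^-1 *
  ((gbinom (n%:R + a) n)^-1 * (2 * n%:R + 1))))).
  move=> n _; have -> : (Kc a n)^-1 = a^-1 * ((gbinom (n%:R - a) n)^-1 *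
      ((gbinom (n%:R + a) n)^-1 * (2 * n%:R + 1))) * Hf a n 1.
    by rewrite /Kc invf_div !invfM; ring.
  rewrite normrM ler_piMr //.
  by rewrite ger0_norm ?Hf1_le // ltW // Hf1_gt0.
apply: expbM; first exact: expb_cst.
apply: expbM; first exact: expb_gbinomV.
by apply: expbM; [exact: expb_gbinomV|exact: expb_lin].
Qed.

Lemma le_sqrt_self (x : R) : 1 <= x -> Num.sqrt x <= x.
Proof.
move=> x1; have x0 : 0 <= x by lra.
have s0 := sqrtr_ge0 x; have e := sqr_sqrtr x0.
rewrite -ler_sqr ?nnegrE // e expr2 ler_peMr //.
Qed.

Lemma expb_sqrt_exp : expb (fun n => Num.sqrt (2 * n%:R) * expR (Num.sqrt (2 * n%:R))).
Proof.
apply: (expb_le (N := 1%N) (v := fun n => (2 * n%:R + 0) * expR (2 * n%:R))).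
  move=> n n1; have nR : 1 <= n%:R :> R by rewrite ler1n.
  have h : Num.sqrt (2 * n%:R) <= 2 * n%:R :> R by apply: le_sqrt_self; lra.
  rewrite !ger0_norm ?mulr_ge0 ?addr_ge0 ?mulr_ge0 ?expR_ge0 ?sqrtr_ge0 // addr0.
  by apply: ler_pM; rewrite ?sqrtr_ge0 ?expR_ge0 // ler_expR.
by apply: expbM; [exact: expb_lin|exact: expb_exp].
Qed.

(** [n! ^ 2 <= (2 n)!], and Gauss's limit replaces [(2 n)!] by [Gamma(2 n + b)] up to a power of
    [n]. *)
Lemma expb_GI_double b : expb (fun n => n`!%:R ^+ 2 / GI (2 * n%:R + b)).
Proof.
have [N HN] := near1_neq0 (rate_rinv R) (near1_gratio b).
have g2 := near1_double (rate_rinv R) (@rinv_double R) (near1_gratio b).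
apply: (expb_le (N := maxn 1 N) (v := fun n => (gratio b n.*2)^-1 *
    ((2 `^ (1 - b)) * n%:R `^ (1 - b)))).
  move=> n; rewrite geq_max => /andP[n1 nN].
  have nR : 0 < n%:R :> R by rewrite ltr0n.
  have n2 : n.*2%:R = 2 * n%:R :> R by rewrite -mul2n natrM.
  have g0 : 0 < gratio b n.*2 by apply: HN; rewrite (leq_trans nN) // -addnn leq_addr.
  rewrite -powRM // -n2.
  have -> : n.*2%:R `^ (1 - b) = (n.*2%:R `^ (b - 1))^-1 by rewrite -powRN opprB.
  have P0 : 0 < n.*2%:R `^ (b - 1) by rewrite powR_gt0 // n2; lra.
  have GE : GI (n.*2%:R + b) = gratio b n.*2 * (n.*2)`!%:R * n.*2%:R `^ (b - 1).
    by rewrite /gratio; field; rewrite !gt_eqF // factR_gt0.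
  rewrite GE.
  have f2 : n`!%:R ^+ 2 <= (n.*2)`!%:R :> R.
    rewrite -natrX ler_nat -addnn; have := bin_fact (leq_addr n n).
    by rewrite addnK => <-; rewrite -mulnn leq_pmull // bin_gt0 leq_addr.
  have D0 : 0 < gratio b n.*2 * (n.*2)`!%:R * n.*2%:R `^ (b - 1).
    by rewrite mulr_gt0 // mulr_gt0 // factR_gt0.
  rewrite [leLHS]ger0_norm; last by rewrite divr_ge0 ?sqr_ge0 // ltW.
  rewrite [leRHS]ger0_norm; last by rewrite mulr_ge0 // invr_ge0 ltW.
  rewrite ler_pdivrMr; last exact: D0.
  rewrite [leRHS](_ : _ = (n.*2)`!%:R) //.
  by field; rewrite !gt_eqF.
apply: expbM; first exact: expb_near1V.
by apply: expbM; [exact: expb_cst|exact: expb_pow].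
Qed.

Lemma expbD u v : expb u -> expb v -> expb (fun n => u n + v n).
Proof.
move=> [C [c [N [C0 c0 H]]]] [D [d [M [D0 d0 H']]]].
exists (C + D), (c + d), (maxn N M); split; rewrite ?addr_ge0 // => n.
rewrite geq_max => /andP[/H h /H' h'].
apply: le_trans (ler_normD _ _) _; rewrite mulrDl; apply: lerD.
  by apply: le_trans h _; rewrite ler_wpM2l // lerXn2r // ?nnegrE ?addr_ge0 // lerDl.
by apply: le_trans h' _; rewrite ler_wpM2l // lerXn2r // ?nnegrE ?addr_ge0 // lerDr.
Qed.

Lemma Kc_neq0 a n : a != 0 -> (forall k, a + 1 + k%:R != 0) ->
  (forall k, - a + 1 + k%:R != 0) -> Kc a n != 0.
Proof.
move=> a0 H1 H2; rewrite /Kc !gbinom_poch.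
have h := Hf1_gt0 a n.
have p1 := poch_neq0 n H1; have p2 := poch_neq0 n H2.
have f0 : n`!%:R != 0 :> R by rewrite gt_eqF // factR_gt0.
have n1 : 2 * n%:R + 1 != 0 :> R by rewrite gt_eqF // ltr_wpDl // mulr_ge0.
have h0 : Hf a n 1 != 0 by rewrite gt_eqF.
by rewrite !mulf_eq0 !invr_eq0 mulf_eq0 !negb_or a0 p1 p2 f0 n1 h0.
Qed.

(** The left side is at most geometric times [n!], while [GI (beta0 a n + 1)] is comparable to
    [(2 n)! >= n! ^ 2]; the other factors being geometric, the quotient is geometric growth over
    [n!]. *)
Lemma crude_small a : -1 < a -> a != 0 -> (forall k, a + 1 + k%:R != 0) ->
  (forall k, - a + 1 + k%:R != 0) ->
  exists C N, forall n, (N <= n)%N ->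
    cbin_abs a n * (GI (n%:R + 1) + GI (n%:R + a + 1)) <=
    C / Num.sqrt (2 * n%:R) * (`|Kc a n| * expR (- Num.sqrt (2 * n%:R)) * GI (beta0 a n + 1)).
Proof.
move=> a1 a0 H1 H2.
pose u n := cbin_abs a n * ((GI (n%:R + 1) / n`!%:R + GI (n%:R + (a + 1)) / n`!%:R) *
  ((Kc a n)^-1 * ((n`!%:R ^+ 2 / GI (2 * n%:R + (a / 2 + 4^-1 + 1))) *
    (Num.sqrt (2 * n%:R) * expR (Num.sqrt (2 * n%:R)))))).
have ub : expb u.
  apply: expbM; first exact: expb_cbin_abs.
  apply: expbM; first by apply: expbD; exact: expb_gratio.
  apply: expbM; first exact: expb_KcV.
  by apply: expbM; [exact: expb_GI_double|exact: expb_sqrt_exp].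
have [C [N HC]] := expb_fact ub.
exists C, (maxn 1 N) => n; rewrite geq_max => /andP[n1 /HC].
have nR : 1 <= n%:R :> R by rewrite ler1n.
rewrite /u; set s := Num.sqrt _.
have s0 : 0 < s by rewrite sqrtr_gt0; lra.
have K0 := Kc_neq0 n a0 H1 H2.
have b0 : 0 < beta0 a n + 1 by rewrite /beta0; lra.
have -> : 2 * n%:R + (a / 2 + 4^-1 + 1) = beta0 a n + 1 by rewrite /beta0; ring.
have g0 := GI_gt0 b0.
rewrite (addrA n%:R a); set X := cbin_abs a n * (GI (n%:R + 1) + GI (n%:R + a + 1)).
have f0 := factR_gt0 R n.
have -> : cbin_abs a n * ((GI (n%:R + 1) / n`!%:R + GI (n%:R + a + 1) / n`!%:R) *
  ((Kc a n)^-1 * (n`!%:R ^+ 2 / GI (beta0 a n + 1) * (s * expR s)))) =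
  X * (n`!%:R * s * expR s / GI (beta0 a n + 1)) / Kc a n.
  rewrite /X; move: (GI (n%:R + 1)) (GI (n%:R + a + 1)) => g1 g2.
  by field; rewrite K0 !gt_eqF.
rewrite normrM normfV => h.
have K1 : 0 < `|Kc a n| by rewrite normr_gt0.
have Q0 : 0 < n`!%:R * s * expR s / GI (beta0 a n + 1).
  by rewrite divr_gt0 // !mulr_gt0 // expR_gt0.
have h1 : X * (n`!%:R * s * expR s / GI (beta0 a n + 1)) / `|Kc a n| / n`!%:R <= C.
  apply: le_trans h; rewrite ler_pM2r ?invr_gt0 // ler_pM2r ?invr_gt0 //.
  exact: ler_norm.
rewrite expRN [leRHS](_ : _ = C * (`|Kc a n| * GI (beta0 a n + 1) / (s * expR s))); last first.
  by field; rewrite !gt_eqF // expR_gt0.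
rewrite -ler_pdivrMr; last by rewrite divr_gt0 ?mulr_gt0 // expR_gt0.
apply: le_trans h1; rewrite le_eqVlt; apply/orP/or_introl/eqP.
by field; rewrite !gt_eqF // expR_gt0.
Qed.

Lemma ev_sqrt2n x : exists N, forall n, (N <= n)%N -> x <= Num.sqrt (2 * n%:R).
Proof.
have [N HN] := ev_ltn (x ^+ 2); exists N => n /HN h.
apply: (@le_trans _ _ `|x|); first exact: ler_norm.
rewrite -sqrtr_sqr ler_wsqrtr //; have := ler0n R n; lra.
Qed.

Lemma inv_sqrt2n_le n : (0 < n)%N -> (Num.sqrt (2 * n%:R))^-1 <= rsqrt R n.
Proof.
move=> n0; have nR : 0 < n%:R :> R by rewrite ltr0n.
by rewrite /rsqrt lef_pV2 ?posrE ?sqrtr_gt0 ?mulr_gt0 // ler_wsqrtr //; lra.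
Qed.

End ExpBound.

(** * Asymptotics of the linear form *)

Section LinformAsymptotics.
Variable R : realType.
Notation GI := (@eulerGamma_integral R).
Implicit Types (a b x y t s : R) (n p : nat).

Lemma linform_params (p : nat) s : 0 < s -> exists m r,
  [/\ s - 2 < 2 * m%:R <= s, s + p%:R + 2 <= r%:R & 1 <= s -> r%:R <= (p%:R + 4) * s].
Proof.
move=> s0; exists (Num.truncn (s / 2)), (Num.truncn s + p + 3)%N.
have s20 : 0 <= s / 2 by lra.
have /andP[m1 m2] := truncn_itv s20.
have /andP[r1 r2] := truncn_itv (ltW s0).
rewrite -(natr1 (Num.truncn (s / 2))) in m2; rewrite -(natr1 (Num.truncn s)) in r2.
have p0 := ler0n R p.
split; [by apply/andP; split; lra|by rewrite !natrD; lra|].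
by move=> s1; rewrite !natrD; nra.
Qed.

Lemma linform_params2 s d q x : 0 <= d -> 0 <= q -> 2 * (d + q) + 2 <= s -> x <= q * s ->
  [/\ 0 < s ^+ 2 + d, x < s ^+ 2 + d, 2 * (d + 1) <= s, 2 * (d + q) <= s & 1 <= s].
Proof.
move=> d0 q0 sg xq; have h : q * s <= s ^+ 2 / 2 by nra.
by split; nra.
Qed.

Lemma linform_near1 a : -1 < a -> a != 0 -> (forall k, a + 1 + k%:R != 0) ->
  (forall k, - a + 1 + k%:R != 0) ->
  near1 (rsqrt R) (fun n => linform a n /
    (Kc a n * expR (- Num.sqrt (2 * n%:R)) * expR (- (3 / 8)) * GI (beta0 a n + 1))).
Proof.
move=> a1 a0 H1 H2.
pose p := (Num.truncn `|a ^+ 2 - 4^-1|).+1.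
(* [d] is chosen so that [beta0 a n + 1 = s ^ 2 + d], and [q] below so that [r <= q * s]. *)
pose d : R := a / 2 + 5 / 4.
pose q : R := p%:R + 4.
have d0 : 0 <= d by rewrite /d; lra.
have p0 := ler0n R p.
have q0 : 0 <= q by rewrite /q; lra.
pose c : R := d + 3 + (d + 1) ^+ 2.
have c0 : 0 <= c by rewrite /c; nra.
pose c1 : R := 25 + p%:R * 2 * 3 ^+ p.
have c10 : 0 <= c1.
  by rewrite addr_ge0 // mulr_ge0 ?exprn_ge0 // mulr_ge0.
pose E1 := expR (q * (d + q)); pose E2 := expR (2 * q * (d + q)).
have [C2 [N2 H]] := crude_small a1 a0 H1 H2.
have [N HN] := ev_sqrt2n (2 * (d + q) + 2).
have pa : `|a ^+ 2 - 4^-1| <= 2 * p%:R.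
  have : `|a ^+ 2 - 4^-1| < p%:R by apply: truncnS_gt.
  lra.
exists (expR (3 / 8) * (c1 * (E1 + E2) + C2) + c * (expR c + 1)), (maxn 1 (maxn N N2)) => n.
rewrite !geq_max => /and3P[n1 /HN sge nN2].
have nR : 0 < n%:R :> R by rewrite ltr0n.
have i_s := inv_sqrt2n_le R n1.
have sE : Num.sqrt (2 * n%:R) ^+ 2 = 2 * n%:R :> R by rewrite sqr_sqrtr // mulr_ge0.
have s0 : 0 < Num.sqrt (2 * n%:R) :> R by rewrite sqrtr_gt0 mulr_gt0.
have [m [r [/andP[ms1 ms2] rs rq]]] := linform_params p s0.
have rq' : r%:R <= q * Num.sqrt (2 * n%:R).
  by apply: rq; apply: le_trans sge; have := addr_ge0 d0 q0; lra.
have {}rq := rq'; clear rq'.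
have bE : beta0 a n + 1 = Num.sqrt (2 * n%:R) ^+ 2 + d by rewrite sE /beta0 /d; field.
have ds := linform_params2 d0 q0 sge rq.
have [b0 rb ds1 ds2 ss1] := ds; clear ds.
have msb := introT andP (conj (ltW ms1) ms2).
have LB := @linform_bound R a n p m r a1 n1 isT pa msb.
rewrite bE in LB; have {}LB := LB rs rb.
have crude := H n nN2.
move: sge crude LB i_s sE s0 bE ms1 ms2 rs rq b0 rb ds1 ds2 ss1 msb.
set s := Num.sqrt _ => sge crude LB i_s sE s0 bE ms1 ms2 rs rq b0 rb ds1 ds2 s1 msb.
rewrite -sE in LB; rewrite bE in crude.
rewrite (_ : beta0 a n + m%:R + 1 = s ^+ 2 + d + m%:R) in LB; last by rewrite -bE; ring.
rewrite (_ : beta0 a n + r%:R + 1 = s ^+ 2 + d + r%:R) in LB; last by rewrite -bE; ring.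
rewrite (_ : beta0 a n - r%:R + 1 = s ^+ 2 + (d - r%:R)) in LB; last by rewrite addrA -bE; ring.
(* For the negative moment the Gamma value at [s ^ 2 + d] is referred back to [s ^ 2 + d - r], which
   puts [poch] in the denominator. *)
have x0 : 0 < s ^+ 2 + (d - r%:R) by rewrite addrA subr_gt0.
have GE := poch_GI r x0.
rewrite (_ : s ^+ 2 + (d - r%:R) + r%:R = s ^+ 2 + d) in GE; last by ring.
rewrite !(poch_GI _ b0) in LB.
have G0 := GI_gt0 b0.
have P0 : poch (s ^+ 2 + (d - r%:R)) r != 0.
  by apply: contraTneq G0 => e; rewrite GE e mul0r ltxx.
have ms : s - 2 < 2 * m%:R <= s by rewrite ms1.
have [e eb mE] := moment_near d0 ds1 ms.
have up := moment_up d0 q0 s1 rq.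
have dn := moment_down d0 q0 s1 rq.
have {}dn := dn ds2.
have K0 := Kc_neq0 n a0 H1 H2.
have K1 : 0 < `|Kc a n| by rewrite normr_gt0.
have sn0 : (s ^+ 2) ^+ m != 0 by rewrite !expf_neq0 // gt_eqF.
have sr0 : (s ^+ 2) ^+ r != 0 by rewrite !expf_neq0 // gt_eqF.
rewrite -/c1 in LB.
set G := GI _ in LB crude G0 GE *.
set G' := GI _ in LB GE.
pose D := `|Kc a n| * expR (- s) * G.
have D0 : 0 < D by rewrite !mulr_gt0 // expR_gt0.
have LB2 : `|linform a n - Kc a n * expR (- s) * G * expR (- (3 / 8) + e)| <=
    (c1 * (E1 + E2) + C2) / s * D.
  apply: (@le_trans _ _ (c1 / s * D * (E1 + E2) + C2 / s * D)); last first.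
    by rewrite le_eqVlt; apply/orP/or_introl/eqP; field; rewrite gt_eqF.
  rewrite (_ : - (3 / 8) + e = - 2^-1 + (8^-1 + e)); last by field.
  rewrite expRD -mE.
  rewrite (_ : Kc a n * expR (- s) * G * _ = Kc a n * expR (- s) * expR (- 2^-1) / s ^+ 2 ^+ m * (poch (s ^+ 2 + d) m * G)); last first.
    by move: (poch _ m) ((s ^+ 2) ^+ m) sn0 => u v v0; field.
  apply: le_trans LB _; apply: lerD; last by apply: le_trans crude _; rewrite /D.
  rewrite [leLHS](_ : _ = c1 / s * D * (poch (s ^+ 2 + d) r / s ^+ 2 ^+ r + s ^+ 2 ^+ r / poch (s ^+ 2 + (d - r%:R)) r)); last first.
    rewrite /D GE; move: (poch _ r) (poch _ r) ((s ^+ 2) ^+ r) P0 sr0 => u v w v0 w0.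
    by field; rewrite v0 w0 gt_eqF.
  apply: ler_wpM2l; last exact: lerD.
  by rewrite mulr_ge0 ?divr_ge0 // ltW.
have eb' : `|e| <= c.
  by apply: le_trans eb _; rewrite ler_pdivrMr // -/c ler_peMr.
pose L := Kc a n * expR (- s) * expR (- (3 / 8)) * G.
have e3 := expR_gt0 (- (3 / 8) : R).
have LD : `|L| = D * expR (- (3 / 8)).
  rewrite /L 3!normrM (gtr0_norm G0) (gtr0_norm e3) (gtr0_norm (expR_gt0 (- s))) /D.
  by rewrite mulrAC.
have L0 : 0 < `|L| by rewrite LD mulr_gt0.
have L1 : L != 0 by rewrite -normr_gt0.
rewrite bE -/G -/L.
have -> : linform a n / L - 1 =
  (linform a n - Kc a n * expR (- s) * G * expR (- (3 / 8) + e)) / L + (expR e - 1).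
  have -> : Kc a n * expR (- s) * G * expR (- (3 / 8) + e) = expR e * L.
    by rewrite expRD /L; move: (expR _) (expR _) (expR _) => *; ring.
  by rewrite [(_ - _ * L) / L]mulrBl mulfK //; ring.
have B1 : `|(linform a n - Kc a n * expR (- s) * G * expR (- (3 / 8) + e)) / L| <=
    expR (3 / 8) * (c1 * (E1 + E2) + C2) / s.
  rewrite normrM normfV ler_pdivrMr // LD; apply: le_trans LB2 _.
  rewrite le_eqVlt; apply/orP/or_introl/eqP.
  rewrite expRN; field; rewrite !gt_eqF // expR_gt0 //.
have B2 : `|expR e - 1| <= c * (expR c + 1) / s.
  rewrite -expR0; apply: le_trans (expR_sub_le _ _) _; rewrite subr0 expR0 mulrAC.
  apply: ler_pM => //.
  by rewrite lerD2r ler_expR (le_trans (ler_norm _)).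
apply: le_trans (ler_normD _ _) _; apply: le_trans (lerD B1 B2) _.
rewrite -mulrDl; apply: ler_wpM2l => //.
have h2 : 0 <= c * (expR c + 1) by rewrite mulr_ge0 // addr_ge0 // expR_ge0.
rewrite addr_ge0 // mulr_ge0 ?expR_ge0 // .
(* [C2] comes with no sign; the sum is nonnegative because it bounds an absolute value. *)
have : 0 <= (c1 * (E1 + E2) + C2) / s * D by exact: le_trans LB2.
by rewrite pmulr_lge0 // pmulr_lge0 // invr_gt0.
Qed.

End LinformAsymptotics.

(** * The denominators *)

Section ExpSums.
Variable R : realType.
Implicit Types (x w : R) (n N : nat).

Definition exps N x : R := \sum_(k < N) x ^+ k / k`!%:R.

Lemma expsS N x : exps N.+1 x = exps N x + x ^+ N / N`!%:R.
Proof. by rewrite /exps big_ord_recr. Qed.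

Lemma exps_series N x : exps N x = series (exp_coeff x) N.
Proof. by rewrite /exps /series /= big_mkord. Qed.

Lemma exps_le N x : 0 <= x -> exps N x <= expR x.
Proof.
move=> x0; rewrite exps_series; apply: nondecreasing_cvgn_le; last exact: is_cvg_series_exp_coeff.
apply/nondecreasing_seqP => n; rewrite -!exps_series expsS lerDl.
by rewrite divr_ge0 ?exprn_ge0.
Qed.

(** From index [N] on, a term at [x] is at most [2 ^ (- N)] times the term at [2 |x|] in absolute
    value. *)
Lemma exps_diff N M x : (N <= M)%N ->
  `|exps M x - exps N x| <= 2^-1 ^+ N * (exps M (2 * `|x|) - exps N (2 * `|x|)).
Proof.
elim: M => [|M IH]; first by rewrite leqn0 => /eqP ->; rewrite !subrr normr0 mulr0.
rewrite leq_eqVlt => /predU1P[->|]; first by rewrite !subrr normr0 mulr0.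
rewrite ltnS => NM; have {}IH := IH NM; rewrite !(expsS M).
rewrite [X in `|X|](_ : _ = exps M x - exps N x + x ^+ M / M`!%:R); last by ring.
rewrite [leRHS](_ : _ = 2^-1 ^+ N * (exps M (2 * `|x|) - exps N (2 * `|x|)) +
  2^-1 ^+ N * ((2 * `|x|) ^+ M / M`!%:R)); last by ring.
apply: le_trans (ler_normD _ _) _; apply: lerD IH _.
rewrite normrM normfV normrX (ger0_norm (ler0n R M`!)) mulrA ler_wpM2r ?invr_ge0 //.
rewrite exprMn mulrA ler_peMl ?exprn_ge0 // exprVn.
by rewrite mulrC ler_pdivlMr ?exprn_gt0 // mul1r ler_weXn2l // ler1n.
Qed.

Lemma exps_tail N x : `|expR x - exps N x| <= 2^-1 ^+ N * expR (2 * `|x|).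
Proof.
have c : exps M x @[M --> \oo] --> expR x.
  rewrite (_ : (fun M => _) = series (exp_coeff x)); first exact: is_cvg_series_exp_coeff.
  by apply/funext => M; exact: exps_series.
apply/ler_addgt0Pr => e e0.
have [M _ HM] := (cvgrPdist_lt _ _).1 c e e0.
have [K NK MK] : exists2 K, (N <= K)%N & (M <= K)%N.
  by exists (maxn N M); [exact: leq_maxl|exact: leq_maxr].
have h : `|expR x - exps K x| < e by exact: HM.
have -> : expR x - exps N x = (exps K x - exps N x) + (expR x - exps K x) by ring.
apply: le_trans (ler_normD _ _) _; apply: lerD; last exact: ltW.
apply: le_trans (exps_diff x NK) _; rewrite ler_wpM2l ?exprn_ge0 //.
have x0 : 0 <= 2 * `|x| by rewrite mulr_ge0.
apply: le_trans (exps_le K x0); rewrite lerBlDr lerDl.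
by apply: sumr_ge0 => i _; rewrite divr_ge0 ?exprn_ge0.
Qed.

Definition evw w j : R := w ^+ (2 * j) / (2 * j)`!%:R.
Definition ev w n : R := \sum_(j < n.+1) evw w j.
Definition od w n : R := \sum_(j < n) w ^+ (2 * j).+1 / (2 * j).+1`!%:R.

Lemma evw_ge0 w j : 0 <= evw w j.
Proof. by rewrite /evw divr_ge0 // exprM exprn_ge0 // sqr_ge0. Qed.

Lemma evS w n : ev w n.+1 = ev w n + evw w n.+1.
Proof. by rewrite /ev big_ord_recr. Qed.

Lemma odS w n : od w n.+1 = od w n + w ^+ (2 * n).+1 / (2 * n).+1`!%:R.
Proof. by rewrite /od big_ord_recr. Qed.

(* The weights [evw w j] form, up to normalisation, the law of an even Poisson
   variable [2 j] of parameter [w]; its first two moments are exact. *)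
Lemma exps_even w n : exps (2 * n).+1 w = ev w n + od w n.
Proof.
elim: n => [|n IH]; first by rewrite expsS /exps /ev /od big_ord_recl !big_ord0 add0r !addr0.
by rewrite mulnS add2n 2!expsS IH evS odS /evw mulnS add2n; ring.
Qed.

Lemma evN w n : ev (- w) n = ev w n.
Proof. by apply: eq_bigr => i _; rewrite /evw !exprM sqrrN. Qed.

Lemma odN w n : od (- w) n = - od w n.
Proof.
rewrite /od -sumrN; apply: eq_bigr => i _.
by rewrite !exprS !exprM sqrrN mulNr mulNr.
Qed.

Lemma evw_le_exp w n : 0 <= w -> ev w n <= expR w.
Proof.
move=> w0; apply: le_trans (exps_le (2 * n).+1 w0); rewrite exps_even lerDl.
by apply: sumr_ge0 => i _; rewrite divr_ge0 // exprn_ge0.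
Qed.

Lemma evM2 w j : evw w j * 2^-1 ^+ (2 * j) = evw (w / 2) j.
Proof. by rewrite /evw exprMn; ring. Qed.

Lemma ev2M w j : evw w j * 2 ^+ (2 * j) = evw (2 * w) j.
Proof. by rewrite /evw exprMn; ring. Qed.

(** With [expR_916] this gives the rational bounds [9/16 <= ln 2 <= 3/4]; cutting the exponent into
    8, respectively 2, parts makes [1 + x <= expR x] sharp enough. *)
Lemma expR_34 : 2 <= expR (3 / 4) :> R.
Proof.
have e : (3 / 4 : R) = 8%:R * (3 / 32) by field.
rewrite e expRM_natl; apply: le_trans (_ : (35 / 32) ^+ 8 <= _); first by lra.
rewrite lerXn2r // ?nnegrE ?expR_ge0 //.
by apply: le_trans (expR_ge1Dx _); lra.
Qed.

Lemma expR_916 : expR (9 / 16) <= 2 :> R.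
Proof.
have e : (9 / 16 : R) = 2%:R * (9 / 32) by field.
rewrite e expRM_natl; apply: le_trans (_ : _ <= (32 / 23) ^+ 2) _; last by lra.
rewrite lerXn2r // ?nnegrE ?expR_ge0 //.
rewrite -[leLHS]invrK -expRN invf_ple ?posrE ?expR_gt0 //.
by apply: le_trans (expR_ge1Dx _); lra.
Qed.

Lemma exp2_ge n : expR (9 / 16 * n%:R) <= 2 ^+ n :> R.
Proof. by rewrite expRM_natr lerXn2r // ?nnegrE ?expR_ge0 // expR_916. Qed.

Lemma exp2_le n : 2 ^+ n <= expR (3 / 4 * n%:R) :> R.
Proof. by rewrite expRM_natr lerXn2r // ?nnegrE ?expR_ge0 // expR_34. Qed.

(** The even and odd sums are half the sum and half the difference of the truncated series of
    [expR w] and [expR (- w)]. The truncation is at degree [w ^ 2]; for [w >= 4] its error is at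
    most 1, because [ln 2 >= 9/16]. *)
Lemma ev_od n w : 4 <= w -> w ^+ 2 = 2 * n%:R ->
  `|ev w n - expR w / 2| <= 2 /\ `|ev w n - od w n| <= 2.
Proof.
move=> w4 wn.
have T : 2^-1 ^+ (2 * n).+1 * expR (2 * w) <= 1.
  rewrite exprVn mulrC ler_pdivrMr ?exprn_gt0 // mul1r.
  apply: le_trans (exp2_ge _); rewrite ler_expR -(natr1 (2 * n)) natrM -wn; nra.
have t1 := exps_tail (2 * n).+1 w.
have t2 := exps_tail (2 * n).+1 (- w).
have w0 : 0 <= w by lra.
rewrite normrN (ger0_norm w0) exps_even evN odN in t2.
rewrite (ger0_norm w0) exps_even in t1.
have e0 := expR_gt0 (- w).
have e1 : expR (- w) <= 1 by rewrite -expR0 ler_expR; lra.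
move: (le_trans t1 T) (le_trans t2 T); rewrite !ler_norml => /andP[? ?] /andP[? ?].
by split; apply/andP; split; lra.
Qed.

Lemma evw_succ w j : (2 * j.+1)%:R * evw w j.+1 = w * (w ^+ (2 * j).+1 / (2 * j).+1`!%:R).
Proof.
rewrite /evw mulnS add2n factS natrM (exprS _ (2 * j).+1).
have : (2 * j).+2%:R != 0 :> R by [].
have : (2 * j).+1`!%:R != 0 :> R by rewrite gt_eqF // ltr0n fact_gt0.
by move: (_.+2%:R) (_`!%:R) => p f f0 p0; field; rewrite f0 p0.
Qed.

Lemma od_succ w j : (2 * j).+1%:R * (w ^+ (2 * j).+1 / (2 * j).+1`!%:R) = w * evw w j.
Proof.
rewrite /evw factS natrM (exprS _ (2 * j)).
have : (2 * j).+1%:R != 0 :> R by [].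
have : (2 * j)`!%:R != 0 :> R by rewrite gt_eqF // ltr0n fact_gt0.
by move: (_.+1%:R) (_`!%:R) => p f f0 p0; field; rewrite f0 p0.
Qed.

(** [2 j] times the term of degree [2 j] is [w] times the term of degree [2 j - 1], so the first
    moment is [w] times the odd sum. *)
Lemma ev_moment1 w n : \sum_(j < n.+1) evw w j * ((2 * j)%:R - w) = w * (od w n - ev w n).
Proof.
elim: n => [|n IH].
  by rewrite big_ord_recl big_ord0 /od big_ord0 /ev big_ord_recl big_ord0 /=; ring.
rewrite big_ord_recr /= IH odS evS.
have -> : evw w n.+1 * ((2 * n.+1)%:R - w) = (2 * n.+1)%:R * evw w n.+1 - w * evw w n.+1.
  by ring.
rewrite evw_succ.
by ring.
Qed.

(** Shifting the degree twice leaves the last even weight as a boundary term; its negative sign lets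
    it be dropped from an upper bound. *)
Lemma ev_moment2 w n : \sum_(j < n.+1) evw w j * ((2 * j)%:R - w) ^+ 2 =
  w ^+ 2 * (2 * (ev w n - od w n) - evw w n) + w * od w n.
Proof.
elim: n => [|n IH].
  rewrite big_ord_recl big_ord0 /od big_ord0 /ev big_ord_recl big_ord0 /= muln0.
  by rewrite /evw muln0; ring.
rewrite big_ord_recr /= IH odS evS.
set O := w ^+ _ / _; have e1 := evw_succ w n; have e2 := od_succ w n.
rewrite -/O in e1 e2.
have kE : (2 * n.+1)%:R = (2 * n).+1%:R + 1 :> R by rewrite natr1 mulnS add2n.
have -> : evw w n.+1 * ((2 * n.+1)%:R - w) ^+ 2 =
  ((2 * n.+1)%:R * evw w n.+1) * ((2 * n.+1)%:R - 2 * w) + w ^+ 2 * evw w n.+1 by ring.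
rewrite e1 kE.
have -> : w * O * ((2 * n).+1%:R + 1 - 2 * w) =
  w * ((2 * n).+1%:R * O) + w * O * (1 - 2 * w) by ring.
by rewrite e2; ring.
Qed.

End ExpSums.

(** * The terms of [q_n] relative to even Poisson weights *)

Section QTerms.
Variable R : realType.
Implicit Types (a b w t : R) (n m j : nat).

(** In the reversed sum consecutive terms have ratio [(n - j)(n + a - j) / ((j + 1)(j + 1 - a)(2 n +
    a - j))]. The weight [evw] accounts for [2 n / ((2 j + 1)(2 j + 2))], [fq] trades [j + 1/2] for
    [j + 1 - a], and [gq] collects what is left, which tends to 1 for fixed [j]. *)
Definition gq a n j : R :=
  \prod_(i < j) ((1 - i%:R / n%:R) * (1 + (a - i%:R) / n%:R) / (1 + (a - i%:R) / (2 * n%:R))).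
Definition fq a j : R := poch 2^-1 j / poch (1 - a) j.

Lemma gqS a n j : gq a n j.+1 = gq a n j *
  ((1 - j%:R / n%:R) * (1 + (a - j%:R) / n%:R) / (1 + (a - j%:R) / (2 * n%:R))).
Proof. by rewrite /gq big_ord_recr. Qed.

Lemma fqS a j : fq a j.+1 = fq a j * ((2^-1 + j%:R) / (1 - a + j%:R)).
Proof. by rewrite /fq !pochS invfM; ring. Qed.

Lemma qterm_ev a n j : -1 < a -> (forall k, 1 - a + k%:R != 0) -> (0 < n)%N -> (j <= n)%N ->
  gbinom (n%:R - a) (n - j) * gbinom (n%:R + a) j * poch (a + 1) (2 * n - j) =
  gbinom (n%:R - a) n * poch (a + 1) (2 * n) *
    (evw (Num.sqrt (2 * n%:R)) j * (fq a j * gq a n j)).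
Proof.
move=> a1 H n0.
have nR : 1 <= n%:R :> R by rewrite ler1n.
elim: j => [_|j IH jn].
  rewrite !subn0 gbinom0 /evw /fq /gq muln0 expr0 divr1 /poch !big_ord0 invr1.
  by ring.
have {}IH := IH (ltnW jn).
have jR : j%:R + 1 <= n%:R :> R by rewrite natr1 ler_nat.
have j0 := ler0n R j.
have k1 : (n - j = (n - j.+1).+1)%N by lia.
have k2 : (2 * n - j = (2 * n - j.+1).+1)%N by lia.
have e1 := gbinomS (n%:R - a) (n - j.+1).
have e2 := gbinomS (n%:R + a) j.
have e3 := pochS (a + 1) (2 * n - j.+1).
rewrite -k1 in e1; rewrite -k2 in e3.
have c1 : (n - j.+1)%:R = n%:R - j%:R - 1 :> R by rewrite natrB // -(natr1 j); ring.
have c1' : (n - j)%:R = n%:R - j%:R :> R by rewrite natrB // ltnW.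
have c2 : (2 * n - j.+1)%:R = 2 * n%:R - j%:R - 1 :> R.
  by rewrite natrB ?natrM ?mulr_natl -?(natr1 j) //; [rewrite -mulr_natl; ring|lia].
rewrite c1 c1' in e1; rewrite c2 in e3; rewrite -(natr1 j) in e2.
have evE : evw (Num.sqrt (2 * n%:R)) j.+1 * ((2 * j%:R + 1) * (2 * j%:R + 2)) =
    evw (Num.sqrt (2 * n%:R)) j * (2 * n%:R) :> R.
  set w := Num.sqrt _; have wE : w ^+ 2 = 2 * n%:R by rewrite sqr_sqrtr ?mulr_ge0.
  have := evw_succ w j; have := od_succ w j; rewrite -wE.
  set o := _ / _ => o1 o2.
  have j1 : (2 * j).+1%:R = 2 * j%:R + 1 :> R by rewrite -(natr1 (2 * j)) natrM.
  have j2 : (2 * j.+1)%:R = 2 * j%:R + 2 :> R by rewrite mulnS natrD natrM addrC.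
  rewrite j1 in o1; rewrite j2 in o2.
  by rewrite mulrC -mulrA o2 mulrCA o1; ring.
have fE := fqS a j; have gE := gqS a n j.
rewrite fE gE.
have hj := H j.
have d1 : 2 * n%:R + a - j%:R != 0 by rewrite gt_eqF //; lra.
have d2 : n%:R - j%:R != 0 :> R by rewrite gt_eqF //; lra.
have -> : gbinom (n%:R + a) j.+1 = (n%:R + a - j%:R) * gbinom (n%:R + a) j / (j%:R + 1).
  by rewrite -e2 mulrC mulKf // natr1.
have -> : poch (a + 1) (2 * n - j.+1) = poch (a + 1) (2 * n - j) / (2 * n%:R + a - j%:R).
  by rewrite e3 (_ : a + 1 + _ = 2 * n%:R + a - j%:R) ?mulfK //; ring.
have -> : evw (Num.sqrt (2 * n%:R)) j.+1 =
    evw (Num.sqrt (2 * n%:R)) j * (2 * n%:R) / ((2 * j%:R + 1) * (2 * j%:R + 2)) :> R.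
  by rewrite -evE mulfK // mulf_neq0 // gt_eqF //; lra.
have -> : gbinom (n%:R - a) (n - j.+1) =
    gbinom (n%:R - a) (n - j) * (n%:R - j%:R) / (1 - a + j%:R).
  rewrite (mulrC (gbinom _ _)) e1 (_ : n%:R - a - _ = 1 - a + j%:R); last by ring.
  by rewrite mulrC mulKf.
rewrite [LHS](_ : _ = gbinom (n%:R - a) (n - j) * gbinom (n%:R + a) j * poch (a + 1) (2 * n - j) *
   ((n%:R - j%:R) * (n%:R + a - j%:R) / ((1 - a + j%:R) * (j%:R + 1) * (2 * n%:R + a - j%:R)))); last first.
  move: (gbinom _ _) (gbinom _ _) (poch _ _) => u v x.
  by field; rewrite d1 hj gt_eqF //; lra.
rewrite IH.
move: (gbinom _ _) (poch _ _) (evw _ _) (fq _ _) (gq _ _ _) => u v x f g.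
field; rewrite hj addrA d1 !gt_eqF //; lra.
Qed.

Lemma q_seq_ev a n : -1 < a -> (forall k, 1 - a + k%:R != 0) -> (0 < n)%N ->
  q_seq a n = gbinom (n%:R - a) n * poch (a + 1) (2 * n) *
    \sum_(j < n.+1) evw (Num.sqrt (2 * n%:R)) j * (fq a j * gq a n j).
Proof.
move=> a1 H n0; rewrite /q_seq (reindex_inj rev_ord_inj) mulr_sumr.
apply: eq_bigr => j _ /=; rewrite subSS.
have jn : (j <= n)%N by rewrite -ltnS.
by rewrite subKn // -qterm_ev //; congr (_ * poch _ _); lia.
Qed.

(** The exponent is the sum of the [(b - i) / M], with main part [- j ^ 2 / (2 M)]; [j <= w] and
    [M >= w ^ 2 / 2] make the rest [O(1 / w)]. *)
Lemma prod_shift_expR b w (M : R) j : 0 < M -> w ^+ 2 <= 2 * M -> j%:R <= w ->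
  4 * (`|b| + 1) <= w -> exists2 e, `|e| <= 10 * (`|b| + 1) ^+ 2 / w &
  \prod_(i < j) (1 + (b - i%:R) / M) = expR (- (j%:R ^+ 2 / (2 * M)) + e).
Proof.
move=> M0 wM jw; set B := `|b| + 1 => Bw.
have b0 : 0 <= `|b| by [].
have B1 : 1 <= B by rewrite /B; lra.
have w0 : 0 < w by lra.
have j0 := ler0n R j.
have MV : M^-1 <= 2 / w ^+ 2.
  by rewrite -div1r ler_pdivrMr // mulrAC ler_pdivlMr ?exprn_gt0 // mul1r.
have hB : 2 * B / w <= 2^-1 by rewrite ler_pdivrMr //; lra.
have xb i : (i < j)%N -> `|(b - i%:R) / M| <= 2 * B / w.
  move=> ij; have iw : i%:R <= w by apply: le_trans jw; rewrite ler_nat ltnW.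
  rewrite normrM normfV (gtr0_norm M0).
  have h1 : `|b - i%:R| <= B * w.
    apply: le_trans (ler_normB _ _) _; rewrite (ger0_norm (ler0n R i)) /B; nra.
  apply: le_trans (ler_pM _ _ h1 MV) _; rewrite ?invr_ge0 //; first exact: ltW.
  by rewrite le_eqVlt; apply/orP/or_introl/eqP; field; rewrite gt_eqF.
have [i ij|d db dE] := @prod_expR R (fun i => (b - i%:R) / M) j.
  by apply: le_trans (xb i ij) hB.
rewrite dE; exists ((b + 2^-1) * j%:R / M + d); last first.
  congr expR; rewrite -mulr_suml sumrB sum_iota_R sumr_const card_ord -mulr_natr.
  by field; rewrite gt_eqF.
have S : \sum_(i < j) ((b - i%:R) / M) ^+ 2 <= w * (2 * B / w) ^+ 2.
  apply: (@le_trans _ _ (\sum_(i < j) (2 * B / w) ^+ 2)).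
    apply: ler_sum => i _; rewrite -[leLHS]ger0_norm ?sqr_ge0 // normrX.
    rewrite lerXn2r // ?nnegrE // ?xb // divr_ge0 //; lra.
  by rewrite sumr_const card_ord -[leLHS]mulr_natl; apply: ler_wpM2r; rewrite ?sqr_ge0.
have h3 : w * (2 * B / w) ^+ 2 = 4 * B ^+ 2 / w by field; rewrite gt_eqF.
have h4 : `|(b + 2^-1) * j%:R / M| <= 2 * B / w.
  rewrite !normrM normfV (gtr0_norm M0) (ger0_norm j0).
  have h1 : `|b + 2^-1| * j%:R <= B * w.
    apply: ler_pM => //; apply: le_trans (ler_normD _ _) _.
    by rewrite (ger0_norm (_ : 0 <= 2^-1 :> R)) /B //; lra.
  apply: le_trans (ler_pM _ _ h1 MV) _; rewrite ?mulr_ge0 ?invr_ge0 //; first exact: ltW.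
  by rewrite le_eqVlt; apply/orP/or_introl/eqP; field; rewrite gt_eqF.
have h5 : 2 * B / w <= 2 * B ^+ 2 / w.
  by apply: ler_wpM2r; [rewrite invr_ge0 ltW|nra].
apply: le_trans (ler_normD _ _) _; rewrite [leRHS](_ : _ = 2 * B ^+ 2 / w + 2 * (4 * B ^+ 2 / w)); last by ring.
by apply: lerD; [apply: le_trans h4 h5|rewrite -h3; apply: le_trans db _; rewrite ler_wpM2l].
Qed.

(** Three such products contribute [- j ^ 2 / (2 n)] twice and [j ^ 2 / (4 n)] once, in all
    [- 3 j ^ 2 / (4 n)]; at the centre [2 j = w] this is [-3/8]. *)
Lemma gq_expR a n j : let w := Num.sqrt (2 * n%:R) in (0 < n)%N -> j%:R <= w ->
  4 * (`|a| + 1) <= w -> exists2 e, `|e| <= 30 * (`|a| + 1) ^+ 2 / w &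
  gq a n j = expR (- (3 / 8 * (2 * j%:R / w) ^+ 2) + e).
Proof.
move=> w n0 jw aw; have nR : 0 < n%:R :> R by rewrite ltr0n.
have wE : w ^+ 2 = 2 * n%:R by rewrite sqr_sqrtr; lra.
have a0 : 0 <= `|a| by [].
have w0 : 0 < w by lra.
have w0' : 4 * (`|0 : R| + 1) <= w by rewrite normr0; lra.
have w1 : w ^+ 2 <= 2 * n%:R by rewrite wE.
have w2 : w ^+ 2 <= 2 * (2 * n%:R) by rewrite wE; lra.
have n2 : 0 < 2 * n%:R :> R by lra.
have [e1 b1 E1] := prod_shift_expR nR w1 jw w0'.
have [e2 b2 E2] := prod_shift_expR nR w1 jw aw.
have [e3 b3 E3] := prod_shift_expR n2 w2 jw aw.
have gE : gq a n j = (\prod_(i < j) (1 + (0 - i%:R) / n%:R)) *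
    (\prod_(i < j) (1 + (a - i%:R) / n%:R)) / (\prod_(i < j) (1 + (a - i%:R) / (2 * n%:R))).
  by rewrite -big_split -prodf_div; apply: eq_bigr => i _; rewrite sub0r mulNr.
rewrite gE E1 E2 E3 -expRN -!expRD; exists (e1 + e2 - e3); last first.
  by congr expR; rewrite exprMn exprVn wE; field; rewrite gt_eqF.
have b1' : `|e1| <= 10 * (`|a| + 1) ^+ 2 / w.
  apply: le_trans b1 _; rewrite normr0 add0r expr1n.
  by apply: ler_wpM2r; [rewrite invr_ge0 ltW|nra].
rewrite (_ : 30 * _ / w = 10 * (`|a| + 1) ^+ 2 / w + 10 * (`|a| + 1) ^+ 2 / w + 10 * (`|a| + 1) ^+ 2 / w); last by ring.
apply: le_trans (ler_normB _ _) _; apply: lerD => //.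
by apply: le_trans (ler_normD _ _) _; apply: lerD.
Qed.

Lemma gq_bound a n j : -1 < a -> (j <= n)%N -> 0 <= gq a n j <= expR `|a|.
Proof.
move=> a1 jn; have [n0|n0] := posnP n.
  move: jn; rewrite n0 leqn0 => /eqP ->; rewrite /gq big_ord0 ler01 /=.
  by rewrite -expR0 ler_expR.
have nR : 1 <= n%:R :> R by rewrite ler1n.
have nn0 : 0 < n%:R :> R by lra.
(* [a > -1] and [i + 1 <= n] keep [n + a - i] nonnegative, so no factor changes sign. *)
have step i : (i < n)%N -> 0 <= (1 - i%:R / n%:R) * (1 + (a - i%:R) / n%:R) /
    (1 + (a - i%:R) / (2 * n%:R)) <= 1 + `|a| / n%:R.
  move=> lin; have iR : i%:R + 1 <= n%:R :> R by rewrite natr1 ler_nat.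
  have i0 := ler0n R i.
  have -> : (1 - i%:R / n%:R) * (1 + (a - i%:R) / n%:R) / (1 + (a - i%:R) / (2 * n%:R)) =
     (1 - i%:R / n%:R) * (2 * (n%:R + a - i%:R) / (2 * n%:R + a - i%:R)).
    by field; repeat (apply/andP; split); rewrite gt_eqF //; lra.
  have D0 : 0 < 2 * n%:R + a - i%:R by lra.
  have p1 : 0 <= 1 - (i%:R / n%:R : R) <= 1.
    have h1 : 0 <= i%:R / n%:R :> R by rewrite divr_ge0.
    have h2 : i%:R / n%:R <= 1 :> R by rewrite ler_pdivrMr // mul1r; lra.
    by apply/andP; split; lra.
  have p2 : 0 <= 2 * (n%:R + a - i%:R) / (2 * n%:R + a - i%:R) <= 1 + `|a| / n%:R.
    rewrite divr_ge0 ?(ltW D0) ?mulr_ge0 //=; last by lra.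
    have h0 := ler_norm a; have h1 : 0 <= `|a| by [].
    have -> : 1 + `|a| / n%:R = (n%:R + `|a|) / n%:R by field; rewrite gt_eqF.
    rewrite ler_pdivrMr // mulrAC ler_pdivlMr //.
    case: (lerP 0 a) => a0; first by rewrite (ger0_norm a0); nra.
    rewrite (ltr0_norm a0).
    have : 0 <= (n%:R - i%:R - 1) * - a by apply: mulr_ge0; lra.
    by nra.
  move: p1 p2 => /andP[? ?] /andP[? ?]; apply/andP; split; first exact: mulr_ge0.
  by rewrite -[leRHS]mul1r; apply: ler_pM.
have B : 0 <= gq a n j <= expR (j%:R * (`|a| / n%:R)).
  elim: j jn => [_|j IH jn]; first by rewrite /gq big_ord0 mul0r expR0 ler01 lexx.
  have /andP[h1 h2] := IH (ltnW jn); have /andP[h3 h4] := step j jn.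
  have -> : expR (j.+1%:R * (`|a| / n%:R)) = expR (j%:R * (`|a| / n%:R)) * expR (`|a| / n%:R).
    by rewrite -expRD -(natr1 j) mulrDl mul1r.
  rewrite gqS mulr_ge0 //=.
  by apply: ler_pM => //; apply: le_trans h4 (expR_ge1Dx _).
move: B => /andP[-> h] /=; apply: le_trans h _; rewrite ler_expR mulrCA ler_piMr //.
by rewrite ler_pdivrMr // mul1r ler_nat.
Qed.

(* The linear term is kept: the weights centre [t] exponentially well, whereas
   [|t - 1|] itself has mean of order [w ^ (- 1/2)] only. *)
Lemma taylor_expR (A t : R) : 2^-1 <= t <= 2 ->
  let u := A * ln t - 3 / 8 * (t ^+ 2 - 1) in
  `|u| <= `|A| + 9 / 8 /\
  `|expR u - 1 - (A - 3 / 4) * (t - 1)| <=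
    ((2 * `|A| + 2) ^+ 2 * (expR (`|A| + 9 / 8) + 1) + 2 * `|A| + 1) * (t - 1) ^+ 2.
Proof.
move=> /andP[t1 t2] u; have t0 : 0 < t by lra.
have /andP[l1 l2] := ln_sub1_ge t0.
have A0 : 0 <= `|A| by [].
have tV : t^-1 <= 2 by rewrite invf_ple ?posrE.
have tV1 : 1 - t^-1 = (t - 1) / t by field; rewrite gt_eqF.
have L1 : `|ln t| <= 1 by rewrite ler_norml; apply/andP; split; lra.
have L2 : `|ln t| <= 2 * `|t - 1|.
  have h : `|(t - 1) / t| <= 2 * `|t - 1|.
    by rewrite normrM normfV (gtr0_norm t0) mulrC ler_wpM2r.
  move: h; rewrite -tV1 !ler_norml => /andP[h1 h2].
  have := ler_norm (t - 1); have n0 : 0 <= `|t - 1| by [].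
  by move=> h3; apply/andP; split; lra.
have L3 : `|ln t - (t - 1)| <= 2 * (t - 1) ^+ 2.
  have h : (t - 1) - (1 - t^-1) <= 2 * (t - 1) ^+ 2.
    rewrite (_ : _ - _ = (t - 1) ^+ 2 * t^-1); last by field; rewrite gt_eqF.
    by rewrite mulrC ler_wpM2r ?sqr_ge0.
  have := sqr_ge0 (t - 1) => q0.
  by rewrite ler_norml; apply/andP; split; lra.
have Q1 : `|t ^+ 2 - 1| <= 3 by rewrite ler_norml; apply/andP; split; nra.
have Q2 : `|t ^+ 2 - 1| <= 3 * `|t - 1|.
  rewrite (_ : t ^+ 2 - 1 = (t + 1) * (t - 1)); last by ring.
  by rewrite normrM ler_wpM2r // gtr0_norm; lra.
have nB (x y : R) : `|x - 3 / 8 * y| <= `|x| + 3 / 8 * `|y|.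
  apply: le_trans (ler_normB _ _) _; rewrite lerD2l normrM ler_wpM2r // ger0_norm //; lra.
have U1 : `|u| <= `|A| + 9 / 8.
  apply: le_trans (nB _ _) _; rewrite normrM; nra.
have U2 : `|u| <= (2 * `|A| + 2) * `|t - 1|.
  apply: le_trans (nB _ _) _; rewrite normrM.
  have n0 : 0 <= `|t - 1| by []; nra.
have U3 : `|u - (A - 3 / 4) * (t - 1)| <= (2 * `|A| + 1) * (t - 1) ^+ 2.
  rewrite (_ : u - _ = A * (ln t - (t - 1)) - 3 / 8 * (t - 1) ^+ 2); last by rewrite /u; field.
  apply: le_trans (nB _ _) _; rewrite normrM (ger0_norm (sqr_ge0 (t - 1))).
  have := sqr_ge0 (t - 1); nra.
split=> //.
have X : `|expR u - 1 - u| <= u ^+ 2 * (expR (`|A| + 9 / 8) + 1).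
  have h1 := expR_ge1Dx u; have h2 := expR_ge1Dx (- u).
  have e0 := expR_gt0 u.
  have h3 : expR u - 1 <= u * expR u.
    have : expR u * (1 - u) <= expR u * expR (- u) by rewrite ler_pM2l.
    by rewrite expRN mulfV ?gt_eqF //; lra.
  rewrite ger0_norm; last by lra.
  apply: (@le_trans _ _ (u * (expR u - 1))); first by lra.
  apply: le_trans (ler_norm _) _; rewrite normrM -(real_normK (num_real u)) expr2 -mulrA.
  apply: ler_wpM2l => //; have := expR_sub_le u 0; rewrite expR0 subr0 => h.
  apply: le_trans h _; apply: ler_wpM2l => //; rewrite lerD2r ler_expR.
  by apply: le_trans (ler_norm _) _.
rewrite (_ : expR u - 1 - (A - 3 / 4) * (t - 1) = (expR u - 1 - u) + (u - (A - 3 / 4) * (t - 1))); last by ring.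
apply: le_trans (ler_normD _ _) _.
rewrite -(addrA _ (2 * `|A|)) [leRHS]mulrDl; apply: lerD => //.
apply: le_trans X _; rewrite [leRHS]mulrAC; apply: ler_wpM2r; first by rewrite addr_ge0 ?expR_ge0.
rewrite -(real_normK (num_real u)) -(real_normK (num_real (t - 1))) -exprMn.
by rewrite lerXn2r // ?nnegrE // mulr_ge0 //; lra.
Qed.

End QTerms.

(** * The terms near the centre and away from it *)

Section QAsymptotics.
Variable R : realType.
Implicit Types (a b w t : R) (n m j : nat).

(** The constant in [fq a j ~ c0q a * j ^ (a - 1/2)], from Gauss's limit at [1/2] and at [1 - a]. *)
Definition c0q a : R := Gamma (1 - a) / Gamma 2^-1.

Lemma Gamma_half_gt0 : 0 < Gamma (2^-1 : R).
Proof. by rewrite Gamma_pos ?GI_gt0. Qed.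

Lemma c0q_neq0 a : (forall k, 1 - a + k%:R != 0) -> c0q a != 0.
Proof.
by move=> H; rewrite /c0q mulf_neq0 ?invr_neq0 ?Gamma_neq0 // gt_eqF // Gamma_half_gt0.
Qed.

Lemma fq_near1 a : (forall k, 1 - a + k%:R != 0) ->
  near1 (rinv R) (fun j => fq a j / (c0q a * j%:R `^ (a - 2^-1))).
Proof.
move=> H; have Hh k : 2^-1 + k%:R != 0 :> R by rewrite gt_eqF // ltr_wpDr.
have := near1_div (rate_rinv R) (near1_poch Hh) (near1_poch H).
apply: (near1_eq (N := 1%N)) => j j1; have jR : 0 < j%:R :> R by rewrite ltr0n.
have g1 := Gamma_neq0 H; have g2 : Gamma (2^-1 : R) != 0 by rewrite gt_eqF // Gamma_half_gt0.
have p1 := poch_neq0 j H.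
have f0 : j`!%:R != 0 :> R by rewrite gt_eqF // factR_gt0.
have -> : j%:R `^ (2^-1 - 1) = j%:R `^ (1 - a - 1) * (j%:R `^ (a - 2^-1)).
  by rewrite -powRD ?(gt_eqF jR) ?implybT //; congr (_ `^ _); field.
have P0 := powR_gt0 (1 - a - 1) jR; have P1 := powR_gt0 (a - 2^-1) jR.
rewrite /fq /c0q; move: (_ `^ _) (_ `^ _) P0 P1 => P Q P0 P1.
move: (Gamma _) (Gamma _) (poch _ _) (poch _ _) (j`!%:R) g1 g2 p1 f0 => G1 G2 p q f g1 g2 p1 f0.
by field; rewrite g1 g2 p1 f0 !gt_eqF.
Qed.

Lemma fq_bound a : (forall k, 1 - a + k%:R != 0) ->
  exists2 C, 0 <= C & forall j, `|fq a j| <= C * (1 + j%:R) `^ `|a - 2^-1|.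
Proof.
move=> H; have h1 : 0 < 1 :> R by [].
have [N HN] := near1_ev (rate_rinv R) (fq_near1 H) h1.
set A := a - 2^-1; pose N' := maxn 1 N.
have S0 : 0 <= \sum_(i < N') `|fq a i| by apply: sumr_ge0.
exists (\sum_(i < N') `|fq a i| + 2 * `|c0q a|); first by rewrite addr_ge0 ?mulr_ge0.
move=> j; have j0 := ler0n R j.
have P1 : 1 <= (1 + j%:R) `^ `|A|.
  by rewrite -[leLHS](powRr0 (1 + j%:R)) ler_powR //; lra.
case: (ltnP j N') => jN.
  apply: (@le_trans _ _ (\sum_(i < N') `|fq a i|)).
    by rewrite (bigD1 (Ordinal jN)) //= lerDl sumr_ge0.
  apply: (@le_trans _ _ (\sum_(i < N') `|fq a i| + 2 * `|c0q a|)).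
    by rewrite lerDl mulr_ge0.
  by rewrite ler_peMr // addr_ge0 // mulr_ge0.
have := jN; rewrite geq_max => /andP[j1 /HN /andP[_ h]].
have jR : 0 < j%:R :> R by rewrite ltr0n.
have c0 := c0q_neq0 H.
have Pj := powR_gt0 A jR.
have Lb : fq a j / (c0q a * j%:R `^ A) >= 0.
  by have [_ /(_ j)] := conj I HN; rewrite subrr => /(_ (leq_trans (leq_maxr 1 N) jN)) /andP[].
have fE : fq a j = c0q a * j%:R `^ A * (fq a j / (c0q a * j%:R `^ A)).
  by move: (_ `^ _) Pj => P P0; field; rewrite c0 gt_eqF.
rewrite fE 2!normrM (ger0_norm Lb) (gtr0_norm Pj) -mulrA (mulrC (j%:R `^ A)) mulrA.
have PA : j%:R `^ A <= (1 + j%:R) `^ `|A|.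
  apply: (@le_trans _ _ (j%:R `^ `|A|)); first by rewrite ler_powR ?ler1n // ler_norm.
  by rewrite ge0_ler_powR ?nnegrE //; lra.
apply: ler_pM => //; first by rewrite mulr_ge0.
rewrite mulrC; apply: (@le_trans _ _ (2 * `|c0q a|)); last by rewrite lerDr.
by apply: ler_wpM2r => //; lra.
Qed.

(** Approximate value of [fq * gq] at the centre [j = w / 2]. *)
Definition Fq a n : R :=
  c0q a * (Num.sqrt (2 * n%:R) / 2) `^ (a - 2^-1) * expR (- (3 / 8)).

Lemma Fq_neq0 a n : (0 < n)%N -> (forall k, 1 - a + k%:R != 0) -> Fq a n != 0.
Proof.
move=> n0 H; have nR : 0 < n%:R :> R by rewrite ltr0n.
have s0 : 0 < Num.sqrt (2 * n%:R) / 2 :> R by rewrite divr_gt0 // sqrtr_gt0 mulr_gt0.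
rewrite /Fq; apply: mulf_neq0; last by rewrite gt_eqF // expR_gt0.
by apply: mulf_neq0; [exact: c0q_neq0|rewrite gt_eqF // powR_gt0].
Qed.

(** With [t = 2 j / w] and [A = a - 1/2], the quotient by [Fq] is [expR u (1 + O(1 / w))], where
    [u = A ln t - 3/8 (t ^ 2 - 1)]. The slope [A - 3/4] is the derivative of [u] at [t = 1]. *)
Lemma psi_central a : (forall k, 1 - a + k%:R != 0) ->
  exists C N, 0 <= C /\ forall n j, (N <= n)%N ->
    let w := Num.sqrt (2 * n%:R) in
    2^-1 <= 2 * j%:R / w <= 2 ->
    `|fq a j * gq a n j / Fq a n - 1 - (a - 2^-1 - 3 / 4) * (2 * j%:R / w - 1)| <=
    C * ((2 * j%:R / w - 1) ^+ 2 + w^-1).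
Proof.
move=> H; set A := a - 2^-1.
have [C1 [N1 [C10 H1]]] := bigOnC0 (rate_rinv R) (fq_near1 H).
pose c3 := 30 * (`|a| + 1) ^+ 2; pose U := `|A| + 9 / 8.
have a0 : 0 <= `|a| by [].
have A0 : 0 <= `|A| by [].
have c30 : 0 <= c3 by rewrite mulr_ge0 // sqr_ge0.
have [N HN] := ev_sqrt2n (4 * N1%:R + 4 * (`|a| + 1) : R).
pose K1 := (2 * `|A| + 2) ^+ 2 * (expR U + 1) + 2 * `|A| + 1.
pose K2 := expR U * (c3 * (expR c3 + 1) + 4 * C1 * expR c3).
have K10 : 0 <= K1.
  by rewrite /K1 !addr_ge0 // ?mulr_ge0 // ?sqr_ge0 // addr_ge0 // expR_ge0.
have K20 : 0 <= K2.
  by rewrite /K2 !(mulr_ge0, addr_ge0, expR_ge0).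
exists (K1 + K2), (maxn 1 N); split; first exact: addr_ge0.
move=> n j; rewrite geq_max => /andP[n1 /HN wge] w; rewrite -/w in wge.
set t := 2 * j%:R / w => tt.
have N10 := ler0n R N1.
have w4 : 4 <= w by lra.
have w0 : 0 < w by lra.
have /andP[t1 t2] := tt.
have t0 : 0 < t by lra.
have jE : j%:R = w / 2 * t by rewrite /t; field; rewrite gt_eqF.
have jw : j%:R <= w by rewrite jE; nra.
have jw4 : w / 4 <= j%:R by rewrite jE; nra.
have jR : 0 < j%:R :> R by lra.
have jN : (N1 <= j)%N by rewrite -(ler_nat R); lra.
have aw : 4 * (`|a| + 1) <= w by lra.
have [e eb gE] := gq_expR n1 jw aw.
rewrite -/w -/t -/c3 in eb gE.
have [ub tb] := taylor_expR A tt.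
rewrite -/U in ub tb; rewrite -/K1 in tb.
move: ub tb; set u := A * ln t - _ => ub tb.
have e1 := H1 j jN; set ep := fq a j / _ - 1 in e1.
have c0 := c0q_neq0 H; have w20 : 0 < w / 2 by lra.
have Pj := powR_gt0 A jR; have Pw := powR_gt0 A w20.
have eE : fq a j = c0q a * j%:R `^ A * (1 + ep).
  by rewrite /ep; move: (_ `^ _) Pj => P P0; field; rewrite c0 gt_eqF.
have psiE : fq a j * gq a n j / Fq a n = (1 + ep) * expR e * expR u.
  rewrite eE gE /Fq -/w -/A.
  have -> : j%:R `^ A = (w / 2) `^ A * expR (A * ln t).
    by rewrite jE powRM ?(ltW w20) ?(ltW t0) // [in t `^ A]/powR gt_eqF.
  have -> : expR u = expR (A * ln t) * expR (- (3 / 8 * t ^+ 2)) / expR (- (3 / 8)).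
    by rewrite -expRN -!expRD; congr expR; rewrite /u; field.
  rewrite expRD; move: (_ `^ _) Pw (expR (- (3 / 8))) (expR_gt0 (- (3 / 8) : R)) => P P0 E E0.
  by field; rewrite c0 !gt_eqF.
have eb' : `|e| <= c3 by apply: le_trans eb _; rewrite ler_pdivrMr // ler_peMr //; lra.
have ee : expR e <= expR c3 by rewrite ler_expR (le_trans (ler_norm _)).
(* [t >= 1/2] means [j >= w / 4], hence the 4. *)
have ep1 : `|ep| <= 4 * C1 / w.
  apply: le_trans e1 _; rewrite /rinv (mulrC 4) -mulrA; apply: ler_wpM2l => //.
  by rewrite -div1r ler_pdivrMr // mulrAC ler_pdivlMr //; lra.
have eu : expR u <= expR U by rewrite ler_expR (le_trans (ler_norm _)).
have D1 : `|(1 + ep) * expR e * expR u - expR u| <= K2 / w.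
  rewrite (_ : _ - _ = expR u * ((expR e - 1) + ep * expR e)); last by ring.
  rewrite normrM (gtr0_norm (expR_gt0 u)) /K2 -mulrA; apply: ler_pM => //.
  apply: le_trans (ler_normD _ _) _; rewrite [leRHS]mulrDl; apply: lerD.
    have := expR_sub_le e 0; rewrite expR0 subr0 => h; apply: le_trans h _.
    rewrite [leRHS]mulrAC; apply: ler_pM => //; last by rewrite lerD2r.
  rewrite normrM (gtr0_norm (expR_gt0 e)) [leRHS]mulrAC; apply: ler_pM => //.
rewrite psiE (_ : _ - 1 - _ = ((1 + ep) * expR e * expR u - expR u) +
  (expR u - 1 - (A - 3 / 4) * (t - 1))); last by ring.
apply: le_trans (ler_normD _ _) _; apply: le_trans (lerD D1 tb) _.
have q0 := sqr_ge0 (t - 1).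
have wV : 0 <= w^-1 by rewrite invr_ge0 ltW.
have z1 : 0 <= K2 * (t - 1) ^+ 2 by rewrite mulr_ge0.
have z2 : 0 <= K1 * w^-1 by rewrite mulr_ge0.
rewrite [leRHS](_ : _ = K2 / w + K1 * (t - 1) ^+ 2 + (K2 * (t - 1) ^+ 2 + K1 * w^-1)); last by ring.
by rewrite lerDl addr_ge0.
Qed.

(** Away from the centre a polynomial bound is enough, the weights being exponentially small in
    comparison. Its exponent covers [2 |A|] from [fq] (as [1 + j <= w ^ 2]) plus [|A|] from the
    inverse of [Fq], and 1 from the linear term, where [A = a - 1/2]. *)
Lemma psi_outer a : -1 < a -> (forall k, 1 - a + k%:R != 0) ->
  exists D, 0 <= D /\ forall n j, (2 <= n)%N -> (j <= n)%N ->
    let w := Num.sqrt (2 * n%:R) in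
    `|fq a j * gq a n j / Fq a n - 1 - (a - 2^-1 - 3 / 4) * (2 * j%:R / w - 1)| <=
    D * w `^ (3 * `|a - 2^-1| + 1).
Proof.
move=> a1 H; set A := a - 2^-1.
have [C C0 HC] := fq_bound H.
have c0 := c0q_neq0 H.
have A0 : 0 <= `|A| by [].
pose D1 := C * expR `|a| / (`|c0q a| * expR (- (3 / 8))).
have D10 : 0 <= D1 by rewrite divr_ge0 ?mulr_ge0 ?expR_ge0.
exists (D1 + (1 + 2 * `|A - 3 / 4|)); split; first by rewrite !addr_ge0 // mulr_ge0.
move=> n j n2 jn; cbv zeta; set w := Num.sqrt _; have nR : 2 <= n%:R :> R by rewrite ler_nat.
have jR : j%:R <= n%:R :> R by rewrite ler_nat.
have j0 := ler0n R j.
have wE : w ^+ 2 = 2 * n%:R by rewrite sqr_sqrtr; lra.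
have w0 : 0 <= w by exact: sqrtr_ge0.
have w2 : 2 <= w by nra.
have wB p : p <= 3 * `|A| + 1 -> w `^ p <= w `^ (3 * `|A| + 1).
  by move=> h; rewrite ler_powR //; lra.
have w20 : 0 < w / 2 by lra.
have Pw := powR_gt0 A w20.
have P1 : ((w / 2) `^ A)^-1 <= w `^ `|A|.
  rewrite -powRN; apply: (@le_trans _ _ ((w / 2) `^ `|A|)).
    by rewrite ler_powR; [|lra|rewrite -normrN ler_norm].
  by rewrite ge0_ler_powR ?nnegrE //; lra.
have P2 : (1 + j%:R) `^ `|A| <= w `^ `|A| * w `^ `|A|.
  rewrite -powRM // -expr2 wE ge0_ler_powR ?nnegrE //; lra.
have /andP[g0 g1] := gq_bound a1 jn.
have B1 : `|fq a j * gq a n j / Fq a n| <= D1 * w `^ (3 * `|A| + 1).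
  rewrite normrM (normrM (fq a j)) normfV (ger0_norm g0) /Fq (normrM (c0q a * _)) (normrM (c0q a)) -/w -/A.
  rewrite (gtr0_norm Pw) (gtr0_norm (expR_gt0 _)).
  have c1 : 0 < `|c0q a| by rewrite normr_gt0.
  have e3 := expR_gt0 (- (3 / 8) : R).
  rewrite [leLHS](_ : _ = `|fq a j| * gq a n j / (`|c0q a| * expR (- (3 / 8))) * ((w / 2) `^ A)^-1); last first.
    move: (_ `^ _) Pw (expR _) e3 => P P0 E E0; by field; rewrite !gt_eqF.
  apply: (@le_trans _ _ (C * (w `^ `|A| * w `^ `|A|) * expR `|a| / (`|c0q a| * expR (- (3 / 8))) * w `^ `|A|)).
    have i0 : 0 <= (`|c0q a| * expR (- (3 / 8)))^-1 by rewrite invr_ge0 mulr_ge0 ?expR_ge0.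
    apply: ler_pM => //; rewrite ?invr_ge0 ?(ltW Pw) //; first by rewrite !mulr_ge0.
    apply: ler_wpM2r => //; apply: ler_pM => //.
    by apply: le_trans (HC j) _; apply: ler_wpM2l.
  rewrite [leLHS](_ : _ = D1 * (w `^ `|A| * w `^ `|A| * w `^ `|A|)); last by rewrite /D1; ring.
  apply: ler_wpM2l => //.
  have wn : w != 0 by rewrite gt_eqF //; lra.
  rewrite -!powRD ?wn ?implybT //; apply: wB; lra.
have t0 : 0 <= 2 * j%:R / w by rewrite divr_ge0 // mulr_ge0.
have t1 : 2 * j%:R / w <= w by rewrite ler_pdivrMr -?expr2 ?wE //; lra.
have B2 : `|1 + (A - 3 / 4) * (2 * j%:R / w - 1)| <= (1 + 2 * `|A - 3 / 4|) * w.
  apply: le_trans (ler_normD _ _) _; rewrite normr1 normrM.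
  have l0 : 0 <= `|A - 3 / 4| by [].
  have h : `|2 * j%:R / w - 1| <= w by rewrite ler_norml; apply/andP; split; lra.
  by have h2 := ler_wpM2l l0 h; nra.
have B3 : w <= w `^ (3 * `|A| + 1) by rewrite -[leLHS]powRr1 //; apply: wB; lra.
rewrite -addrA -opprD; apply: le_trans (ler_normB _ _) _.
rewrite [leRHS]mulrDl; apply: lerD => //; apply: le_trans B2 _.
by apply: ler_wpM2l => //; rewrite addr_ge0 // mulr_ge0.
Qed.

End QAsymptotics.

(** * Summation against the weights *)

Section QAssemble.
Variable R : realType.
Implicit Types (a b w t : R) (n m j : nat).

(** Exponential Markov inequality on both sides. Multiplying [evw w j] by [2 ^ (- 2 j)] or
    [2 ^ (2 j)] gives the weights of [w / 2] or [2 w]. The constants 3/8 and 9/8 come from the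
    bounds on [ln 2] and leave [expR (7/8 w)] in both cases, as [1/2 + 3/8 = 2 - 9/8]. *)
Lemma tail_weight w j : 0 <= w ->
  ~~ (2^-1 <= 2 * j%:R / w <= 2) -> 0 < w ->
  1 <= 2^-1 ^+ (2 * j) * expR (3 / 8 * w) + 2 ^+ (2 * j) * expR (- (9 / 8 * w)).
Proof.
move=> w0 H wp.
have p2 : 0 < 2 ^+ (2 * j) :> R by rewrite exprn_gt0.
have h1 := exp2_ge R (2 * j); have h2 := exp2_le R (2 * j).
rewrite natrM in h1 h2.
have x1 : 0 <= 2^-1 ^+ (2 * j) * expR (3 / 8 * w) by rewrite mulr_ge0 ?expR_ge0 // exprn_ge0.
have x2 : 0 <= 2 ^+ (2 * j) * expR (- (9 / 8 * w)) by rewrite mulr_ge0 ?expR_ge0 // ltW.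
move: H; rewrite negb_and -!ltNge => /orP[]; rewrite ?ltr_pdivrMr ?ltr_pdivlMr // => h.
  have : 1 <= 2^-1 ^+ (2 * j) * expR (3 / 8 * w); last by lra.
  rewrite exprVn mulrC ler_pdivlMr // mul1r; apply: le_trans h2 _; rewrite ler_expR; lra.
have : 1 <= 2 ^+ (2 * j) * expR (- (9 / 8 * w)); last by lra.
rewrite expRN ler_pdivlMr ?expR_gt0 // mul1r; apply: le_trans h1; rewrite ler_expR; lra.
Qed.

Lemma powR_small (p : R) : 0 < p -> exists2 C, 0 <= C & forall w, 0 <= w ->
  w `^ p * expR (7 / 8 * w) <= C * expR w.
Proof.
move=> p0; exists (8 `^ p * p `^ p); first by rewrite mulr_ge0 ?powR_ge0.
move=> w w0; have w80 : 0 <= w / 8 by rewrite divr_ge0.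
have h := powR_le_expR p0 w80.
have -> : w `^ p = 8 `^ p * (w / 8) `^ p by rewrite -powRM // mulrC divfK.
have -> : expR w = expR (w / 8) * expR (7 / 8 * w) by rewrite -expRD; congr expR; field.
by rewrite -!mulrA; apply: ler_wpM2l; rewrite ?powR_ge0 // [leRHS]mulrA; apply: ler_wpM2r; rewrite ?expR_ge0.
Qed.

Lemma qsum_near1 a : -1 < a -> (forall k, 1 - a + k%:R != 0) ->
  near1 (rsqrt R) (fun n => (\sum_(j < n.+1) evw (Num.sqrt (2 * n%:R)) j * (fq a j * gq a n j)) /
    (Fq a n * (expR (Num.sqrt (2 * n%:R)) / 2))).
Proof.
move=> a1 H.
have [C [N [C0 HC]]] := psi_central H.
have [D [D0 HD]] := psi_outer a1 H.
pose B := 3 * `|a - 2^-1| + 1.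
have B0 : 0 < B + 1 by rewrite /B; have : 0 <= `|a - 2^-1| by []; lra.
have [K K0 HK] := powR_small B0.
pose la := a - 2^-1 - 3 / 4.
have [N2 HN2] := ev_sqrt2n (4 : R).
exists (2 * (C * 10 + D * (2 * K) + `|la| * 2 + 2)), (maxn 2 (maxn N N2)) => n.
rewrite !geq_max => /and3P[n2 nN nN2].
have nR : 2 <= n%:R :> R by rewrite ler_nat.
have n1 : (0 < n)%N by apply: leq_trans n2.
have i_s := inv_sqrt2n_le R n1.
have w4 := HN2 n nN2.
have := HC n ^~ nN; have := HD n ^~ n2; cbv zeta.
have wE : Num.sqrt (2 * n%:R) ^+ 2 = 2 * n%:R :> R by rewrite sqr_sqrtr //; lra.
rewrite -/la -/B; move: i_s w4 wE; set w := Num.sqrt _ => i_s w4 wE {}HD {}HC.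
have w0 : 0 < w by lra.
have w00 := ltW w0.
have F0 := Fq_neq0 n1 H.
have [b1 b2] := ev_od w4 wE.
have E0 := expR_gt0 w.
pose t j : R := 2 * j%:R / w.
pose psi j := fq a j * gq a n j / Fq a n.
pose W j : R := 2^-1 ^+ (2 * j) * expR (3 / 8 * w) + 2 ^+ (2 * j) * expR (- (9 / 8 * w)).
have W0 j : 0 <= W j.
  by rewrite addr_ge0 // mulr_ge0 ?expR_ge0 // exprn_ge0.
have P j : (j <= n)%N -> `|psi j - 1 - la * (t j - 1)| <=
    C * ((t j - 1) ^+ 2 + w^-1) + D * w `^ B * W j.
  move=> jn; have [tt|tt] := boolP (2^-1 <= t j <= 2).
    apply: le_trans (HC j tt) _; by rewrite lerDl mulr_ge0 // mulr_ge0 // powR_ge0.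
  have hd := HD j jn.
  apply: le_trans hd _; have := tail_weight w00 tt w0; rewrite -/(W j) => h.
  apply: (@le_trans _ _ (D * w `^ B * W j)); first by rewrite ler_peMr // mulr_ge0 // powR_ge0.
  by rewrite lerDr mulr_ge0 // addr_ge0 ?sqr_ge0 // invr_ge0.
(* The linear term sums to [od - ev], which stays bounded and so is negligible against [expR w]. *)
have M1 : \sum_(j < n.+1) evw w j * (t j - 1) = od w n - ev w n.
  have := ev_moment1 w n => h; apply: (mulfI (lt0r_neq0 w0)); rewrite -h mulr_sumr.
  by apply: eq_bigr => j _; rewrite /t natrM; field; rewrite gt_eqF.
have M2 : w ^+ 2 * \sum_(j < n.+1) evw w j * (t j - 1) ^+ 2 =
    w ^+ 2 * (2 * (ev w n - od w n) - evw w n) + w * od w n.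
  rewrite -ev_moment2 mulr_sumr.
  by apply: eq_bigr => j _; rewrite /t natrM; field; rewrite gt_eqF.
have Ew : w <= expR w by apply: le_trans (expR_ge1Dx w); lra.
rewrite ler_norml in b1; rewrite ler_norml in b2.
move: b1 b2 => /andP[b1 b1'] /andP[b2 b2'].
(* The variance of [2 j / w] is of order [1 / w]; this gives the denominator its rate
   [n ^ (- 1/2)]. *)
have M2' : \sum_(j < n.+1) evw w j * (t j - 1) ^+ 2 <= 9 * expR w / w.
  have := evw_ge0 w n; set X := \sum_(j < _) _ in M2 *; set v := evw w n in M2 * => v0.
  rewrite ler_pdivlMr // -(ler_pM2l w0) mulrA mulrAC -expr2 M2.
  have q1 : 0 <= w ^+ 2 * v by rewrite mulr_ge0 // sqr_ge0.
  have q2 : w ^+ 2 * (ev w n - od w n) <= w ^+ 2 * 2 by rewrite ler_wpM2l // sqr_ge0.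
  have q3 : w * od w n <= w * (expR w / 2 + 4) by rewrite ler_wpM2l //; lra.
  have q4 : w * w <= w * expR w by rewrite ler_wpM2l.
  have q5 : w * 1 <= w * expR w by rewrite ler_wpM2l //; lra.
  by rewrite expr2 in q1 q2 *; lra.
have SW : \sum_(j < n.+1) evw w j * W j <= 2 * expR (7 / 8 * w).
  have -> : \sum_(j < n.+1) evw w j * W j =
      ev (w / 2) n * expR (3 / 8 * w) + ev (2 * w) n * expR (- (9 / 8 * w)).
    rewrite /ev !mulr_suml -big_split; apply: eq_bigr => j _ /=.
    by rewrite /W mulrDr !mulrA evM2 ev2M.
  have e1 : 0 <= w / 2 by rewrite divr_ge0.
  have e2 : 0 <= 2 * w by rewrite mulr_ge0.
  have h1 : ev (w / 2) n * expR (3 / 8 * w) <= expR (7 / 8 * w).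
    rewrite (_ : 7 / 8 * w = w / 2 + 3 / 8 * w); last by field.
    by rewrite expRD ler_wpM2r ?expR_ge0 // evw_le_exp.
  have h2 : ev (2 * w) n * expR (- (9 / 8 * w)) <= expR (7 / 8 * w).
    rewrite (_ : 7 / 8 * w = 2 * w + - (9 / 8 * w)); last by field.
    by rewrite expRD ler_wpM2r ?expR_ge0 // evw_le_exp.
  lra.
have tailb : w `^ B * (2 * expR (7 / 8 * w)) <= 2 * K * expR w / w.
  rewrite ler_pdivlMr //; have := HK w w00; rewrite powRD ?(gt_eqF w0) ?implybT // powRr1 //.
  move=> h; rewrite (_ : _ * w = 2 * (w `^ B * w * expR (7 / 8 * w))); last by ring.
  by rewrite -[leRHS]mulrA; apply: ler_wpM2l.
have evE := evw_le_exp n w00.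
pose S := \sum_(j < n.+1) evw w j * (fq a j * gq a n j).
have SE : S / Fq a n = ev w n + la * (od w n - ev w n) +
    \sum_(j < n.+1) evw w j * (psi j - 1 - la * (t j - 1)).
  rewrite -M1 mulr_sumr /ev -!big_split /S mulr_suml; apply: eq_bigr => j _ /=.
  by rewrite /psi; ring.
have RB : `|\sum_(j < n.+1) evw w j * (psi j - 1 - la * (t j - 1))| <=
    C * 10 * expR w / w + D * (2 * K) * expR w / w.
  apply: le_trans (ler_norm_sum _ _ _) _.
  apply: (@le_trans _ _ (C * (\sum_(j < n.+1) evw w j * (t j - 1) ^+ 2 + ev w n / w) +
      D * w `^ B * \sum_(j < n.+1) evw w j * W j)).
    rewrite mulrDr !mulr_sumr mulr_suml mulr_sumr -!big_split; apply: ler_sum => j _ /=.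
    rewrite normrM (ger0_norm (evw_ge0 w j)).
    have jn : (j <= n)%N by rewrite -ltnS.
    rewrite [leRHS](_ : _ = evw w j * (C * ((t j - 1) ^+ 2 + w^-1) + D * w `^ B * W j)); last by ring.
    by apply: ler_wpM2l (P j jn); exact: evw_ge0.
  apply: lerD.
    rewrite -2!mulrA; apply: ler_wpM2l => //.
    rewrite (_ : 10 * _ = 9 * expR w / w + expR w / w); last by ring.
    by apply: lerD => //; apply: ler_wpM2r => //; rewrite invr_ge0.
  rewrite -3!mulrA; apply: ler_wpM2l => //; rewrite !mulrA; apply: le_trans _ tailb.
  by apply: ler_wpM2l => //; exact: powR_ge0.
have Z : `|S / Fq a n - expR w / 2| <=
    (C * 10 + D * (2 * K) + `|la| * 2 + 2) * (expR w / w).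
  rewrite SE (_ : _ + _ - _ = (\sum_(j < n.+1) evw w j * (psi j - 1 - la * (t j - 1)) +
     la * (od w n - ev w n)) + (ev w n - expR w / 2)); last by ring.
  have u1 : 1 <= expR w / w by rewrite ler_pdivlMr // mul1r.
  have z1 : `|la * (od w n - ev w n)| <= `|la| * 2 * (expR w / w).
    rewrite normrM -mulrA; apply: ler_wpM2l => //.
    have z : `|od w n - ev w n| <= 2 by rewrite ler_norml; apply/andP; split; lra.
    lra.
  have z2 : `|ev w n - expR w / 2| <= 2 * (expR w / w).
    have z : `|ev w n - expR w / 2| <= 2 by rewrite ler_norml; apply/andP; split; lra.
    lra.
  rewrite [leRHS](_ : _ = (C * 10 * expR w / w + D * (2 * K) * expR w / w +
    `|la| * 2 * (expR w / w)) + 2 * (expR w / w)); last by ring.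
  apply: le_trans (ler_normD _ _) _; apply: lerD => //.
  by apply: le_trans (ler_normD _ _) _; apply: lerD.
have -> : S / (Fq a n * (expR w / 2)) - 1 = (S / Fq a n - expR w / 2) / (expR w / 2).
  by field; rewrite F0 gt_eqF.
rewrite normrM normfV (gtr0_norm (_ : 0 < expR w / 2)) ?divr_gt0 //.
rewrite ler_pdivrMr ?divr_gt0 //; apply: le_trans Z _.
set T := C * 10 + _ + _ + _.
have T0 : 0 <= T by rewrite /T !addr_ge0 // mulr_ge0 // mulr_ge0.
rewrite (_ : 2 * T * rsqrt R n * (expR w / 2) = T * (expR w * rsqrt R n)); last by field.
by apply: ler_wpM2l => //; apply: ler_wpM2l => //; exact: ltW.
Qed.

End QAssemble.

(** * The error *)

Section Final.
Variable R : realType.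
Notation GI := (@eulerGamma_integral R).
Implicit Types (a b x y t s w : R) (n p : nat).

Lemma Gamma_half_sq : Gamma (2^-1 : R) ^+ 2 = pi.
Proof. by rewrite Gamma_pos // GI_half sqr_sqrtr // pi_ge0. Qed.

Definition error_const a : R := 2 * pi * a / Gamma (1 - a).

(** The ingredients are Gauss's limits at [a + 1] (along [n] and along [2 n]), at [1/2] and at
    [a / 2 + 5/4] (along [2 n]), and [(n + 1/2) / n] for the factor [2 n + 1] of [Kc];
    [gbinom (n - a) n] cancels exactly. *)
Lemma const_near1 a : -1 < a -> a != 0 -> (forall k, a + 1 + k%:R != 0) ->
  (forall k, 1 - a + k%:R != 0) ->
  near1 (rinv R) (fun n => Kc a n * expR (- (3 / 8)) * GI (beta0 a n + 1) /
    (gbinom (n%:R - a) n * poch (a + 1) (2 * n) * (Fq a n / 2)) / error_const a).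
Proof.
move=> a1 a0 H1 H2.
have rr := rate_rinv R.
have Hh k : 2^-1 + k%:R != 0 :> R by rewrite gt_eqF // ltr_wpDr.
have N1 := near1_poch H1; have N2 := near1_poch Hh.
have N3 := near1_double rr (@rinv_double R) (near1_gratio (a / 2 + 5 / 4)).
have N4 := near1_double rr (@rinv_double R) N1.
have N5 := near1_lin (2^-1 : R).
have [M2 P2] := near1_neq0 rr N2; have [M4 P4] := near1_neq0 rr N4.
apply: (near1_eq (N := maxn 1 (maxn M2 M4)))
  (near1_div rr (near1M rr N1 N3) (near1M rr N5 (near1M rr N2 N4))) => n.
rewrite !geq_max => /and3P[n1 /P2 u2 /P4 u4].
have nR : 0 < n%:R :> R by rewrite ltr0n.
have n0 : n%:R != 0 :> R by rewrite gt_eqF.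
have nE : n.*2%:R = 2 * n%:R :> R by rewrite -mul2n natrM.
have n2 : n.*2 = (2 * n)%N by rewrite -mul2n.
(* All powers of [n] and 2 become monomials in these four quantities, so that [field] can check the
   cancellation. *)
pose p : R := n%:R `^ (a / 2); pose r : R := n%:R `^ (4^-1).
pose P : R := 2 `^ (a / 2); pose Q : R := 2 `^ (4^-1).
have p0 : p != 0 by rewrite gt_eqF // powR_gt0.
have r0 : r != 0 by rewrite gt_eqF // powR_gt0.
have P0 : P != 0 by rewrite gt_eqF // powR_gt0.
have Q0 : Q != 0 by rewrite gt_eqF // powR_gt0.
have rE : n%:R = r ^+ 4 by rewrite /r -powR_mulrn ?powR_ge0 // -powRrM mulVf // powRr1 // ltW.
have pw1 x (x0 : 0 < x) : x `^ a = (x `^ (a / 2)) ^+ 2.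
  by rewrite -powR_mulrn ?powR_ge0 // -powRrM divfK.
have pw2 x (x0 : 0 < x) : x `^ (a / 2 + 5 / 4 - 1) = x `^ (a / 2) * x `^ 4^-1.
  by rewrite -powRD ?(gt_eqF x0) ?implybT //; congr (_ `^ _); field.
have pw3 : n%:R `^ (2^-1 - 1) = (r ^+ 2)^-1 :> R.
  rewrite /r -powR_mulrn ?powR_ge0 // -powRrM -powRN; congr (_ `^ _); by field.
have pw4 : (Num.sqrt (2 * n%:R) / 2) `^ (a - 2^-1) = (p / r) / (P / Q) :> R.
  have -> : Num.sqrt (2 * n%:R) / 2 = (n%:R / 2) `^ 2^-1 :> R.
    rewrite powR12_sqrt ?divr_ge0 ?(ltW nR) //.
    apply/eqP; rewrite -(eqrXn2 (n := 2)) // ?divr_ge0 ?sqrtr_ge0 //.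
    by rewrite exprMn !sqr_sqrtr ?divr_ge0 ?mulr_ge0 ?(ltW nR) //; apply/eqP; field.
  have pw5 x (x0 : 0 < x) : x `^ (2^-1 * (a - 2^-1)) = x `^ (a / 2) / x `^ 4^-1.
    by rewrite -powRN -powRD ?(gt_eqF x0) ?implybT //; congr (_ `^ _); field.
  have z0 : 0 < n%:R / 2 :> R by rewrite divr_gt0.
  rewrite -powRrM -(pw5 _ nR) -(pw5 2) //.
  have {2}-> : n%:R = (n%:R / 2) * 2 :> R by rewrite divfK.
  by rewrite (powRM _ (ltW z0)) // mulfK // gt_eqF // powR_gt0.
have pw6 : n.*2%:R `^ a = P ^+ 2 * p ^+ 2 :> R.
  by rewrite nE powRM ?(ltW nR) // !pw1.
have pw7 : n.*2%:R `^ (a / 2 + 5 / 4 - 1) = P * Q * (p * r) :> R.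
  by rewrite nE powRM ?(ltW nR) // !pw2.
have g1 := Gamma_neq0 H1; have g2 := Gamma_neq0 H2.
have gh : Gamma (2^-1 : R) != 0 by rewrite gt_eqF // Gamma_half_gt0.
have bE : beta0 a n + 1 = n.*2%:R + (a / 2 + 5 / 4) by rewrite nE /beta0; field.
have p1 := poch_neq0 n H1; have ph := poch_neq0 n Hh.
have p2 := poch_neq0 n.*2 H1.
have f0 : n`!%:R != 0 :> R by rewrite gt_eqF // factR_gt0.
have f2 : (n.*2)`!%:R != 0 :> R by rewrite gt_eqF // factR_gt0.
have H2' k : - a + 1 + k%:R != 0 by rewrite (addrC (- a)).
have gn0 : gbinom (n%:R - a) n != 0.
  by rewrite gbinom_poch mulf_neq0 ?invr_neq0 ?poch_neq0.
have c4 := gbinom_central R n.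
have c4E : gbinom (2 * n%:R) n = 4 ^+ n * poch 2^-1 n / n`!%:R :> R.
  by rewrite -c4 mulfK.
have e4 : 4 ^+ n != 0 :> R by rewrite expf_neq0.
have two : 2 ^+ (2 * n).+1 = 2 * 4 ^+ n :> R by rewrite exprS exprM; congr (_ * _ ^+ n); ring.
have n21 : 2 * n%:R + 1 != 0 :> R by rewrite gt_eqF //; lra.
rewrite /Kc Hf1 c4E two /Fq pw4 bE (gbinom_poch a) -n2 /gratio pw7 !addrK pw6 pw3 (pw1 _ nR) -/p.
rewrite /c0q /error_const -Gamma_half_sq.
move: (GI _) (expR _) (expR_gt0 (- (3 / 8) : R)) => G E /lt0r_neq0 E0.
move: (gbinom _ _) gn0 (poch _ n.*2) p2 (poch (a + 1) n) p1 (poch _ n) ph => gn gn0 p4 p40 p5 p50 p6 p60.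
move: (Gamma (a + 1)) g1 (Gamma (1 - a)) g2 (Gamma _) gh => G1 G10 G2 G20 Gh Gh0.
move: (n`!%:R) f0 ((n.*2)`!%:R) f2 (4 ^+ n) e4 => f f0 F F0 e e0.
rewrite rE in n0 n21 *; clear pw1 pw2 pw3 pw4 pw6 pw7 rE.
move: p p0 r r0 P P0 Q Q0 n0 n21 => p p0 r r0 P P0 Q Q0 n0 n21.
by field; rewrite G20 a0 Gh0 Q0 P0 r0 E0 p0 p40 gn0 e0 f0 p60 n21 F0 G10.
Qed.

Lemma error_near1 a : -1 < a -> a \isn't a Num.int ->
  near1 (rsqrt R) (fun n => (Gamma (a + 1) - p_seq a n / q_seq a n) *
    expR (2 * Num.sqrt (2 * n%:R)) / error_const a).
Proof.
move=> a1 aN.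
have a0 : a != 0 by apply: contra aN => /eqP ->; rewrite rpred0.
have H1 k : a + 1 + k%:R != 0.
  by apply: nonint_add; apply: contra aN => h; rewrite -(addrK 1 a) rpredB // rpred1.
have H2 k : - a + 1 + k%:R != 0.
  apply: nonint_add; apply: contra aN => h.
  by rewrite -rpredN -(addrK 1 (- a)) rpredB // rpred1.
have H2' k : 1 - a + k%:R != 0 by rewrite (addrC 1).
have rr := rate_rsqrt R.
have S1 := qsum_near1 a1 H2'.
have [M HM] := near1_neq0 rr S1.
apply: (near1_eq (N := maxn 1 M)) (near1M rr (near1_div rr (linform_near1 a1 a0 H1 H2) S1)
  (near1_rsqrt (const_near1 a1 a0 H1 H2'))) => n.
rewrite geq_max => /andP[n1 /HM].
set S := \sum_(_ < _) _ => Spos.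
have F0 := Fq_neq0 n1 H2'.
have S0 : S != 0 by apply: contraTneq Spos => ->; rewrite mul0r ltxx.
have K0 := Kc_neq0 n a0 H1 H2.
have nR : 0 < n%:R :> R by rewrite ltr0n.
have gn0 : gbinom (n%:R - a) n != 0.
  by rewrite gbinom_poch mulf_neq0 ?invr_neq0 ?poch_neq0.
have p0 := poch_neq0 (2 * n) H1.
have qE := q_seq_ev a1 H2' n1; rewrite -/S in qE.
have q0 : q_seq a n != 0 by rewrite qE; apply: mulf_neq0 => //; apply: mulf_neq0.
have b0 : 0 < beta0 a n + 1 by rewrite /beta0; lra.
have G0 := lt0r_neq0 (GI_gt0 b0).
have C0 : error_const a != 0.
  have h1 := Gamma_neq0 H2'; have h2 := lt0r_neq0 (pi_gt0 R).
  by rewrite /error_const !mulf_neq0 ?invr_neq0.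
have e1 := expR_gt0 (Num.sqrt (2 * n%:R) : R).
have e2 := lt0r_neq0 (expR_gt0 (- (3 / 8) : R)).
have LE : Gamma (a + 1) - p_seq a n / q_seq a n = linform a n / q_seq a n.
  rewrite /linform Gamma_pos; last by lra.
  by move: (GI _) (q_seq _ _) q0 (p_seq _ _) => x y y0 z; field.
rewrite LE qE (expRM_natl 2) (expRN (Num.sqrt _)).
move: (linform a n) (GI _) G0 (error_const a) C0 (Kc a n) K0 (Fq a n) F0 => l G G0 c C0 K K0 F F0.
move: (gbinom _ _) gn0 (poch _ _) p0 (expR (- _)) e2 (expR _) (lt0r_neq0 e1) => g g0 p p0 e e0 E E0.
by field; rewrite ?G0 ?C0 ?K0 ?F0 ?g0 ?p0 ?e0 ?E0 ?S0.
Qed.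

End Final.

Theorem corollary3 (R : realType) (a : R)
    (a_rat : exists r : rat, a = ratr r)
    (a_nonint : a \isn't a Num.int)
    (a_gtN1 : -1 < a) :
  [/\ recurrence a (p_seq a) /\ recurrence a (q_seq a),
      [/\ p_seq a 0 = 1,
          p_seq a 1 = 3 + a &
          p_seq a 2 = 50 + 33 * a + 7 * a ^+ 2],
      [/\ q_seq a 0 = 1,
          q_seq a 1 = (a + 1) * (3 - a ^+ 2) &
          q_seq a 2 = (a + 1) * (a + 2)
            * (a ^+ 4 + 2 * a ^+ 3 - 12 * a ^+ 2 - 11 * a + 50) / 2] &
      exists h : nat -> R,
        h =O_\oo (fun n : nat => n%:R `^ (- (1 / 2)))
        /\ forall n : nat,
             Gamma (a + 1) - p_seq a n / q_seq a n
             = expR (- (2 * Num.sqrt (2 * n%:R)))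
               * (2 * pi * a / Gamma (1 - a) + h n)].
Proof.
split; [by split; [exact: p_recurrence|exact: q_recurrence]|exact: p_init|exact: q_init|].
(* [h] is forced by the claimed identity; its size follows on multiplying the relative estimate by
   [|error_const a|]. *)
exists (fun n => (Gamma (a + 1) - p_seq a n / q_seq a n) *
  expR (2 * Num.sqrt (2 * n%:R)) - error_const a); split; last first.
  move=> n; rewrite -/(error_const a) addrCA subrr addr0 mulrCA -expRD addNr expR0 mulr1.
  by [].
have [C [N [C0 HC]]] := bigOnC0 (rate_rsqrt R) (error_near1 a_gtN1 a_nonint).
(* The [+ 1] makes the constant strictly positive, as [eqO_exP] requires. *)
apply/eqO_exP; exists (C * `|error_const a| + 1).
  by rewrite ltr_wpDl // mulr_ge0.
exists (maxn 1 N) => // n /=; rewrite geq_max => /andP[n1 /HC].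
have nR : 0 < n%:R :> R by rewrite ltr0n.
have C1 : error_const a != 0.
  have h : Gamma (1 - a) != 0.
    apply: Gamma_neq0 => k; apply: nonint_add; apply: contra (a_nonint) => h.
    by rewrite -(subKr 1 a) rpredB // rpred1.
  apply: contra (a_nonint); rewrite /error_const !mulf_eq0 invr_eq0.
  by rewrite (negPf h) (gt_eqF (pi_gt0 R)) pnatr_eq0 /= orbF => /eqP ->; rewrite rpred0.
have -> : n%:R `^ (- (1 / 2)) = rsqrt R n.
  by rewrite powRN div1r powR12_sqrt // ltW.
set X := _ * expR _; rewrite -(ler_pM2r (_ : 0 < `|error_const a|)) ?normr_gt0 //.
rewrite -normrM mulrBl mul1r divfK // => h; apply: le_trans h _.
have r0 : 0 <= rsqrt R n by rewrite invr_ge0 sqrtr_ge0.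
by rewrite (ger0_norm r0) mulrDl mul1r mulrAC lerDl.
Qed.
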